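(* Let $(M,\varphi)$ be a $\mathrm{G}_2$ manifold. There exists a parallel warped $\mathrm{Spin}(7)$-structure on $N=I_f\times M$ if and only if the fiber $(M,\varphi)$ belongs to $\mathcal{X}_1$, i.e. it is a nearly parallel $\mathrm{G}_2$ manifold, with torsion $\tau_0=-4$. Furthermore, in that case $N=(0,\infty)\times M$ is the cone ($f(t)=t$) with $\mathrm{Spin}(7)$-structure $$\phi=t^3\,\varphi\wedge dt+t^4\ast_7\varphi.$$
   Context: A $\mathrm{G}_2$-structure on a 7-manifold $M$ is a 3-form $\varphi$ locally of the form $e^{127}+e^{347}+e^{567}+e^{135}-e^{146}-e^{236}-e^{245}$ in coframes declared orthonormal and oriented (defining $g_\varphi$, $\ast_7$). It is nearly parallel (class $\mathcal{X}_1$) with torsion $\tau_0$ if $d\varphi=\tau_0\ast_7\varphi$ and $d\ast_7\varphi=0$ (the remaining torsion forms vanish). A $\mathrm{Spin}(7)$-structure on an 8-manifold $N$ is a 4-form $\phi$ locally of the form $e^{1278}+e^{3478}+e^{5678}+e^{1358}-e^{1468}-e^{2368}-e^{2458}+e^{1234}+e^{1256}+e^{3456}+e^{1367}+e^{1457}+e^{2357}-e^{2467}$ in coframes declared orthonormal and oriented (defining $g_\phi$, $\ast_8$). Its torsion forms are the unique $\lambda_1\in\Omega^1(N)$ and $\lambda_5\in\{\gamma\in\Omega^5(N):\phi\wedge\ast_8\gamma=0\}$ with $d\phi=\lambda_1\wedge\phi+\lambda_5$. It is parallel if $\lambda_1=\lambda_5=0$. A warped $\mathrm{Spin}(7)$-structure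 on $N=I_f\times M$ is $\phi=f^3(t)\,\varphi\wedge dt+f^4(t)\ast_7\varphi$, with $I_f$ an open interval with coordinate $t$ and $f$ smooth, nowhere vanishing and nonconstant; then $g_\phi=f^2g_\varphi+dt^2$. Normalization convention: Einstein metrics on the 7-dimensional fiber are rescaled to have Einstein constant $\mu\in\{-6,0,6\}$ and Einstein metrics on $N$ to have Einstein constant $\lambda\in\{-7,0,7\}$, and the warping function of an Einstein warped product is taken to be the corresponding one of: $f=\cosh t$ on $\mathbb{R}$ $(\mu=-6,\lambda=-7)$, $f=e^t$ on $\mathbb{R}$ $(\mu=0,\lambda=-7)$, $f=\sinh t$ on $(0,\infty)$ $(\mu=6,\lambda=-7)$, $f=t$ on $(0,\infty)$ $(\mu=6,\lambda=0)$, $f=\sin t$ on $(0,\pi)$ $(\mu=6,\lambda=7)$. *)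

(* Defs.v *)
From HB Require Import structures.
From mathcomp Require Import all_boot all_order all_algebra all_fingroup.
From mathcomp Require Import all_classical all_reals all_analysis.

Set Implicit Arguments.
Unset Strict Implicit.
Unset Printing Implicit Defensive.

Import Order.TTheory GRing.Theory Num.Theory.
Import numFieldNormedType.Exports.

Local Open Scope classical_set_scope.
Local Open Scope ring_scope.

(* All iterated directional derivatives of f are differentiable at every      *)
(* point of U; for U open this is C^oo on U.                                  *)
Definition smooth_on (R : realType) (V W : normedModType R) (U : set V)
    (f : V -> W) : Prop :=
  forall (vs : seq V) (x : V), U x ->
    differentiable (foldr (fun (v : V) (g : V -> W) => 'D_v g) f vs) x.

Section Manifolds.
Variable R : realType.

(* Charts cmap c : cdom c -> R^n with inverses cinv c; the values of cmap c   *)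
(* and cinv c outside the domain and the image of the chart are irrelevant.   *)
Record atlas (n : nat) (M : topologicalType) := Atlas {
  chart : Type;
  cdom : chart -> set M;
  cmap : chart -> M -> 'rV[R]_n;
  cinv : chart -> 'rV[R]_n -> M }.

Definition cimg n (M : topologicalType) (A : atlas n M) (c : chart A) :
  set 'rV[R]_n := cmap c @` cdom c.

Definition overlap n (M : topologicalType) (A : atlas n M) (c c' : chart A) :
  set 'rV[R]_n := cmap c @` (cdom c `&` cdom c').

Definition transition n (M : topologicalType) (A : atlas n M)
  (c c' : chart A) : 'rV[R]_n -> 'rV[R]_n := cmap c' \o cinv c.

Record smooth_manifold n (M : topologicalType) (A : atlas n M) : Prop :=
  SmoothManifold {
  manifold_hausdorff : hausdorff_space M;
  manifold_second_countable : @second_countable M;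
  cdom_open : forall c : chart A, open (cdom c);
  cimg_open : forall c : chart A, open (cimg c);
  cdom_cover : forall p : M, exists c : chart A, cdom c p;
  cmapK : forall (c : chart A) (p : M), cdom c p -> cinv c (cmap c p) = p;
  cmap_continuous : forall c : chart A, {within cdom c, continuous (cmap c)};
  cinv_continuous : forall c : chart A, {within cimg c, continuous (cinv c)};
  transition_smooth : forall c c' : chart A,
    smooth_on (overlap c c') (transition c c') }.

(* A k-covector on R^n is evaluated on the k rows of a k x n matrix.          *)
Definition covec (k n : nat) := 'M[R]_(k, n) -> R.

Definition is_alternating k n (a : covec k n) : Prop :=
  (forall (v v1 v2 : 'M[R]_(k, n)) (i : 'I_k) (s : R),
     row i v = s *: row i v1 + row i v2 ->
     row' i v = row' i v1 -> row' i v = row' i v2 -> a v = s * a v1 + a v2) /\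
  (forall (v : 'M[R]_(k, n)) (i j : 'I_k), i != j -> row i v = row j v ->
     a v = 0).

(* Normalised so that (e^1 /\ ... /\ e^k)(v) = det (e^i (v_j)).               *)
Definition wedge k l n (a : covec k n) (b : covec l n) : covec (k + l) n :=
  fun v => (k`! * l`!)%:R^-1 *
    \sum_(s : 'S_(k + l)) (-1) ^+ s *
      a (usubmx (row_perm s v)) * b (dsubmx (row_perm s v)).

Definition extd k n (w : 'rV[R]_n -> covec k n) : 'rV[R]_n -> covec k.+1 n :=
  fun x v => \sum_(i < k.+1) (-1) ^+ i * 'D_(row i v) (w^~ (row' i v)) x.

(* A k-form is given by its expressions in the charts of the atlas; only the  *)
(* values at points of cimg c are meaningful.                                 *)
Definition dform n (M : topologicalType) (A : atlas n M) (k : nat) :=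
  chart A -> 'rV[R]_n -> covec k n.

Definition form_eq n (M : topologicalType) (A : atlas n M) k
    (a b : dform A k) : Prop :=
  forall (c : chart A) x, cimg c x -> forall v, a c x v = b c x v.

Record is_form n (M : topologicalType) (A : atlas n M) k (a : dform A k) :
  Prop := IsForm {
  form_alternating : forall (c : chart A) x, cimg c x -> is_alternating (a c x);
  form_smooth : forall (c : chart A) v, smooth_on (cimg c) (fun x => a c x v : R^o);
  form_compatible : forall (c c' : chart A) x v, overlap c c' x ->
    a c x v = a c' (transition c c' x)
                (\matrix_(i < k) 'D_(row i v) (transition c c') x) }.

Definition zero_form n (M : topologicalType) (A : atlas n M) k : dform A k :=
  fun _ _ _ => 0.

Definition form_wedge n (M : topologicalType) (A : atlas n M) k l
    (a : dform A k) (b : dform A l) : dform A (k + l) :=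
  fun c x => wedge (a c x) (b c x).

Definition form_d n (M : topologicalType) (A : atlas n M) k (a : dform A k) :
  dform A k.+1 := fun c => extd (a c).

(* A coframe of R^n is an invertible matrix e whose columns are the covectors *)
(* e^1, ..., e^n; the dual frame consists of the rows of invmx e.             *)
(* e^{i1 ... ik}, with indices starting from 1.                               *)
Definition cobasis n (e : 'M[R]_n.+1) (s : seq nat) : covec (size s) n.+1 :=
  fun v => \det (colsub (fun a : 'I_(size s) => inord (nth 0%N s a).-1) (v *m e)).

(* Hodge star for the metric and orientation making e oriented orthonormal.   *)
Definition coframe_star k l (e : 'M[R]_(k + l)) (a : covec k (k + l)) :
    covec l (k + l) :=
  fun w => k`!%:R^-1 *
    \sum_(f : {ffun 'I_k -> 'I_(k + l)})
      a (rowsub f (invmx e)) * \det (col_mx (rowsub f (invmx e)) w *m e).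

(* A model assigns to every coframe the k-covector having a fixed standard    *)
(* expression in it.                                                          *)
Definition model (k n : nat) := 'M[R]_n -> covec k n.

Definition adapted k n (std : model k n) (a : covec k n) (e : 'M[R]_n) : Prop :=
  e \in unitmx /\ forall v, a v = std e v.

Definition adapted_on n (M : topologicalType) (A : atlas n M) k
    (std : model k n) (w : dform A k) (c : chart A) (U : set 'rV[R]_n)
    (e : 'rV[R]_n -> 'M[R]_n) : Prop :=
  [/\ open U, U `<=` cimg c, smooth_on U e &
      forall x, U x -> adapted std (w c x) (e x)].

Definition is_structure n (M : topologicalType) (A : atlas n M) k
    (std : model k n) (w : dform A k) : Prop :=
  is_form w /\
  forall (c : chart A) x, cimg c x ->
    exists (U : set 'rV[R]_n) (e : 'rV[R]_n -> 'M[R]_n),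
      U x /\ adapted_on std w c U e.

(* For the G2 and Spin(7) models below the star does not depend on the chosen *)
(* adapted coframe, since G2 lies in SO(7) and Spin(7) in SO(8).              *)
Definition form_star k l m (M : topologicalType) (A : atlas (k + l) M)
    (std : model m (k + l)) (w : dform A m) (a : dform A k) : dform A l :=
  fun c x => coframe_star (xget 1%:M [set e | adapted std (w c x) e]) (a c x).

(* The metric of the structure has Einstein constant lambda, computed from    *)
(* Cartan's structure equations in adapted (hence orthonormal) coframes:      *)
(*   de^i = - omega_ij /\ e^j,  omega_ij = - omega_ji,                        *)
(*   Omega_ij = d omega_ij + omega_ik /\ omega_kj,                            *)
(*   Ric (E_j, E_l) = sum_i Omega_ij (E_i, E_l).                              *)
Definition coframe_form n (e : 'rV[R]_n -> 'M[R]_n) (i : 'I_n) :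
  'rV[R]_n -> covec 1 n := fun x v => (v *m e x) 0 i.

Record levi_civita n (U : set 'rV[R]_n) (e : 'rV[R]_n -> 'M[R]_n)
    (omega : 'I_n -> 'I_n -> 'rV[R]_n -> covec 1 n) : Prop := LeviCivita {
  connection_linear : forall i j x, U x -> is_alternating (omega i j x);
  connection_smooth : forall i j v, smooth_on U (fun x => omega i j x v : R^o);
  connection_skew : forall i j x v, U x -> omega i j x v = - omega j i x v;
  connection_torsion_free : forall i x v, U x ->
    extd (coframe_form e i) x v =
    - \sum_j wedge (omega i j x) (coframe_form e j x) v }.

Definition curvature n (omega : 'I_n -> 'I_n -> 'rV[R]_n -> covec 1 n)
    (i j : 'I_n) : 'rV[R]_n -> covec 2 n :=
  fun x v => extd (omega i j) x v +
             \sum_k wedge (omega i k x) (omega k j x) v.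

Definition ricci n (e : 'rV[R]_n -> 'M[R]_n)
    (omega : 'I_n -> 'I_n -> 'rV[R]_n -> covec 1 n) (x : 'rV[R]_n)
    (j l : 'I_n) : R :=
  \sum_i curvature omega i j x
           (col_mx (row i (invmx (e x))) (row l (invmx (e x)))).

Definition einstein n (M : topologicalType) (A : atlas n M) k
    (std : model k n) (w : dform A k) (lambda : R) : Prop :=
  forall (c : chart A) U e omega,
    adapted_on std w c U e -> levi_civita U e omega ->
    forall x (j l : 'I_n), U x -> ricci e omega x j l = lambda * (j == l)%:R.

(* In the product charts of I x M (an open subset of R x M) the coordinate t  *)
(* of I comes last, so that dt plays the role of e^8.                         *)
Definition cylinder n (M : topologicalType) (A : atlas n M) (I : set R) :
  atlas (n + 1) (R^o * M)%type :=
  @Atlas (n + 1) (R^o * M)%type (chart A)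
    (fun c => I `*` cdom c)
    (fun c p => row_mx (cmap c p.2) (p.1)%:M)
    (fun c y => (rsubmx y 0 0, cinv c (lsubmx y))).

Definition pull_form n (M : topologicalType) (A : atlas n M) (I : set R) k
    (a : dform A k) : dform (cylinder A I) k :=
  fun c y v => a c (lsubmx y) (lsubmx v).

Definition dt_form n (M : topologicalType) (A : atlas n M) (I : set R) :
  dform (cylinder A I) 1 := fun _ _ v => rsubmx v 0 0.

End Manifolds.

Arguments cobasis {R n} e s v.
Arguments zero_form {R n M} A k.
Arguments dt_form {R n M} A I.
Arguments pull_form {R n M A} I {k} a.

Section Models.
Variable R : realType.

Definition g2_model : model R 3 7 := fun e v =>
  let E := fun i j k : nat => cobasis e [:: i; j; k] v in
  E 1 2 7 + E 3 4 7 + E 5 6 7 + E 1 3 5 - E 1 4 6 - E 2 3 6 - E 2 4 5.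

Definition spin7_model : model R 4 8 := fun e v =>
  let E := fun i j k l : nat => cobasis e [:: i; j; k; l] v in
  E 1 2 7 8 + E 3 4 7 8 + E 5 6 7 8 + E 1 3 5 8 - E 1 4 6 8 - E 2 3 6 8
  - E 2 4 5 8 + E 1 2 3 4 + E 1 2 5 6 + E 3 4 5 6 + E 1 3 6 7 + E 1 4 5 7
  + E 2 3 5 7 - E 2 4 6 7.

End Models.

Arguments g2_model {R}.
Arguments spin7_model {R}.

Section G2.
Variables (R : realType) (M : topologicalType) (A : atlas R 7 M).

Definition g2_structure (phi : dform A 3) : Prop :=
  is_structure g2_model phi.

Definition g2_star (phi : dform A 3) : dform A 4 :=
  @form_star R 3 4 3 M A g2_model phi phi.

Definition nearly_parallel (phi : dform A 3) (tau0 : R) : Prop :=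
  form_eq (form_d phi) (fun c x v => tau0 * g2_star phi c x v) /\
  form_eq (form_d (g2_star phi)) (zero_form A 5).

End G2.

Section Spin7.
Variables (R : realType) (N : topologicalType) (B : atlas R 8 N).

Definition spin7_structure (Phi : dform B 4) : Prop :=
  is_structure spin7_model Phi.

Definition spin7_star5 (Phi : dform B 4) (g : dform B 5) : dform B 3 :=
  @form_star R 5 3 4 N B spin7_model Phi g.

Definition spin7_torsion_forms (Phi : dform B 4) (l1 : dform B 1) (l5 : dform B 5) :
    Prop :=
  [/\ is_form l1, is_form l5,
      form_eq (form_wedge Phi (spin7_star5 Phi l5)) (zero_form B 7) &
      form_eq (form_d Phi) (fun c x v => form_wedge l1 Phi c x v + l5 c x v)].

Definition spin7_parallel (Phi : dform B 4) : Prop :=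
  spin7_structure Phi /\
  exists (l1 : dform B 1) (l5 : dform B 5),
    [/\ spin7_torsion_forms Phi l1 l5,
        form_eq l1 (zero_form B 1) & form_eq l5 (zero_form B 5)].

End Spin7.

Section Warped.
Variable R : realType.

Definition warping_function (I : set R) (f : R -> R) : Prop :=
  [/\ open I, is_interval I,
      smooth_on (I : set R^o) (f : R^o -> R^o),
      (forall t, I t -> f t != 0) &
      exists s t, [/\ I s, I t & f s != f t]].

(* The normal forms of Einstein warping functions for fibers of Einstein      *)
(* constant mu and total spaces of Einstein constant lambda.                  *)
Definition normal_warping (mu lambda : R) (I : set R) (f : R -> R) : Prop :=
  let normal m l J g :=
    [/\ mu = m, lambda = l, I = J & forall t, I t -> f t = g t] in
  normal (-6) (-7) setT (fun t => (expR t + expR (- t)) / 2) \/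
  normal 0 (-7) setT expR \/
  normal 6 (-7) `]0, +oo[%classic (fun t => (expR t - expR (- t)) / 2) \/
  normal 6 0 `]0, +oo[%classic id \/
  normal 6 7 `]0, pi[%classic sin.

Variables (M : topologicalType) (A : atlas R 7 M) (phi : dform A 3).

Definition warped_form (I : set R) (f : R -> R) : dform (cylinder A I) 4 :=
  let p3 := form_wedge (pull_form I phi) (dt_form A I) in
  let p4 := pull_form I (g2_star phi) in
  fun c y v => let t := (rsubmx (y : 'rV_(7 + 1))) 0 0 in
    f t ^+ 3 * p3 c y v + f t ^+ 4 * p4 c y v.

Arguments warped_form : clear implicits.

Definition warped_einstein (I : set R) (f : R -> R) (lambda : R) : Prop :=
  @einstein R 8 _ (cylinder A I) 4 spin7_model (warped_form I f) lambda.

(* The normalization convention: if the warped product is Einstein, then the  *)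
(* metrics and the warping function are in normal form.                       *)
Definition normalized (I : set R) (f : R -> R) : Prop :=
  (exists lambda, warped_einstein I f lambda) ->
  exists mu lambda, [/\ einstein g2_model phi mu,
    warped_einstein I f lambda & normal_warping mu lambda I f].

Definition parallel_warped (I : set R) (f : R -> R) : Prop :=
  [/\ warping_function I f, normalized I f &
      @spin7_parallel R _ (cylinder A I) (warped_form I f)].

End Warped.

Arguments warped_form {R M A} phi I f.

(* Main.v *)
(* In an adapted coframe of a closed Spin(7)-form the connection matrix takes
   values in spin(7): the 56 components of [d Phi = 0] can be solved for the
   8 * 7 components of the connection transverse to spin(7).  The curvature is
   then spin(7)-valued as well, and the Bianchi identity makes the metric Ricci
   flat.

   Up to signs, [d Phi] is [f^3 (d phi + 4 f' *phi) /\ dt + f^4 d *phi] for the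
   warped form.  Hence [Phi] is closed if and only if [d *phi = 0] and
   [d phi = - 4 f' *phi]; since [*phi] vanishes nowhere, [f'] is then constant,
   and [t] on the half-line is the only affine normal form.  Conversely, if
   [tau_0 = - 4] then the cone is closed, hence Ricci flat, and its explicit
   Levi-Civita connection shows that the fiber has Einstein constant 6.

   The form [*phi] is independent of the adapted coframe because a matrix [g]
   fixing the model 3-form lies in SO(7): it preserves up to [det g] the
   symmetric tensor [(iota_a phi) /\ (iota_b phi) /\ phi]. *)
Require Import Defs.
From HB Require Import structures.
From mathcomp Require Import all_boot all_order all_algebra all_fingroup.
From mathcomp Require Import all_classical all_reals all_analysis.
From mathcomp Require Import zify ring lra.

Set Implicit Arguments.
Unset Strict Implicit.
Unset Printing Implicit Defensive.

Import Order.TTheory GRing.Theory Num.Theory.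
Import numFieldNormedType.Exports.

Local Open Scope classical_set_scope.
Local Open Scope ring_scope.

(** * Smooth functions *)

(** Closedness is a first order condition, whereas the normalization says nothing until the warped
    metric is known to be Einstein. Hence the Ricci tensor of a closed Spin(7)-structure is needed
    in both directions: it makes the normalization applicable in one, and supplies the constant 0 in
    the other. The normalization is also what removes the slope and the translation left in an
    affine [f].

    The algebra is reduced to finite tables. Model forms have integer coefficients indexed by words
    of natural numbers, so that Hodge duality, the invariant tensor and the resolution of
    [d Phi = 0] become boolean checks. The linear system is solvable because the fourteen monomials
    of [Phi] are the blocks of the Steiner system S(3,4,8): for fixed [m], the seven blocks avoiding
    [m] have an invertible 7 x 7 incidence matrix.

    Exterior derivatives are evaluated on constant coordinate vectors: frames are frozen at a point
    and no Lie bracket enters. The Einstein constant 6 = 7 - 1 is the trace of the term [e^i /\ e^j]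
    in the Gauss equation of the cone. *)

Lemma near_eq_differentiable (R : realType) (V W : normedModType R)
    (f g : V -> W) (x : V) :
  {near x, f =1 g} -> differentiable f x -> differentiable g x.
Proof.
move=> fg df.
(* The correction [g - f] vanishes near [x], so its remainder is eventually zero and its
   differential is 0. *)
have -> : g = f + (g - f) by rewrite addrC subrK.
apply: differentiableD => //.
set h := g - f.
have h0 : \forall y \near x, h y = 0.
  by apply: filterS fg => y fgy; rewrite /h !fctE fgy subrr.
have Dh : h \o shift x = cst (h x) + \0 +o_ 0 id.
  apply/eqaddoP => e e0; rewrite (nbhs_singleton h0).
  have : \forall y \near (0 : V), h (y + x) = 0.
    by move: h0; rewrite (near_shift 0) /= ; apply: filterS => y /=; rewrite subr0.
  apply: filterS => y hy; rewrite !fctE /= hy !addr0 subr0 normr0.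
  by rewrite mulr_ge0 // ltW.
apply/diff_locallyP.
have E : 'd h x = \0 :> (V -> W).
  by apply/diff_unique => //; exact: cst_continuous.
by rewrite E; split; first exact: cst_continuous.
Qed.

Section Smooth.
Variables (R : realType) (V : normedModType R).

(* [f] is [n.+1] times differentiable on [U]; unlike [smooth_on] this is
   suited to inductions in which the order of differentiability drops. *)
Fixpoint diff_order (W : normedModType R) (n : nat) (U : set V) (f : V -> W) : Prop :=
  (forall x, U x -> differentiable f x) /\
  (if n is m.+1 then forall v, diff_order m U ('D_v f) else True).

Lemma diff_order0 (W : normedModType R) n U (f : V -> W) x :
  diff_order n U f -> U x -> differentiable f x.
Proof. by case: n => [|n] [df _]; exact: df. Qed.

Lemma diff_orderW (W : normedModType R) n U (f : V -> W) :
  diff_order n.+1 U f -> diff_order n U f.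
Proof.
elim: n f => [|n IH] f [df dDf]; split => // v.
by apply: IH.
Qed.

(** [foldr] applies the last vector first, so derivatives are taken off at the end of the list
    ([rcons]), not at its head. *)
Lemma smooth_onP (W : normedModType R) U (f : V -> W) :
  smooth_on U f <-> forall n, diff_order n U f.
Proof.
split=> [sf n|df vs].
  elim: n f sf => [|n IH] f sf; split => //; try exact: (sf [::]).
  move=> v; apply: IH => vs x Ux.
  by have := sf (rcons vs v) x Ux; rewrite foldr_rcons.
have : diff_order (size vs) U f by [].
move: {2 3}(size vs) (leqnn (size vs)) => n; clear df.
elim/last_ind: vs f n => [|vs v IH] f n.
  by move=> _ df x Ux; exact: diff_order0 df Ux.
rewrite size_rcons foldr_rcons; case: n => // n ltn [_ df].
exact: IH ltn (df v).
Qed.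

Lemma smooth_differentiable (W : normedModType R) (U : set V) (f : V -> W) x :
  smooth_on U f -> U x -> differentiable f x.
Proof. by move=> sf; exact: (sf [::]). Qed.

Lemma smooth_derivable (W : normedModType R) (U : set V) (f : V -> W) x v :
  smooth_on U f -> U x -> derivable f x v.
Proof. by move=> sf /(smooth_differentiable sf)/diff_derivable. Qed.

Lemma smooth_derive (W : normedModType R) (U : set V) (f : V -> W) v :
  smooth_on U f -> smooth_on U ('D_v f).
Proof. by move=> sf vs x Ux; have := sf (rcons vs v) x Ux; rewrite foldr_rcons. Qed.

Lemma smooth_onW (W : normedModType R) (U U' : set V) (f : V -> W) :
  U' `<=` U -> smooth_on U f -> smooth_on U' f.
Proof. by move=> UU sf vs x /UU; exact: sf. Qed.

Lemma eq_derive_on (W : normedModType R) (U : set V) (f g : V -> W) v x :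
  open U -> (forall y, U y -> f y = g y) -> U x -> 'D_v f x = 'D_v g x.
Proof.
move=> oU fg Ux; apply: near_eq_derive.
by apply: filterS fg _; exact: open_nbhs_nbhs.
Qed.

Lemma eq_diff_order (W : normedModType R) n (U : set V) (f g : V -> W) :
  open U -> (forall y, U y -> f y = g y) -> diff_order n U f -> diff_order n U g.
Proof.
move=> oU; elim: n f g => [|n IH] f g fg [df dDf]; split => //.
- move=> x Ux; apply: near_eq_differentiable (df x Ux).
  by apply: filterS fg _; exact: open_nbhs_nbhs.
- move=> x Ux; apply: near_eq_differentiable (df x Ux).
  by apply: filterS fg _; exact: open_nbhs_nbhs.
- by move=> v; apply: IH (dDf v) => y; exact: eq_derive_on.
Qed.

Lemma eq_smooth_on (W : normedModType R) (U : set V) (f g : V -> W) :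
  open U -> (forall y, U y -> f y = g y) -> smooth_on U f -> smooth_on U g.
Proof.
move=> oU fg /smooth_onP df; apply/smooth_onP => n.
exact: eq_diff_order fg (df n).
Qed.

Lemma smooth_cst (W : normedModType R) (U : set V) (a : W) :
  smooth_on U (fun _ : V => a).
Proof.
apply/smooth_onP => n; elim: n a => [|n IH] a; split => // v.
have -> : 'D_v (fun=> a) = (fun=> 0) by apply/funext => x; rewrite derive_cst.
exact: IH.
Qed.

Lemma diff_order_add (W : normedModType R) n (U : set V) (f g : V -> W) : open U ->
  diff_order n U f -> diff_order n U g -> diff_order n U (fun x => f x + g x).
Proof.
move=> oU; elim: n f g => [|n IH] f g [df dDf] [dg dDg]; split => //.
- by move=> x Ux; apply: (differentiableD (df x Ux) (dg x Ux)).
- by move=> x Ux; apply: (differentiableD (df x Ux) (dg x Ux)).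
move=> v; apply: (@eq_diff_order _ _ _ (fun x => 'D_v f x + 'D_v g x)) => //.
  move=> x Ux; rewrite -deriveD //; apply: diff_derivable; [exact: df|exact: dg].
exact: IH (dDf v) (dDg v).
Qed.

Lemma smooth_add (W : normedModType R) (U : set V) (f g : V -> W) :
  open U -> smooth_on U f -> smooth_on U g -> smooth_on U (fun x => f x + g x).
Proof.
move=> oU /smooth_onP sf /smooth_onP sg; apply/smooth_onP => n.
exact: diff_order_add.
Qed.

(** The product rule leaves one factor undifferentiated; its surplus order is dropped by
    [diff_orderW] before the induction hypothesis applies. *)
Lemma diff_order_mul n (U : set V) (f g : V -> R^o) : open U ->
  diff_order n U f -> diff_order n U g ->
  diff_order n U (fun x => f x * g x : R^o).
Proof.
move=> oU; elim: n f g => [|n IH] f g Df Dg; have [df dDf] := Df; have [dg dDg] := Dg.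
  by split=> // x Ux; apply: (differentiableM (df x Ux) (dg x Ux)).
split.
  by move=> x Ux; apply: (differentiableM (df x Ux) (dg x Ux)).
move=> v; apply: (@eq_diff_order _ _ _
    (fun x => f x * 'D_v g x + g x * 'D_v f x)) => //.
  by move=> x Ux; rewrite -deriveM //; apply: diff_derivable; [exact: df|exact: dg].
by apply: diff_order_add => //;
  [exact: IH (diff_orderW Df) (dDg v)|exact: IH (diff_orderW Dg) (dDf v)].
Qed.

Lemma smooth_mul (U : set V) (f g : V -> R^o) :
  open U -> smooth_on U f -> smooth_on U g -> smooth_on U (fun x => f x * g x : R^o).
Proof.
move=> oU /smooth_onP sf /smooth_onP sg; apply/smooth_onP => n.
exact: diff_order_mul.
Qed.

Lemma smooth_sum (W : normedModType R) (I : Type) (r : seq I) (P : pred I)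
    (U : set V) (f : I -> V -> W) :
  open U -> (forall i, smooth_on U (f i)) ->
  smooth_on U (fun x => \sum_(i <- r | P i) f i x).
Proof.
move=> oU sf; elim: r => [|i r IH].
  by under eq_fun do rewrite big_nil; exact: smooth_cst.
under eq_fun do rewrite big_cons.
by case: (P i) => //; exact: smooth_add.
Qed.

Lemma smooth_prod (I : Type) (r : seq I) (P : pred I)
    (U : set V) (f : I -> V -> R^o) :
  open U -> (forall i, smooth_on U (f i)) ->
  smooth_on U (fun x => \prod_(i <- r | P i) f i x : R^o).
Proof.
move=> oU sf; elim: r => [|i r IH].
  by under eq_fun do rewrite big_nil; exact: smooth_cst.
under eq_fun do rewrite big_cons.
by case: (P i) => //; exact: smooth_mul.
Qed.

Lemma smooth_opp (U : set V) (f : V -> R^o) :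
  open U -> smooth_on U f -> smooth_on U (fun x => - f x : R^o).
Proof.
move=> oU sf; under eq_fun do rewrite -mulN1r.
by apply: smooth_mul => //; exact: smooth_cst.
Qed.

Lemma smooth_linear (U : set V) (W : normedModType R) (L : {linear V -> W}) :
  continuous L -> smooth_on U L.
Proof.
move=> cL; have dL x : differentiable L x by exact: linear_differentiable.
apply/smooth_onP => -[|n]; split => // v.
have -> : 'D_v L = (fun=> L v).
  apply/funext => x; rewrite deriveE //.
  by rewrite diff_lin.
by move: n; apply/smooth_onP; exact: smooth_cst.
Qed.

End Smooth.

Section SmoothComp.
Variables (R : realType) (V V' W : normedModType R).

Lemma derive_comp_linear (f : V -> W) (L : {linear V' -> V}) x v :
  continuous L -> differentiable f (L x) -> 'D_v (f \o L) x = 'D_(L v) f (L x).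
Proof.
move=> cL df; have dL : differentiable L x by exact: linear_differentiable.
rewrite deriveE; last exact: differentiable_comp.
by rewrite diff_comp //= diff_lin // deriveE.
Qed.

Lemma smooth_comp_linear (U : set V) (f : V -> W) (L : {linear V' -> V}) :
  continuous L -> open U -> smooth_on U f -> smooth_on (L @^-1` U) (f \o L).
Proof.
move=> cL oU /smooth_onP sf; apply/smooth_onP => n.
have oLU : open (L @^-1` U) by apply: open_comp.
have dL x : differentiable L x by exact: linear_differentiable.
elim: n f {sf}(sf n) => [|n IH] f [df dDf]; split => //.
- move=> x Ux; apply: differentiable_comp => //; exact: df.
- move=> x Ux; apply: differentiable_comp => //; exact: df.
move=> v; apply: (@eq_diff_order _ _ _ _ _ ('D_(L v) f \o L)) => //.
  by move=> x Ux; rewrite derive_comp_linear //; exact: df.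
exact: IH (dDf _).
Qed.

End SmoothComp.

Section SmoothMatrix.
Variables (R : realType) (V : normedModType R) (m n : nat).
Implicit Types (M : V -> 'M[R]_(m, n)) (U : set V).

Lemma derive_entry M x v i j :
  derivable M x v -> 'D_v (fun y => M y i j : R^o) x = ('D_v M x) i j.
Proof. by move=> dM; rewrite derive_mx // mxE. Qed.

Lemma differentiable_entry M x i j :
  differentiable M x -> differentiable (fun y => M y i j : R^o) x.
Proof.
move=> dM; apply: (@differentiable_comp _ _ _ _ M (fun N => N i j : R^o)) => //.
exact: differentiable_coord.
Qed.

Lemma differentiable_mx M x :
  (forall i j, differentiable (fun y => M y i j : R^o) x) -> differentiable M x.
Proof.
move=> dM.
have -> : M = \sum_(i < m) \sum_(j < n) (fun y => M y i j *: delta_mx i j).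
  apply/funext => y; rewrite {1}[M y]matrix_sum_delta fct_sumE.
  by apply: eq_bigr => i _; rewrite fct_sumE.
apply: differentiable_sum => i; apply: differentiable_sum => j.
exact: (differentiableZl _ (dM i j)).
Qed.

Lemma smooth_entry M U i j : open U ->
  smooth_on U M -> smooth_on U (fun y => M y i j : R^o).
Proof.
move=> oU /smooth_onP sM; apply/smooth_onP => k.
elim: k M {sM}(sM k) => [|k IH] M [dM dDM]; split => //.
- by move=> x Ux; apply: differentiable_entry; exact: dM.
- by move=> x Ux; apply: differentiable_entry; exact: dM.
move=> v; apply: eq_diff_order (IH _ (dDM v)) => // x Ux.
by rewrite derive_entry //; apply: diff_derivable; exact: dM.
Qed.

Lemma smooth_mx M U : open U ->
  (forall i j, smooth_on U (fun y => M y i j : R^o)) -> smooth_on U M.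
Proof.
move=> oU sM; apply/smooth_onP => k.
have : forall i j, diff_order k U (fun y => M y i j : R^o).
  by move=> i j; have /smooth_onP := sM i j.
elim: k M {sM} => [|k IH] M dM.
  by split => // x Ux; apply: differentiable_mx => i j; have [] := dM i j; auto.
have dMx x : U x -> differentiable M x.
  by move=> Ux; apply: differentiable_mx => i j; have [] := dM i j; auto.
split=> // v; apply: IH => i j.
have [_ /(_ v)] := dM i j; apply: eq_diff_order => // x Ux.
by rewrite derive_entry //; apply: diff_derivable; exact: dMx.
Qed.

End SmoothMatrix.

(** * Symmetry of second derivatives *)

Section Schwarz.
Variables (R : realType) (V : normedModType R).
Implicit Types (f : V -> R^o).

Lemma is_derive_line f (u y : V) (s : R) :
  differentiable f (s *: u + y) ->
  is_derive (s : R^o) 1 (fun s : R^o => f (s *: u + y)) ('D_u f (s *: u + y)).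
Proof.
move=> df.
have dA : is_diff (s : R^o) (fun s : R^o => s *: u + y) ( *:%R^~ u).
  have -> : (fun s : R^o => s *: u + y) = ( *:%R^~ u) + cst y by [].
  by apply: is_diff_eq; rewrite addr0.
have dfA := @is_diff_comp _ _ _ _ _ _ _ _ _ dA (differentiableP df).
apply: DeriveDef; first by apply: diff_derivable; exact: ex_diff.
by rewrite deriveE ?diff_val /= ?scale1r -?deriveE //; exact: ex_diff.
Qed.

(* The mean value theorem in direction [u] expresses the second difference by
   ['D_u f], which is then replaced by its linear part at [x]. *)
Lemma second_difference f u v x (e : R) :
  (\forall y \near x, differentiable f y) ->
  differentiable ('D_u f) x -> 0 < e ->
  exists2 d : R, 0 < d & forall h, 0 < h < d ->
    `|f (h *: u + (h *: v + x)) - f (h *: v + x) - f (h *: u + x) + f x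
     - h ^+ 2 * 'D_v ('D_u f) x| <= h ^+ 2 * e.
Proof.
move=> nf dF e0; set F := 'D_u f.
(* The linear approximation is used at [xi *: u + h *: v] and at [xi *: u], whose norms add up to at
   most [h * (2 * |u| + |v|)]; the 1 makes [k] positive. *)
set k := 2 * `|u| + `|v| + 1.
have k0 : 0 < k by rewrite /k ltr_wpDl // addr_ge0 // mulr_ge0.
have [d d0 near] : exists2 d : R, 0 < d & forall w, `|w| < d ->
    differentiable f (w + x) /\ `|F (w + x) - F x - 'd F x w| <= e / k * `|w|.
  have /eqaddoP/(_ (e / k) (divr_gt0 e0 k0)) := diff_locally dF.
  have nf0 : \forall w \near (0 : V), differentiable f (w + x).
    by move: nf; rewrite (near_shift 0); apply: filterS => w /=; rewrite subr0.
  move=> nF; have : \forall w \near (0 : V), differentiable f (w + x) /\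
    `|F (w + x) - (F x + 'd F x w)| <= e / k * `|w| by apply: filterI.
  move=> /nbhs_ballP[d /= d0 dP].
  exists d => // w wd; have : ball 0 d w by rewrite -ball_normE /= sub0r normrN.
  by move=> /dP[dfw]; rewrite opprD addrA.
exists (d / k); first exact: divr_gt0.
move=> h /andP[h0 hd].
have hk : h * k < d by rewrite -ltr_pdivlMr.
have u0 := normr_ge0 u; have v0 := normr_ge0 v.
have small s t : 0 <= s <= h -> 0 <= t <= h -> `|s *: u + t *: v| < d.
  move=> /andP[s0 sh] /andP[t0 th]; apply: le_lt_trans (ler_normD _ _) _.
  rewrite !normrZ !ger0_norm //; apply: le_lt_trans hk.
  have := ler_wpM2r u0 sh; have := ler_wpM2r v0 th; rewrite /k; nra.
have dfst s t : 0 <= s <= h -> 0 <= t <= h ->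
    differentiable f (s *: u + (t *: v + x)).
  by move=> hs ht; rewrite addrA; exact: (near _ (small s t hs ht)).1.
have Fst s t (hs : 0 <= s <= h) (ht : 0 <= t <= h) := (near _ (small s t hs ht)).2.
have h0h : 0 <= h <= h by rewrite lexx ltW.
have z0h : 0 <= (0 : R) <= h by rewrite le_refl (ltW h0).
pose g (s : R^o) : R^o := f (s *: u + (h *: v + x)) - f (s *: u + x).
pose g' (s : R^o) : R^o := F (s *: u + (h *: v + x)) - F (s *: u + x).
have dg s : 0 <= s <= h -> is_derive (s : R^o) 1 g (g' s).
  move=> hs; apply: is_deriveB; apply: is_derive_line; first exact: dfst.
  by have := dfst s 0 hs z0h; rewrite scale0r add0r.
have [||xi] := @MVT R g g' 0 h h0.
- by move=> s; rewrite in_itv /= => /andP[s0 sh]; apply: dg; rewrite !ltW.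
- apply: derivable_within_continuous => s; rewrite in_itv /= => hs.
  by have [] := dg s hs.
rewrite in_itv /= => /andP[xi0 xih]; rewrite subr0 /g !scale0r !add0r => gE.
have hxi : 0 <= xi <= h by rewrite !ltW.
have -> : f (h *: u + (h *: v + x)) - f (h *: v + x) - f (h *: u + x) + f x
  = g' xi * h by rewrite -gE; ring.
have F1 := Fst _ _ hxi h0h.
have := Fst _ _ hxi z0h; rewrite scale0r addr0 => F2.
have -> : 'D_v F x = 'd F x v by rewrite deriveE.
have -> : g' xi * h - h ^+ 2 * 'd F x v = h *
   ((F (xi *: u + h *: v + x) - F x - 'd F x (xi *: u + h *: v)) -
    (F (xi *: u + x) - F x - 'd F x (xi *: u))).
  rewrite /g' addrA [X in _ - X - _]linearD [X in _ - (_ + X) - _]linearZ /=.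
  rewrite -[h *: 'd F x v]/(h * 'd F x v); ring.
rewrite normrM gtr0_norm // expr2 -mulrA ler_pM2l //.
apply: le_trans (ler_normB _ _) _; apply: le_trans (lerD F1 F2) _.
rewrite -mulrDr mulrAC ler_pdivrMr // [h * e]mulrC -mulrA ler_pM2l //.
apply: le_trans (lerD (ler_normD _ _) (lexx _)) _.
rewrite !normrZ !ger0_norm ?(ltW h0) ?(ltW xi0) // /k.
have := ler_wpM2r u0 (ltW xih); nra.
Qed.

(** The second difference is symmetric in [u] and [v], so both iterated derivatives are within
    [e / 2] of the same quotient. Differentiability of the two first derivatives at the single point
    [x] suffices, as in Young's theorem. *)
Lemma derive_comm f u v x :
  (\forall y \near x, differentiable f y) ->
  differentiable ('D_u f) x -> differentiable ('D_v f) x ->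
  'D_u ('D_v f) x = 'D_v ('D_u f) x.
Proof.
move=> nf du dv; apply/eqP; rewrite -subr_eq0 -normr_le0.
apply/ler_addgt0Pl => e e0; rewrite addr0.
have e2 : 0 < e / 2 by rewrite divr_gt0.
have [d1 d10 D1] := second_difference v nf du e2.
have [d2 d20 D2] := second_difference u nf dv e2.
pose h := Num.min d1 d2 / 2.
have m0 : 0 < Num.min d1 d2 by rewrite lt_min d10.
have h0 : 0 < h by rewrite divr_gt0.
have hm : h < Num.min d1 d2 by rewrite /h ltr_pdivrMr // ltr_pMr // ltr1n.
have h1 : 0 < h < d1 by rewrite h0 (lt_le_trans hm) // ge_min lexx.
have h2 : 0 < h < d2 by rewrite h0 (lt_le_trans hm) // ge_min lexx orbT.
have := D1 _ h1; have := D2 _ h2.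
rewrite [h *: v + (_ + _)]addrCA.
set a := f _; set b := f _; set c := f _; set p := f x.
set A := 'D_u _ x; set B := 'D_v _ x => E2 E1.
have h20 : 0 < h ^+ 2 by rewrite exprn_gt0.
rewrite -(ler_pM2l h20) -[X in X * `|_|]gtr0_norm // -normrM.
have -> : h ^+ 2 * (A - B) = (a - c - b + p - h ^+ 2 * B) - (a - b - c + p - h ^+ 2 * A).
  by ring.
apply: le_trans (ler_normB _ _) _.
apply: le_trans (lerD E1 E2) _.
by rewrite -mulrDr -splitr.
Qed.

Lemma smooth_derive_comm f (U : set V) u v x :
  open U -> smooth_on U f -> U x -> 'D_u ('D_v f) x = 'D_v ('D_u f) x.
Proof.
move=> oU sf Ux; apply: derive_comm.
- apply: filterS (open_nbhs_nbhs (conj oU Ux)) => y Uy.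
  exact: smooth_differentiable sf Uy.
- exact: smooth_differentiable (smooth_derive u sf) Ux.
- exact: smooth_differentiable (smooth_derive v sf) Ux.
Qed.

End Schwarz.

(** * Multi-indices and tensors *)

Section MultiIndex.
Variable n : nat.

Definition idx k (f : {ffun 'I_k -> 'I_n}) : seq nat :=
  [seq (f i : nat) | i <- enum 'I_k].

Definition fcat k l (f : {ffun 'I_k -> 'I_n}) (h : {ffun 'I_l -> 'I_n}) :
    {ffun 'I_(k + l) -> 'I_n} :=
  [ffun i => match fintype.split i with inl a => f a | inr b => h b end].

(** An explicit list of all multi-indices, so that sums over them can be evaluated by computation
    ([sum_words] makes the link). *)
Fixpoint words k : seq (seq nat) :=
  if k is k'.+1 then [seq x :: w | x <- iota 0 n, w <- words k'] else [:: [::]].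

Lemma mem_words k w : size w = k -> all (fun x => x < n)%N w -> w \in words k.
Proof.
elim: k w => [|k IH] [|x w] //= [sw] /andP[xn wn].
by apply: allpairs_f; rewrite ?mem_iota ?IH.
Qed.

Lemma size_words k w : w \in words k -> size w = k.
Proof.
elim: k w => [|k IH] w; first by rewrite inE => /eqP ->.
by case/allpairsP => -[x v] [_ /IH <- ->].
Qed.

Lemma all_words k w : w \in words k -> all (fun x => x < n)%N w.
Proof.
elim: k w => [|k IH] w; first by rewrite inE => /eqP ->.
by case/allpairsP => -[x v] [/=]; rewrite mem_iota => /andP[_ xn] /IH vn -> /=; rewrite vn andbT.
Qed.

Lemma size_idx k (f : {ffun 'I_k -> 'I_n}) : size (idx f) = k.
Proof. by rewrite size_map size_enum_ord. Qed.

Lemma idx_words k (f : {ffun 'I_k -> 'I_n}) : idx f \in words k.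
Proof.
by apply: mem_words; [exact: size_idx|apply/allP => x /mapP[i _ ->]].
Qed.

Lemma nth_idx k (f : {ffun 'I_k -> 'I_n}) (i : 'I_k) : nth 0%N (idx f) i = f i.
Proof. by rewrite (nth_map i) ?size_enum_ord // nth_ord_enum. Qed.

Lemma fcat_l k l (f : {ffun 'I_k -> 'I_n}) (h : {ffun 'I_l -> 'I_n}) i :
  fcat f h (lshift l i) = f i.
Proof. by rewrite ffunE (unsplitK (inl i)). Qed.

Lemma fcat_r k l (f : {ffun 'I_k -> 'I_n}) (h : {ffun 'I_l -> 'I_n}) i :
  fcat f h (rshift k i) = h i.
Proof. by rewrite ffunE (unsplitK (inr i)). Qed.

Lemma idx_fcat k l (f : {ffun 'I_k -> 'I_n}) (h : {ffun 'I_l -> 'I_n}) :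
  idx (fcat f h) = idx f ++ idx h.
Proof.
apply: (@eq_from_nth _ 0%N); first by rewrite size_cat !size_idx.
rewrite size_idx => i ltikl; rewrite -[i]/(nat_of_ord (Ordinal ltikl)).
move: (Ordinal ltikl) => {ltikl} {}i; rewrite nth_idx nth_cat size_idx.
case: (split_ordP i) => j -> /=; first by rewrite fcat_l -nth_idx.
by rewrite addKn fcat_r -nth_idx.
Qed.

Lemma sum_fcat (V : nmodType) k l (F : {ffun 'I_(k + l) -> 'I_n} -> V) :
  \sum_f F f = \sum_(f : {ffun 'I_k -> 'I_n}) \sum_(h : {ffun 'I_l -> 'I_n})
    F (fcat f h).
Proof.
rewrite pair_big /= (reindex (fun p => fcat p.1 p.2)) //=.
exists (fun F => ([ffun i => F (lshift l i)], [ffun i => F (rshift k i)])).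
  by case=> f h _ /=; congr pair; apply/ffunP => i; rewrite ffunE ?fcat_l ?fcat_r.
move=> f _; apply/ffunP => i; case: (split_ordP i) => j ->.
  by rewrite fcat_l ffunE.
by rewrite fcat_r ffunE.
Qed.

Lemma sum_ffun0 (V : nmodType) (F : {ffun 'I_0 -> 'I_n} -> V) (f0 : {ffun 'I_0 -> 'I_n}) :
  \sum_f F f = F f0.
Proof.
by rewrite (bigD1 f0) //= big1 ?addr0 // => f /eqP[]; apply/ffunP => -[].
Qed.

Lemma sum_ffun1 (V : nmodType) (F : {ffun 'I_1 -> 'I_n} -> V) :
  \sum_f F f = \sum_x F [ffun=> x].
Proof.
rewrite (reindex (fun x : 'I_n => [ffun=> x])) //.
exists (fun f : {ffun _} => f ord0) => [x _|f _]; first by rewrite ffunE.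
by apply/ffunP => i; rewrite ffunE (ord1 i) (ord1 ord0).
Qed.

Lemma idx1 x : idx ([ffun=> x] : {ffun 'I_1 -> 'I_n}) = [:: (x : nat)].
Proof. by rewrite /idx enum_ordSl enum_ord0 /= ffunE. Qed.

Lemma sum_words (V : nmodType) k (F : seq nat -> V) :
  \sum_(f : {ffun 'I_k -> 'I_n}) F (idx f) = \sum_(w <- words k) F w.
Proof.
elim: k F => [|k IH] F.
  have f0 : {ffun 'I_0 -> 'I_n} by apply: finfun; case.
  by rewrite (sum_ffun0 _ f0) /= big_seq1 /idx enum_ord0.
rewrite (@sum_fcat _ 1 k) sum_ffun1 /=.
rewrite big_allpairs_dep -val_enum_ord big_map big_enum /=.
apply: eq_bigr => x _; rewrite -(IH (fun w => F (_ :: w))).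
apply: eq_bigr => f _; congr F.
by rewrite -[_ :: idx f]/([:: (x : nat)] ++ idx f) -idx1; exact: (@idx_fcat 1 k).
Qed.

End MultiIndex.

(* [kdelta f s] is the generalised Kronecker delta, the determinant of the
   matrix with entries [f_p == s_q], computed by expansion along the first row. *)
Fixpoint kdelta (f s : seq nat) : int :=
  if f is x :: f' then
    if x \in s then
      if odd (index x s) then - kdelta f' (rem x s) else kdelta f' (rem x s)
    else 0
  else 1.

Lemma det_kdelta (R : comPzRingType) n (f s : seq nat) :
  size f = n -> size s = n -> uniq s ->
  \det (\matrix_(i < n, j < n) ((nth 0%N f i == nth 0%N s j)%:R : R)) = (kdelta f s)%:~R.
Proof.
elim: n f s => [|n IH] [|x f] // s; first by rewrite det_mx00.
move=> [sf] ss us; rewrite (expand_det_row _ ord0) /=.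
case: ifPn => [xs|xs]; last first.
  rewrite big1 // => j _; rewrite !mxE /=.
  by case: eqP => [E|_]; rewrite ?mul0r //; rewrite E mem_nth ?ss in xs.
have lti : (index x s < n.+1)%N by rewrite -ss index_mem.
pose j := Ordinal lti.
rewrite (bigD1 j) //= big1 ?addr0 => [|i ij]; last first.
  rewrite !mxE /=; case: eqP => [E|_]; rewrite ?mul0r //.
  by case/eqP: ij; apply/val_inj; rewrite /= E index_uniq ?ss.
rewrite !mxE /= nth_index // eqxx mul1r /cofactor /= add0n.
have E : row' ord0 (col' j (\matrix_(i < n.+1, j < n.+1)
      ((nth 0%N (x :: f) i == nth 0%N s j)%:R : R)))
   = \matrix_(i < n, j < n) ((nth 0%N f i == nth 0%N (rem x s) j)%:R : R).
  apply/matrixP => p q; rewrite !mxE /=; congr ((_ == _)%:R).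
  rewrite remE nth_cat size_takel ?index_size // /bump.
  case: ltnP => hq; first by rewrite add0n nth_take.
  by rewrite nth_drop add1n addSn subnKC.
rewrite E IH ?rem_uniq ?size_rem ?ss //.
rewrite -signr_odd; case: odd; rewrite ?expr1 ?expr0 ?mul1r //.
by rewrite mulN1r rmorphN.
Qed.

Section Tensors.
Variables (R : comPzRingType) (n : nat).

(** The covariant tensor with components [c], not assumed alternating, evaluated on the rows of
    [v]. *)
Definition tform k (c : seq nat -> R) (v : 'M[R]_(k, n)) : R :=
  \sum_(f : {ffun 'I_k -> 'I_n}) c (idx f) * \prod_i v i (f i).

Lemma eq_tform k (c c' : seq nat -> R) (v : 'M[R]_(k, n)) :
  c =1 c' -> tform c v = tform c' v.
Proof. by move=> cc; apply: eq_bigr => f _; rewrite cc. Qed.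

Lemma tformD k (c c' : seq nat -> R) (v : 'M[R]_(k, n)) :
  tform (fun l => c l + c' l) v = tform c v + tform c' v.
Proof. by rewrite -big_split; apply: eq_bigr => f _; rewrite mulrDl. Qed.

Lemma tformN k (c : seq nat -> R) (v : 'M[R]_(k, n)) :
  tform (fun l => - c l) v = - tform c v.
Proof. by rewrite /tform -sumrN; apply: eq_bigr => f _; rewrite mulNr. Qed.

Lemma tform_basis k (c : seq nat -> R) (f : {ffun 'I_k -> 'I_n}) :
  tform c (rowsub f 1%:M) = c (idx f).
Proof.
rewrite /tform (bigD1 f) //= [X in _ + X]big1 ?addr0 => [|h hf].
  by rewrite big1 ?mulr1 // => i _; rewrite !mxE eqxx.
have [i fi] : exists i, f i != h i.
  by apply/existsP; rewrite -negb_forall; apply: contraNN hf => /forallP E;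
     apply/eqP/ffunP => i; rewrite (eqP (E i)).
by rewrite (bigD1 i) //= !mxE (negbTE fi) mul0r mulr0.
Qed.

(** The Cauchy-Binet formula before grouping: multilinearity in the rows of [X], with the sum over
    all functions instead of subsets. *)
Lemma det_mul_rowsub k (X : 'M[R]_(k, n)) (Y : 'M[R]_(n, k)) :
  \det (X *m Y) =
  \sum_(f : {ffun 'I_k -> 'I_n}) \det (rowsub f Y) * \prod_i X i (f i).
Proof.
rewrite /determinant; under eq_bigr do under eq_bigr do rewrite mxE.
under eq_bigr do rewrite bigA_distr_bigA mulr_sumr.
rewrite exchange_big /=; apply: eq_bigr => f _; rewrite mulr_suml.
apply: eq_bigr => s _; rewrite -mulrA; congr (_ * _); rewrite -big_split.
by apply: eq_bigr => i _; rewrite !mxE mulrC.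
Qed.

End Tensors.

(** * The model forms and the group G2 *)

(* Indices start from 0 here, and from 1 in [cobasis]. *)
Definition g2_coef (l : seq nat) : int :=
  kdelta l [:: 0; 1; 6]%N + kdelta l [:: 2; 3; 6]%N + kdelta l [:: 4; 5; 6]%N +
  kdelta l [:: 0; 2; 4]%N - kdelta l [:: 0; 3; 5]%N - kdelta l [:: 1; 2; 5]%N -
  kdelta l [:: 1; 3; 4]%N.

Definition g2_dual_coef (l : seq nat) : int :=
  kdelta l [:: 0; 1; 2; 3]%N + kdelta l [:: 0; 1; 4; 5]%N +
  kdelta l [:: 2; 3; 4; 5]%N + kdelta l [:: 0; 2; 5; 6]%N +
  kdelta l [:: 0; 3; 4; 6]%N + kdelta l [:: 1; 2; 4; 6]%N -
  kdelta l [:: 1; 3; 5; 6]%N.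

(** A transparent sum that [vm_compute] can evaluate, unlike the locked big operator. *)
Definition sumz (T : Type) (r : seq T) (F : T -> int) : int :=
  foldr (fun x s => F x + s) 0 r.

Lemma sumzE (T : Type) (r : seq T) (F : T -> int) : sumz r F = \sum_(x <- r) F x.
Proof. by rewrite unlock; elim: r => //= x r ->. Qed.

(** Pruning zeros makes the triple sum below feasible: 6, 6 and 42 words instead of 7^2, 7^2 and
    7^3. *)
Definition support (c : seq nat -> int) (ws : seq (seq nat)) : seq (seq nat * int) :=
  [seq p <- [seq (w, c w) | w <- ws] | p.2 != 0].

(* The coefficient of [e^0 /\ ... /\ e^6] in
   (iota_a phi) /\ (iota_b phi) /\ phi, up to a constant. *)
Definition g2_metric_check : bool :=
  let s3 := support g2_coef (words 7 3) in
  let s2 := [seq support (fun l => g2_coef (a :: l)) (words 7 2) | a <- iota 0 7] in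
  all (fun a => all (fun b =>
    sumz (nth [::] s2 a) (fun p => sumz (nth [::] s2 b) (fun q => sumz s3 (fun r =>
      p.2 * q.2 * r.2 * kdelta (p.1 ++ q.1 ++ r.1) (iota 0 7)))) ==
    if a == b then 144%:Z else 0) (iota 0 7)) (iota 0 7).

(** Hodge duality of the two model forms; the factor 6 = 3! counts the orderings of each triple. *)
Definition g2_star_check : bool :=
  let s3 := support g2_coef (words 7 3) in
  all (fun l => sumz s3 (fun p => p.2 * kdelta (p.1 ++ l) (iota 0 7)) ==
     6%:Z * g2_dual_coef l) (words 7 4).

Lemma g2_metric_checkT : g2_metric_check. Proof. by vm_compute. Qed.

Lemma g2_star_checkT : g2_star_check. Proof. by vm_compute. Qed.

Lemma sum_support (c F : seq nat -> int) ws :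
  \sum_(w <- ws) c w * F w = \sum_(p <- support c ws) p.2 * F p.1.
Proof.
rewrite /support big_filter big_map [RHS]big_mkcond /=.
by apply: eq_bigr => w _; case: eqP => //= ->; rewrite mul0r.
Qed.

Lemma det_colsub_tform (R : comPzRingType) n k (s : seq nat) (v : 'M[R]_(k, n.+1)) :
  size s = k -> uniq s -> all (fun i => i < n.+1)%N s ->
  \det (colsub (fun a : 'I_k => inord (nth 0%N s a)) v) =
  tform (fun l => (kdelta l s)%:~R) v.
Proof.
move=> ss us /allP ls.
have -> : colsub (fun a : 'I_k => inord (nth 0%N s a)) v =
    v *m colsub (fun a : 'I_k => inord (nth 0%N s a)) 1%:M.
  by rewrite mulmx_colsub mulmx1.
rewrite det_mul_rowsub /tform; apply: eq_bigr => f _; congr (_ * _).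
rewrite -(det_kdelta _ (size_idx f) ss us); congr (\det _).
apply/matrixP => i j; rewrite !mxE nth_idx -val_eqE /= inordK //.
by apply: ls; rewrite mem_nth ?ss.
Qed.

Lemma sum_exchange3 (R : comPzRingType) (I J K U V W : finType)
    (A : U -> R) (B : V -> R) (C : W -> R)
    (P : I -> U -> R) (Q : J -> V -> R) (S : K -> W -> R) (e : I -> J -> K -> R) :
  \sum_i \sum_j \sum_k (\sum_u A u * P i u) * (\sum_v B v * Q j v) *
     (\sum_w C w * S k w) * e i j k =
  \sum_u \sum_v \sum_w A u * B v * C w *
     \sum_i \sum_j \sum_k P i u * Q j v * S k w * e i j k.
Proof.
transitivity (\sum_(x : I * J * K) \sum_(y : U * V * W)
   A y.1.1 * B y.1.2 * C y.2 *
   (P x.1.1 y.1.1 * Q x.1.2 y.1.2 * S x.2 y.2 * e x.1.1 x.1.2 x.2)).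
  rewrite [LHS]pair_big /= [LHS]pair_big /=; apply: eq_bigr => -[[i j] k] _ /=.
  rewrite big_distrlr /= pair_big /= big_distrlr /= pair_big /= mulr_suml.
  by apply: eq_bigr => -[[u v] w] _ /=; ring.
rewrite exchange_big [RHS]pair_big /= [RHS]pair_big /=.
apply: eq_bigr => -[[u v] w] _ /=.
by rewrite pair_big /= pair_big /= mulr_sumr.
Qed.

Section G2Tensor.
Variable R : realFieldType.
Local Notation phi0 := (fun l => (g2_coef l)%:~R : R).
Local Notation psi0 := (fun l => (g2_dual_coef l)%:~R : R).
Local Notation eps := (fun l => (kdelta l (iota 0 7))%:~R : R).

Lemma det_rowsub_eps (f : {ffun 'I_7 -> 'I_7}) :
  \det (rowsub f 1%:M : 'M[R]_7) = eps (idx f).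
Proof.
apply: etrans (det_kdelta R (size_idx f) (erefl : size (iota 0 7) = 7%N) isT).
by congr (\det _); apply/matrixP => i j; rewrite !mxE nth_idx nth_iota.
Qed.

Lemma det_eps (A : 'M[R]_7) : \det A = tform eps A.
Proof.
rewrite -[A in LHS]mulmx1 det_mul_rowsub /tform; apply: eq_bigr => f _.
by rewrite det_rowsub_eps.
Qed.

Definition g2_metric (a b : 'I_7) : R :=
  \sum_(f : {ffun 'I_2 -> 'I_7}) \sum_(g : {ffun 'I_2 -> 'I_7})
  \sum_(h : {ffun 'I_3 -> 'I_7})
    phi0 ((a : nat) :: idx f) * phi0 ((b : nat) :: idx g) * phi0 (idx h) *
    eps (idx f ++ idx g ++ idx h).

(** Here 144 = 2! * 2! * 3! * 6: the factorials come from summing over all words, and 6 from the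
    identity [(iota_a phi) /\ (iota_a phi) /\ phi = 6 vol]. *)
Lemma g2_metricE a b : g2_metric a b = 144 * (a == b)%:R.
Proof.
pose K f g h : int := g2_coef ((a : nat) :: f) * (g2_coef ((b : nat) :: g) *
   (g2_coef h * kdelta (f ++ g ++ h) (iota 0 7))).
have -> : g2_metric a b = (\sum_(f <- words 7 2) \sum_(g <- words 7 2)
    \sum_(h <- words 7 3) K f g h)%:~R.
  rewrite /g2_metric rmorph_sum -(@sum_words 7 _ 2); apply: eq_bigr => f _.
  rewrite rmorph_sum -(@sum_words 7 _ 2); apply: eq_bigr => g _.
  rewrite rmorph_sum -(@sum_words 7 _ 3); apply: eq_bigr => h _.
  by rewrite /K !rmorphM !mulrA.
have /allP/(_ (a : nat)) := g2_metric_checkT; rewrite mem_iota ltn_ord => /(_ isT).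
move=> /allP/(_ (b : nat)); rewrite mem_iota ltn_ord => /(_ isT)/eqP.
rewrite !(nth_map 0%N) ?size_iota // !nth_iota // !add0n => E.
have -> : 144 * (a == b)%:R = (if (a : nat) == b then 144%:Z else 0)%:~R :> R.
  by rewrite val_eqE; case: eqP; rewrite ?mulr1 ?mulr0.
rewrite -E sumzE; congr (_%:~R).
under eq_bigr => f _ do under eq_bigr => g _ do rewrite /K -!mulr_sumr.
under eq_bigr => f _ do rewrite -mulr_sumr.
rewrite sum_support; apply: eq_bigr => p _; rewrite sumzE sum_support mulr_sumr.
apply: eq_bigr => q _; rewrite sumzE sum_support !mulr_sumr.
by apply: eq_bigr => r _; rewrite !mulrA.
Qed.

(** Invariance lets [g] be inserted in every slot of the three factors [phi]. Two copies of [g]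
    remain on the free indices [a] and [b]; the other seven are contracted with the volume tensor
    and produce [det g]. *)
Lemma g2_metric_change (g : 'M[R]_7) (a b : 'I_7) :
  (forall v : 'M[R]_(3, 7), tform phi0 (v *m g) = tform phi0 v) ->
  g2_metric a b = \det g * \sum_c \sum_d g a c * g b d * g2_metric c d.
Proof.
move=> gphi.
have phiE (f : {ffun 'I_3 -> 'I_7}) : phi0 (idx f) =
    \sum_(f' : {ffun 'I_3 -> 'I_7}) phi0 (idx f') * \prod_i g (f i) (f' i).
  rewrite -(tform_basis phi0) -gphi /tform; apply: eq_bigr => f' _; congr (_ * _).
  by apply: eq_bigr => i _; rewrite mul_rowsub_mx mul1mx mxE.
have phi1E (x : 'I_7) (f : {ffun 'I_2 -> 'I_7}) : phi0 ((x : nat) :: idx f) =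
    \sum_c \sum_(f' : {ffun 'I_2 -> 'I_7})
      g x c * (phi0 ((c : nat) :: idx f') * \prod_i g (f i) (f' i)).
  have E1 (y : 'I_7) (h : {ffun 'I_2 -> 'I_7}) :
      (y : nat) :: idx h = idx (@fcat 7 1 2 [ffun=> y] h).
    by rewrite (idx_fcat ([ffun=> y] : {ffun 'I_1 -> _}) h) idx1.
  rewrite E1 phiE (@sum_fcat _ _ 1 2) sum_ffun1; apply: eq_bigr => c _.
  apply: eq_bigr => f' _; rewrite -E1 mulrCA; congr (_ * _).
  rewrite (@big_split_ord _ _ _ 1 2) /= big_ord1. rewrite !(@fcat_l 7 1 2) !ffunE; congr (_ * _).
  by apply: eq_bigr => i _; rewrite !(@fcat_r 7 1 2).
have epsE (f' g' : {ffun 'I_2 -> 'I_7}) (h' : {ffun 'I_3 -> 'I_7}) :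
   \det g * eps (idx f' ++ idx g' ++ idx h') =
   \sum_(f : {ffun 'I_2 -> 'I_7}) \sum_(k : {ffun 'I_2 -> 'I_7})
   \sum_(h : {ffun 'I_3 -> 'I_7}) (\prod_i g (f i) (f' i) * \prod_i g (k i) (g' i) *
      \prod_i g (h i) (h' i)) * eps (idx f ++ idx k ++ idx h).
  pose F' : {ffun 'I_7 -> 'I_7} := @fcat 7 2 5 f' (@fcat 7 2 3 g' h').
  have -> : idx f' ++ idx g' ++ idx h' = idx F'.
    by rewrite (@idx_fcat 7 2 5) (@idx_fcat 7 2 3).
  rewrite -det_rowsub_eps mulrC -[\det g]det_tr -det_mulmx mul_rowsub_mx mul1mx.
  rewrite -[rowsub _ _]mulmx1 det_mul_rowsub (@sum_fcat _ _ 2 5).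
  apply: eq_bigr => f _; rewrite (@sum_fcat _ _ 2 3); apply: eq_bigr => k _.
  apply: eq_bigr => h _; rewrite det_rowsub_eps mulrC; congr (_ * _); last first.
    by rewrite (@idx_fcat 7 2 5) (@idx_fcat 7 2 3).
  rewrite (@big_split_ord _ _ _ 2 5) /= (@big_split_ord _ _ _ 2 3) /= mulrA.
  by congr (_ * _ * _); apply: eq_bigr => i _; rewrite !mxE ?(@fcat_l 7 2 5) ?(@fcat_r 7 2 5)
    ?(@fcat_l 7 2 3) ?(@fcat_r 7 2 3).
rewrite /g2_metric.
pose A (x : 'I_7) (u : 'I_7 * {ffun 'I_2 -> 'I_7}) : R :=
  g x u.1 * phi0 ((u.1 : nat) :: idx u.2).
pose P (f : {ffun 'I_2 -> 'I_7}) (u : 'I_7 * {ffun 'I_2 -> 'I_7}) : R :=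
  \prod_i g (f i) (u.2 i).
pose S (h h' : {ffun 'I_3 -> 'I_7}) : R := \prod_i g (h i) (h' i).
have phi2E (x : 'I_7) (f : {ffun 'I_2 -> 'I_7}) : phi0 ((x : nat) :: idx f) = \sum_u A x u * P f u.
  by rewrite phi1E pair_big; apply: eq_bigr => u _; rewrite mulrA.
under eq_bigr => f _ do under eq_bigr => k _ do under eq_bigr => h _ do
  rewrite !phi2E phiE.
rewrite (@sum_exchange3 R _ _ _ _ _ _ (A a) (A b) (fun h => phi0 (idx h)) P P S
  (fun f k h => eps (idx f ++ idx k ++ idx h))).
pose T (f' k' : {ffun 'I_2 -> 'I_7}) (h' : {ffun 'I_3 -> 'I_7}) : R := phi0 (idx h') * (\det g * eps (idx f' ++ idx k' ++ idx h')).
transitivity (\sum_u \sum_v \sum_h' A a u * A b v * T u.2 v.2 h').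
  apply: eq_bigr => u _; apply: eq_bigr => v _; apply: eq_bigr => h' _.
  by rewrite /T epsE mulrA.
rewrite -(pair_bigA _ (fun c f' => \sum_v \sum_h' A a (c, f') * A b v * T f' v.2 h')) /=.
rewrite mulr_sumr; apply: eq_bigr => c _; rewrite mulr_sumr exchange_big /=.
rewrite -(pair_bigA _ (fun d k' => \sum_f' \sum_h'
    A a (c, f') * A b (d, k') * T f' k' h')) /=.
apply: eq_bigr => d _; rewrite exchange_big /= !mulr_sumr.
apply: eq_bigr => f' _; rewrite !mulr_sumr; apply: eq_bigr => k' _.
rewrite !mulr_sumr; apply: eq_bigr => h' _; rewrite /A /T /=; ring.
Qed.

(* The tensor [g2_metric] is a multiple of the identity, so its transformation
   law reads [det g * (g g^T) = 1]; taking determinants gives [det g ^ 9 = 1]. *)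
Lemma g2_stabilizer (g : 'M[R]_7) :
  (forall v : 'M[R]_(3, 7), tform phi0 (v *m g) = tform phi0 v) ->
  \det g = 1 /\ g *m g^T = 1%:M.
Proof.
move=> gphi.
have E a b : \det g * (g *m g^T) a b = (a == b)%:R.
  have n144 : (144 : R) != 0 by rewrite pnatr_eq0.
  apply: (mulfI n144); rewrite -g2_metricE (g2_metric_change _ _ gphi).
  rewrite mulrCA; congr (_ * _); rewrite mxE mulr_sumr; apply: eq_bigr => c _.
  rewrite (bigD1 c) //= big1 ?addr0 => [|d dc]; last first.
    by rewrite g2_metricE eq_sym (negbTE dc) !mulr0.
  by rewrite g2_metricE eqxx mulr1 mulrC mxE.
have D : \det g *: (g *m g^T) = 1%:M by apply/matrixP => a b; rewrite !mxE -E mxE.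
have d9 : \det g ^+ 9 = 1.
  have := congr1 determinant D; rewrite detZ det_mulmx det_tr det1 => <-; ring.
have d1 : \det g = 1.
  have := d9; set x := \det g => x9.
  have x0 : 0 <= x by rewrite -(@exprn_odd_ge0 _ 9) // x9 ler01.
  by apply/eqP; rewrite -(@pexpr_eq1 _ _ 9) // x9.
by split => //; rewrite -D d1 scale1r.
Qed.

Lemma det_col_mx_basis (f : {ffun 'I_3 -> 'I_7}) (w : 'M[R]_(4, 7)) :
  \det (col_mx (rowsub f 1%:M) w : 'M[R]_7) = tform (fun l => eps (idx f ++ l)) w.
Proof.
rewrite det_eps /tform (@sum_fcat _ _ 3 4) (bigD1 f) //= [X in _ + X]big1 ?addr0.
  apply: eq_bigr => h _; rewrite (@idx_fcat 7 3 4); congr (_ * _).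
  rewrite (@big_split_ord _ _ _ 3 4) /= [X in X * _]big1 ?mul1r => [|i _].
    by apply: eq_bigr => i _; rewrite (@col_mxEd R 3 4 7) (@fcat_r 7 3 4).
  by rewrite (@col_mxEu R 3 4 7) (@fcat_l 7 3 4) !mxE eqxx.
move=> f' ff'; apply: big1 => h _.
have [i fi] : exists i, f i != f' i.
  by apply/existsP; rewrite -negb_forall; apply: contraNN ff' => /forallP E;
     apply/eqP/ffunP => i; rewrite (eqP (E i)).
rewrite (bigD1 (lshift 4 i : 'I_7)) //= (@col_mxEu R 3 4 7) (@fcat_l 7 3 4) !mxE (negbTE fi).
by rewrite mul0r mulr0.
Qed.

Lemma g2_star_tform (w : 'M[R]_(4, 7)) :
  6^-1 * \sum_(f : {ffun 'I_3 -> 'I_7})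
    phi0 (idx f) * \det (col_mx (rowsub f 1%:M) w : 'M[R]_7) = tform psi0 w.
Proof.
under eq_bigr => f _ do rewrite det_col_mx_basis /tform mulr_sumr.
rewrite exchange_big mulr_sumr; apply: eq_bigr => h _ /=.
have /allP/(_ _ (idx_words h))/eqP E := g2_star_checkT.
have n6 : (6 : R) != 0 by rewrite pnatr_eq0.
have -> : psi0 (idx h) = 6^-1 * (6%:Z * g2_dual_coef (idx h))%:~R.
  by rewrite intrM mulKf.
rewrite -E sumzE -mulrA; congr (_ * _).
rewrite -(sum_support g2_coef (fun l => kdelta (l ++ idx h) (iota 0 7))).
rewrite rmorph_sum mulr_suml -(@sum_words 7 _ 3); apply: eq_bigr => f _.
by rewrite rmorphM mulrA.
Qed.

Lemma det_col_mx_top (X : 'M[R]_(3, 7)) (w : 'M[R]_(4, 7)) :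
  \det (col_mx X w : 'M[R]_7) = \sum_(f : {ffun 'I_3 -> 'I_7})
    \det (col_mx (rowsub f 1%:M) w : 'M[R]_7) * \prod_i X i (f i).
Proof.
under eq_bigr => f _ do rewrite det_col_mx_basis /tform mulr_suml.
rewrite det_eps /tform (@sum_fcat _ _ 3 4); apply: eq_bigr => f _.
apply: eq_bigr => h _; rewrite (@idx_fcat 7 3 4) -mulrA; congr (_ * _).
rewrite (@big_split_ord _ _ _ 3 4) /= mulrC.
by congr (_ * _); apply: eq_bigr => i _;
  rewrite ?(@col_mxEu R 3 4 7) ?(@col_mxEd R 3 4 7) ?(@fcat_l 7 3 4) ?(@fcat_r 7 3 4).
Qed.

(** The star formula uses only [phi], the volume and the metric. As [det g = 1] and [g^T *m g = 1],
    the matrix [g] acting on [w] can be moved to the three top rows as [g^T], where invariance of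
    [phi] absorbs it. *)
Lemma g2_dual_invariant (g : 'M[R]_7) (w : 'M[R]_(4, 7)) :
  (forall v : 'M[R]_(3, 7), tform phi0 (v *m g) = tform phi0 v) ->
  tform psi0 (w *m g) = tform psi0 w.
Proof.
move=> gphi; have [dg gg] := g2_stabilizer gphi.
have gg' : g^T *m g = 1%:M by exact: mulmx1C.
rewrite -!g2_star_tform; congr (_ * _).
transitivity (\sum_(f : {ffun 'I_3 -> 'I_7}) tform phi0 (rowsub f 1%:M) *
   \det (col_mx (rowsub f g^T) w : 'M[R]_7)).
  apply: eq_bigr => f _; rewrite tform_basis; congr (_ * _).
  rewrite -[RHS]mulr1 -[X in _ * X]dg -det_mulmx.
  by rewrite (@mul_col_mx R 3 4 7 7) mul_rowsub_mx gg'.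
under eq_bigr => f _ do rewrite det_col_mx_top mulr_sumr.
rewrite exchange_big; apply: eq_bigr => h _ /=.
rewrite -(tform_basis phi0 h) -[in RHS]gphi mul_rowsub_mx mul1mx mulr_suml.
apply: eq_bigr => f _; rewrite tform_basis mulrA mulrAC; congr (_ * _ * _).
by apply: eq_bigr => i _; rewrite !mxE.
Qed.
End G2Tensor.

(** * Alternating covectors and coframes *)

Lemma lift_perm_inj n (i0 : 'I_n.+1) :
  injective (fun p : 'I_n.+1 * 'S_n => lift_perm i0 p.1 p.2).
Proof.
move=> [i s] [j t] /= E; have /permP Ex := E.
have Ei : i = j by have := Ex i0; rewrite !lift_perm_id.
rewrite Ei in Ex *; congr pair; apply/permP => k.
by have := Ex (lift i0 k); rewrite !lift_perm_lift => /lift_inj.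
Qed.

Lemma sum_lift_perm (V : nmodType) n (i0 : 'I_n.+1) (F : 'S_n.+1 -> V) :
  \sum_s F s = \sum_i \sum_s F (lift_perm i0 i s).
Proof.
rewrite pair_big /= (reindex (fun p : 'I_n.+1 * 'S_n => lift_perm i0 p.1 p.2)) //.
apply: onW_bij; apply: inj_card_bij (@lift_perm_inj n i0) _.
by rewrite card_prod !card_Sn card_ord factS.
Qed.

Lemma odd_cast_perm m n (E : m = n) (s : 'S_m) : cast_perm E s = s :> bool.
Proof. by case: n / E; rewrite cast_perm_id. Qed.

Section CovectorAlgebra.
Variables (R : realType) (n : nat).

(** The sign rule alone, without linearity, is what the expansion of [wedge] uses. *)
Definition perm_alternating k (a : covec R k n) :=
  forall (s : 'S_k) v, a (row_perm s v) = (-1) ^+ s * a v.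

(** Permutations are grouped by the row [i] that they send to [b]: the [k!] members of a group
    contribute equally and cancel the normalising factor, and moving row [i] to the last place costs
    [(-1) ^+ (k + i)]. The cast bridges [k.+1] and [k + 1]. *)
Lemma wedge_covec1 k (a : covec R k n) (b : covec R 1 n) (v : 'M[R]_(k.+1, n)) :
  perm_alternating a ->
  wedge a b (castmx (esym (addn1 k), erefl n) v) =
  \sum_(i < k.+1) (-1) ^+ (k + i) * a (row' i v) * b (row i v).
Proof.
move=> alt; rewrite /wedge -[(1`!)%N]/1%N muln1.
have kn0 : k`!%:R != 0 :> R by rewrite pnatr_eq0 -lt0n fact_gt0.
apply: (mulfI kn0); rewrite mulVKf //.
pose cast (s : 'S_k.+1) : 'S_(k + 1) := cast_perm (esym (addn1 k)) s.
rewrite (reindex cast) /=; last first.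
  exists (cast_perm (addn1 k)) => s _; rewrite /cast; first exact: cast_permKV.
  exact: cast_permK.
rewrite (sum_lift_perm ord_max) mulr_sumr; apply: eq_bigr => i _.
transitivity (\sum_(s : 'S_k) ((-1) ^+ (k + i) * a (row' i v) * b (row i v))); last first.
  by rewrite sumr_const card_Sn mulr_natl.
apply: eq_bigr => s _.
have -> : usubmx (row_perm (cast (lift_perm ord_max i s))
    (castmx (esym (addn1 k), erefl n) v)) = row_perm s (row' i v).
  apply/matrixP => p q; rewrite !mxE castmxE /=; congr (v _ _); last exact/val_inj.
  apply/val_inj; rewrite /= /cast cast_permE /=.
  have -> : cast_ord (esym (esym (addn1 k))) (lshift 1 p) = lift ord_max p.
    by apply/val_inj; rewrite /= /bump leqNgt ltn_ord.
  by rewrite lift_perm_lift.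
have -> : dsubmx (row_perm (cast (lift_perm ord_max i s))
    (castmx (esym (addn1 k), erefl n) v)) = row i v.
  apply/matrixP => p q; rewrite !mxE castmxE /=; congr (v _ _); last exact/val_inj.
  apply/val_inj; rewrite /= /cast cast_permE /=.
  have -> : cast_ord (esym (esym (addn1 k))) (rshift k p) = ord_max.
    by apply/val_inj; rewrite /= (ord1 p) addn0.
  by rewrite lift_perm_id.
rewrite alt !mulrA; congr (_ * _ * _).
have -> : (-1) ^+ cast (lift_perm ord_max i s) = (-1) ^+ lift_perm ord_max i s :> R.
  by rewrite /cast odd_cast_perm.
by rewrite odd_lift_perm /= -signr_addb -addbA addbb addbF -oddD signr_odd.
Qed.

Lemma alternatingD k (a b : covec R k n) : is_alternating a -> is_alternating b ->
  is_alternating (fun v => a v + b v).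
Proof.
move=> [la aa] [lb ab]; split=> [v v1 v2 i s E E1 E2|v i j ij E].
  by rewrite (la _ _ _ _ _ E E1 E2) (lb _ _ _ _ _ E E1 E2) mulrDr addrACA.
by rewrite (aa _ _ _ ij E) (ab _ _ _ ij E) addr0.
Qed.

Lemma alternatingN k (a : covec R k n) :
  is_alternating a -> is_alternating (fun v => - a v).
Proof.
move=> [la aa]; split=> [v v1 v2 i s E E1 E2|v i j ij E].
  by rewrite (la _ _ _ _ _ E E1 E2) opprD mulrN.
by rewrite (aa _ _ _ ij E) oppr0.
Qed.

Lemma alternating_det_mul k (A : 'M[R]_(n, k)) :
  is_alternating (fun v : 'M[R]_(k, n) => \det (v *m A)).
Proof.
split=> [v v1 v2 i s E E1 E2|v i j ij E].
  rewrite (@determinant_multilinear _ _ (v *m A) (v1 *m A) (v2 *m A) i s 1) ?mul1r //.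
  - by rewrite !row_mul E mulmxDl scalemxAl scale1r.
  - by rewrite !row'Esub -!mul_rowsub_mx -!row'Esub E1.
  - by rewrite !row'Esub -!mul_rowsub_mx -!row'Esub E2.
apply: (determinant_alternate ij) => k'.
by have /rowP/(_ k') := congr1 (mulmx^~ A) E; rewrite -!row_mul !mxE.
Qed.

Lemma perm_alternatingD k (a b : covec R k n) :
  perm_alternating a -> perm_alternating b -> perm_alternating (fun v => a v + b v).
Proof. by move=> aa ab s v; rewrite aa ab mulrDr. Qed.

Lemma perm_alternatingN k (a : covec R k n) :
  perm_alternating a -> perm_alternating (fun v => - a v).
Proof. by move=> aa s v; rewrite aa mulrN. Qed.

Lemma perm_alternating_det_mul k (A : 'M[R]_(n, k)) :
  perm_alternating (fun v : 'M[R]_(k, n) => \det (v *m A)).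
Proof.
by move=> s v; rewrite row_permE -mulmxA det_mulmx det_perm.
Qed.

Lemma perm_alternating1 (a : covec R 1 n) : perm_alternating a.
Proof.
move=> s v; have -> : s = 1%g by apply/permP => i; rewrite (ord1 (s i)) (ord1 (_ i)).
by rewrite odd_perm1 row_perm1 mul1r.
Qed.

End CovectorAlgebra.

Definition spin7_coef (l : seq nat) : int :=
  kdelta l [:: 0; 1; 6; 7]%N + kdelta l [:: 2; 3; 6; 7]%N +
  kdelta l [:: 4; 5; 6; 7]%N + kdelta l [:: 0; 2; 4; 7]%N -
  kdelta l [:: 0; 3; 5; 7]%N - kdelta l [:: 1; 2; 5; 7]%N -
  kdelta l [:: 1; 3; 4; 7]%N + kdelta l [:: 0; 1; 2; 3]%N +
  kdelta l [:: 0; 1; 4; 5]%N + kdelta l [:: 2; 3; 4; 5]%N +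
  kdelta l [:: 0; 2; 5; 6]%N + kdelta l [:: 0; 3; 4; 6]%N +
  kdelta l [:: 1; 2; 4; 6]%N - kdelta l [:: 1; 3; 5; 6]%N.

Section Models.
Variable R : realType.

Lemma cobasisE n (e : 'M[R]_n.+1) s v :
  uniq (map predn s) -> all (fun i => i < n.+1)%N (map predn s) ->
  cobasis e s v = tform (fun l => (kdelta l (map predn s))%:~R) (v *m e).
Proof.
move=> us ls; rewrite -(det_colsub_tform _ (size_map _ _) us ls) /cobasis.
congr (\det (colsub _ _)); apply/funext => a.
by rewrite (nth_map 0%N).
Qed.

Lemma g2_modelE (e : 'M[R]_7) v :
  g2_model e v = tform (fun l => (g2_coef l)%:~R) (v *m e).
Proof.
rewrite /g2_model !cobasisE //= /g2_coef -!tformN -!tformD; apply: eq_tform => l.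
by rewrite !(rmorphD, rmorphN).
Qed.

Lemma spin7_modelE (e : 'M[R]_8) v :
  spin7_model e v = tform (fun l => (spin7_coef l)%:~R) (v *m e).
Proof.
rewrite /spin7_model !cobasisE //= /spin7_coef -!tformN -!tformD.
by apply: eq_tform => l; rewrite !(rmorphD, rmorphN).
Qed.

Definition g2_dual : model R 4 7 := fun e v =>
  let E := fun i j k l : nat => cobasis e [:: i; j; k; l] v in
  E 1 2 3 4 + E 1 2 5 6 + E 3 4 5 6 + E 1 3 6 7 + E 1 4 5 7 + E 2 3 5 7 - E 2 4 6 7.

Lemma g2_dual_tform (e : 'M[R]_7) v :
  g2_dual e v = tform (fun l => (g2_dual_coef l)%:~R) (v *m e).
Proof.
rewrite /g2_dual !cobasisE //= /g2_dual_coef -!tformN -!tformD.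
by apply: eq_tform => l; rewrite !(rmorphD, rmorphN).
Qed.

Lemma alternating_cobasis n (e : 'M[R]_n.+1) s : is_alternating (cobasis e s).
Proof.
have -> : cobasis e s = (fun v => \det (v *m
    colsub (fun a : 'I_(size s) => inord (nth 0%N s a).-1) e)).
  by apply/funext => v; rewrite mulmx_colsub.
exact: alternating_det_mul.
Qed.

Lemma perm_alternating_cobasis n (e : 'M[R]_n.+1) s : perm_alternating (cobasis e s).
Proof.
have -> : cobasis e s = (fun v => \det (v *m
    colsub (fun a : 'I_(size s) => inord (nth 0%N s a).-1) e)).
  by apply/funext => v; rewrite mulmx_colsub.
exact: perm_alternating_det_mul.
Qed.

Lemma alternating_g2_dual (e : 'M[R]_7) : is_alternating (g2_dual e).
Proof.
rewrite /g2_dual /=.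
by do ?[apply: alternatingD|apply: alternatingN];
  exact: (@alternating_cobasis _ e [:: _; _; _; _]).
Qed.

Lemma perm_alternating_g2_model (e : 'M[R]_7) : perm_alternating (g2_model e).
Proof.
rewrite /g2_model /=.
by do ?[apply: perm_alternatingD|apply: perm_alternatingN];
  exact: (@perm_alternating_cobasis _ e [:: _; _; _]).
Qed.

Lemma alternating_spin7_model (e : 'M[R]_8) : is_alternating (spin7_model e).
Proof.
rewrite /spin7_model /=.
by do ?[apply: alternatingD|apply: alternatingN];
  exact: (@alternating_cobasis _ e [:: _; _; _; _]).
Qed.

Lemma g2_dual_star (e : 'M[R]_7) (a : covec R 3 7) w :
  adapted g2_model a e -> @coframe_star R 3 4 e a w = g2_dual e w.
Proof.
move=> [ue ae]; rewrite g2_dual_tform -g2_star_tform /coframe_star; congr (_ * _).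
apply: eq_bigr => f _; rewrite ae g2_modelE mul_rowsub_mx mulVmx // tform_basis.
congr (_ * \det _); rewrite mul_col_mx mul_rowsub_mx mulVmx //.
Qed.

(** Invertibility of [e'] is a conclusion: [invmx e *m e'] fixes the model 3-form, hence has
    determinant 1. For coframes pulled back by a change of charts this avoids inverting the
    Jacobian. *)
Lemma g2_coframe_change (a : covec R 3 7) (e e' : 'M[R]_7) :
  adapted g2_model a e -> (forall v, a v = g2_model e' v) ->
  adapted g2_model a e' /\ g2_dual e' = g2_dual e.
Proof.
move=> [ue ae] ae'.
pose g := invmx e *m e'.
have gphi (v : 'M[R]_(3, 7)) : tform (fun l => (g2_coef l)%:~R) (v *m g) =
    tform (fun l => (g2_coef l)%:~R) v :> R.
  have := ae' (v *m invmx e); rewrite ae !g2_modelE mulmxKV // => ->.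
  by rewrite mulmxA.
have [dg _] := g2_stabilizer gphi.
have eg : e *m g = e' by rewrite mulKVmx.
split; first by split => //; rewrite -eg unitmx_mul ue unitmxE dg unitr1.
by apply/funext => w; rewrite !g2_dual_tform -eg mulmxA g2_dual_invariant.
Qed.

End Models.

(** * The Spin(7) model in a warped coframe *)

Section WarpedModel.
Variable R : realType.

(** The columns are [t e^i] followed by the last coordinate covector: an orthonormal coframe of the
    metric [t^2 g + dt^2]. *)
Definition warp_coframe n (t : R) (e : 'M[R]_n) : 'M[R]_(n + 1) :=
  block_mx (t *: e) 0 0 1%:M.

Lemma mul_warp_coframe n k (t : R) (e : 'M[R]_n) (v : 'M[R]_(k, n + 1)) :
  v *m warp_coframe t e = row_mx (t *: (lsubmx v *m e)) (rsubmx v).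
Proof.
rewrite -{1}[v]hsubmxK mul_row_block !mulmx0 mulmx1 addr0 add0r.
by rewrite scalemxAr.
Qed.

Lemma warp_coframe_unit n (t : R) (e : 'M[R]_n) :
  t != 0 -> e \in unitmx -> warp_coframe t e \in unitmx.
Proof.
move=> t0 ue; rewrite unitmxE det_ublock det1 mulr1 detZ unitrM -unitmxE ue andbT.
by rewrite unitrX // unitfE.
Qed.

Lemma inord_lshift x : (x < 7)%N -> inord x = lshift 1 (inord x : 'I_7) :> 'I_8.
Proof. by move=> x7; apply/val_inj; rewrite /= !inordK // ltnW. Qed.

Lemma cobasis_warp_tangent (t : R) (e : 'M[R]_7) s (v : 'M[R]_(size s, 8)) :
  all (fun x => x.-1 < 7)%N s ->
  cobasis (warp_coframe t e : 'M[R]_8) s v = t ^+ size s * cobasis e s (@lsubmx R _ 7 1 v).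
Proof.
move=> /allP s7; rewrite /cobasis -detZ; congr (\det _).
rewrite (@mul_warp_coframe 7 _ t e v); apply/matrixP => i j.
have sj : ((nth 0%N s j).-1 < 7)%N by apply: s7; rewrite mem_nth.
by rewrite [LHS]mxE (inord_lshift sj) (@row_mxEl R _ 7 1) !mxE.
Qed.

Lemma det_expand_last k (A : 'M[R]_k.+1) :
  \det A = \sum_(i < k.+1) (-1) ^+ (k + i) * A i ord_max * \det (row' i (col' ord_max A)).
Proof.
rewrite (expand_det_col _ ord_max); apply: eq_bigr => i _.
by rewrite /cofactor mulrCA mulrA addnC.
Qed.

Lemma cobasis_warp_normal (t : R) (e : 'M[R]_7) i j k (v : 'M[R]_(4, 8)) :
  all (fun x => x.-1 < 7)%N [:: i; j; k] ->
  cobasis (warp_coframe t e : 'M[R]_8) [:: i; j; k; 8]%N v =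
  t ^+ 3 * \sum_(p < 4) (-1) ^+ (3 + p) *
    cobasis e [:: i; j; k] (row' p (@lsubmx R _ 7 1 v)) * @rsubmx R _ 7 1 v p 0.
Proof.
move=> /allP s7; rewrite /cobasis [LHS]det_expand_last mulr_sumr.
apply: eq_bigr => p _.
have -> : row' p (col' ord_max (colsub (fun a : 'I_4 =>
      inord (nth 0%N [:: i; j; k; 8%N] a).-1) (v *m (warp_coframe t e : 'M[R]_8)))) =
    t *: colsub (fun a : 'I_3 => inord (nth 0%N [:: i; j; k] a).-1)
      (row' p (@lsubmx R _ 7 1 v) *m e).
  rewrite (@mul_warp_coframe 7 _ t e v); apply/matrixP => a b.
  rewrite !row'Esub mul_rowsub_mx [LHS]mxE [LHS]mxE [LHS]mxE.
  have -> : nth 0%N [:: i; j; k; 8%N] (lift ord_max b) = nth 0%N [:: i; j; k] b.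
    by case: b => -[|[|[|]]].
  have sb : ((nth 0%N [:: i; j; k] b).-1 < 7)%N by apply: s7; rewrite mem_nth.
  by rewrite (inord_lshift sb) (@row_mxEl R _ 7 1) !mxE.
rewrite detZ (@mul_warp_coframe 7 _ t e v) [X in _ * X * _]mxE.
have -> : inord 7 = rshift 7 ord0 :> 'I_8 by apply/val_inj; rewrite /= inordK.
rewrite (@row_mxEr R _ 7 1) /cobasis; ring.
Qed.

Lemma wedge_3_1 n (a : covec R 3 n) (b : covec R 1 n) (v : 'M[R]_(4, n)) :
  perm_alternating a ->
  wedge a b (v : 'M[R]_(3 + 1, n)) =
  \sum_(i < 4) (-1) ^+ (3 + i) * a (row' i v) * b (row i v).
Proof.
move=> alt; rewrite -(wedge_covec1 b v alt); congr (wedge _ _ _).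
by rewrite castmx_id.
Qed.

Lemma wedge_1_1 n (a b : covec R 1 n) (v : 'M[R]_(2, n)) :
  wedge a b (v : 'M[R]_(1 + 1, n)) =
  a (row 0 v) * b (row 1 v) - a (row 1 v) * b (row 0 v).
Proof.
have := wedge_covec1 b v (@perm_alternating1 R n a); rewrite castmx_id => ->.
rewrite big_ord_recl big_ord1 /= expr1 exprD expr1 mulrNN mulr1 mul1r mulN1r.
have -> : row' ord0 v = row 1 v.
  by apply/matrixP => i j; rewrite !mxE; congr (v _ _); apply/val_inj; rewrite /= (ord1 i).
have -> : row' (lift ord0 ord0) v = row 0 v.
  by apply/matrixP => i j; rewrite !mxE; congr (v _ _); apply/val_inj; rewrite /= (ord1 i).
have -> : lift ord0 ord0 = 1 :> 'I_2 by apply/val_inj.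
by rewrite mulNr addrC.
Qed.

(** The monomials of the model containing [e^8] make up [phi /\ e^8], and the others make up [*phi];
    scaling the first seven covectors by [t] gives the powers 3 and 4. *)
Lemma spin7_model_warp (t : R) (e : 'M[R]_7) (v : 'M[R]_(4, 8)) :
  spin7_model (warp_coframe t e : 'M[R]_8) v =
  t ^+ 3 * wedge (fun u : 'M[R]_(3, 7 + 1) => g2_model e (lsubmx u))
             (fun u : 'M[R]_(1, 7 + 1) => rsubmx u 0 0) (v : 'M[R]_(3 + 1, 7 + 1)) +
  t ^+ 4 * g2_dual e (@lsubmx R _ 7 1 v).
Proof.
rewrite wedge_3_1; last first.
  by move=> s u; rewrite -perm_alternating_g2_model; congr (g2_model e _);
     apply/matrixP => i j; rewrite !mxE.
rewrite /spin7_model /g2_dual !cobasis_warp_normal //.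
rewrite !(@cobasis_warp_tangent _ _ [:: _; _; _; _]) //=.
rewrite !big_ord_recr !big_ord0 /= /g2_model /=.
have E (i : 'I_4) : lsubmx (row' i v : 'M[R]_(3, 7 + 1)) = row' i (lsubmx (v : 'M[R]_(4, 7 + 1))).
  by apply/matrixP => p q; rewrite !mxE.
have E' (i : 'I_4) : rsubmx (row i v : 'M[R]_(1, 7 + 1)) 0 0 = rsubmx (v : 'M[R]_(4, 7 + 1)) i 0.
  by rewrite !mxE.
rewrite !E !E'; ring.
Qed.
End WarpedModel.

(** * The Lie algebra spin(7) *)

Definition del_nth (a : seq nat) p := take p a ++ drop p.+1 a.

(* The terms of [d Phi (E_a0, ..., E_a4)]: a pair [(z, (k, i, b))] stands for
   [z * (D_(E_k) e^i) (E_b)]. *)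
Definition closed_terms (a : seq nat) : seq (int * (nat * nat * nat)) :=
  [seq t <- flatten [seq flatten [seq
    [seq (let c := spin7_coef (set_nth 0%N (del_nth a p) q i) in
          if odd p then - c else c,
          (nth 0%N a p, i, nth 0%N (del_nth a p) q)) | i <- iota 0 8]
    | q <- iota 0 4] | p <- iota 0 5] | t.1 != 0].

(** Exchanges direction and argument with a sign. A list invariant under this, up to order, depends
    only on the antisymmetrised derivatives of the coframe, that is on [d e^i]. *)
Definition flip_term (t : int * (nat * nat * nat)) : int * (nat * nat * nat) :=
  let: (z, (k, i, b)) := t in (- z, (b, i, k)).

(** Normal form modulo skew symmetry of the connection matrix: diagonal entries are dropped and the
    others are brought to [i < b]. *)
Definition upper_terms (l : seq (int * (nat * nat * nat))) :=
  [seq (let: (z, (k, i, b)) := t in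
        if (i < b)%N then (z, (k, i, b)) else (- z, (k, b, i)))
  | t <- l & t.2.1.2 != t.2.2].

(* One of the equations of spin(7), for the connection matrix in direction
   [E_k]: the coefficients of [e^k /\ e^m + iota_m iota_k Phi]. *)
Definition rel_terms (k m : nat) : seq (int * (nat * nat * nat)) :=
  upper_terms ((1, (k, k, m)) ::
    [seq t <- flatten [seq [seq (spin7_coef [:: k; m; p; q], (k, p, q)) | q <- iota 0 8 & (p < q)%N]
             | p <- iota 0 8] | t.1 != 0]).

(** The fourteen blocks of the Steiner system S(3,4,8). *)
Definition spin7_quads : seq (seq nat) :=
  [seq a <- words 8 4 | sorted ltn a && (spin7_coef a != 0)].

Definition opp_terms (l : seq (int * (nat * nat * nat))) := [seq (- t.1, t.2) | t <- l].

(* Every 5-subset of the index set is the disjoint union of a quadruple [B] of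
   [spin7_quads] and a point [m], and the corresponding component of [d Phi]
   is, up to sign, the sum over [k] in [B] of the relations [rel_terms k m]. *)
Definition closed_terms_check : bool :=
  all (fun B => all (fun m => (m \in B) ||
    let l := closed_terms (sort leq (m :: B)) in
    let s := flatten [seq rel_terms k m | k <- B] in
    perm_eq l (map flip_term l) &&
    (perm_eq (upper_terms l) s || perm_eq (upper_terms l) (opp_terms s)))
  (iota 0 8)) spin7_quads.

Lemma closed_terms_checkT : closed_terms_check. Proof. by vm_compute. Qed.

Lemma rel_terms_checkT : all (fun k => all (fun m => (k == m) ||
  all (fun t => (t.1 == 1) || (t.1 == -1)) (rel_terms k m)) (iota 0 8)) (iota 0 8).
Proof. by vm_compute. Qed.

Section Spin7Algebra.
Variable R : realFieldType.
Implicit Types (A : nat -> nat -> R) (D W : nat -> nat -> nat -> R).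

Definition eval_terms D (l : seq (int * (nat * nat * nat))) : R :=
  \sum_(t <- l) t.1%:~R * D t.2.1.1 t.2.1.2 t.2.2.

Definition skew_entries A := forall i j, A i j = - A j i.

(* The equations of the subalgebra spin(7) of so(8): the seven 2-forms
   [iota_j iota_0 Phi + e^0 /\ e^j] span the complement of spin(7). *)
Definition spin7_rel A : Prop :=
  A 0%N 1%N + A 2%N 3%N + A 4%N 5%N + A 6%N 7%N = 0 :> R /\
   A 0%N 2%N - A 1%N 3%N + A 4%N 7%N + A 5%N 6%N = 0 :> R /\
   A 0%N 3%N + A 1%N 2%N + A 4%N 6%N - A 5%N 7%N = 0 :> R /\
   A 0%N 4%N - A 1%N 5%N - A 2%N 7%N - A 3%N 6%N = 0 :> R /\
   A 0%N 5%N + A 1%N 4%N - A 2%N 6%N + A 3%N 7%N = 0 :> R /\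
   A 0%N 6%N - A 1%N 7%N + A 2%N 5%N + A 3%N 4%N = 0 :> R /\
   A 0%N 7%N + A 1%N 6%N + A 2%N 4%N - A 3%N 5%N = 0 :> R.

(** Twice the value of a flip-invariant list is its value on the antisymmetrised array, where the
    torsion-free condition replaces [D] by [- W]. *)
Lemma eval_terms_torsion D W (l : seq (int * (nat * nat * nat))) :
  (forall k i b, D k i b - D b i k = - (W k i b - W b i k)) ->
  perm_eq l (map flip_term l) -> eval_terms D l = - eval_terms W l.
Proof.
move=> tor pl.
have flip X : eval_terms X l + eval_terms X l =
    \sum_(t <- l) t.1%:~R * (X t.2.1.1 t.2.1.2 t.2.2 - X t.2.2 t.2.1.2 t.2.1.1).
  rewrite {2}/eval_terms (perm_big _ pl) big_map -big_split /=.
  by apply: eq_bigr => -[z [[k i] b]] _ /=; rewrite intrN mulNr mulrBr.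
have : eval_terms D l + eval_terms D l = - (eval_terms W l + eval_terms W l).
  rewrite !flip -sumrN; apply: eq_bigr => t _.
  by rewrite tor mulrN.
lra.
Qed.

Lemma eval_opp_terms W l : eval_terms W (opp_terms l) = - eval_terms W l.
Proof.
rewrite /eval_terms big_map -sumrN; apply: eq_bigr => t _ /=.
by rewrite intrN mulNr.
Qed.

(** For coefficients 1 and -1 only: it reduces to a plain linear expression, with no integer casts,
    that [lra] can read. *)
Fixpoint sign_terms W (l : seq (int * (nat * nat * nat))) : R :=
  if l is (z, (k, i, b)) :: l' then
    (if z is Posz _ then W k i b else - W k i b) + sign_terms W l'
  else 0.

Lemma sign_termsE W l : all (fun t => (t.1 == 1) || (t.1 == -1)) l ->
  eval_terms W l = sign_terms W l.
Proof.
rewrite /eval_terms; elim: l => [|[z [[k i] b]] l IH]; first by rewrite big_nil.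
by rewrite big_cons => /andP[/orP[]/eqP/= -> /IH ->]; rewrite ?mul1r ?mulN1r.
Qed.

Lemma skewxx A i : skew_entries A -> A i i = 0.
Proof. by move=> sA; have := sA i i; lra. Qed.

(** A rewriting rule that kills diagonal entries and orients the others to increasing indices below
    8. *)
Definition skew_normal A (sA : skew_entries A) := ((fun i => @skewxx A i sA), (sA 1%N 0%N, sA 2%N 0%N, sA 3%N 0%N, sA 4%N 0%N, sA 5%N 0%N, sA 6%N 0%N, sA 7%N 0%N, sA 2%N 1%N, sA 3%N 1%N, sA 4%N 1%N, sA 5%N 1%N, sA 6%N 1%N, sA 7%N 1%N, sA 3%N 2%N, sA 4%N 2%N, sA 5%N 2%N, sA 6%N 2%N, sA 7%N 2%N, sA 4%N 3%N, sA 5%N 3%N, sA 6%N 3%N, sA 7%N 3%N, sA 5%N 4%N, sA 6%N 4%N, sA 7%N 4%N, sA 6%N 5%N, sA 7%N 5%N, sA 7%N 6%N)).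

Lemma eval_upper_terms W l : (forall k, skew_entries (W k)) ->
  eval_terms W (upper_terms l) = eval_terms W l.
Proof.
move=> sW; rewrite /eval_terms big_map big_filter big_mkcond.
apply: eq_bigr => -[z [[k i] b]] _ /=; case: eqP => /= [->|_].
  by rewrite skewxx ?mulr0.
by case: ifP => //= _; rewrite (sW k i b) intrN mulrN mulNr.
Qed.

(** For fixed [m], the seven blocks [B] avoiding [m] give the equations [\sum_(k <- B) T k m = 0] in
    the seven unknowns [T k m]. Two points other than [m] lie in exactly two of these blocks, so the
    incidence matrix [N] satisfies [N N^T = 2 I + 2 J], with [J] the all-ones matrix, and is
    invertible: each relation vanishes separately. *)
Lemma spin7_rel_closed W : (forall k, skew_entries (W k)) ->
  (forall B m, B \in spin7_quads -> (m < 8)%N -> m \notin B ->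
     eval_terms W (closed_terms (sort leq (m :: B))) = 0) ->
  forall k, (k < 8)%N -> spin7_rel (W k).
Proof.
move=> sW HW.
(* [T] is made opaque so that each [T k m] is a single atom for [lra]. *)
have [T TE] : exists T : nat -> nat -> R, forall k m, T k m = eval_terms W (rel_terms k m).
  by exists (fun k m => eval_terms W (rel_terms k m)).
have H B m : B \in spin7_quads -> (m < 8)%N -> m \notin B -> \sum_(k <- B) T k m = 0.
  move=> qB m8 mB; under eq_bigr do rewrite TE; have := HW B m qB m8 mB.
  have /allP/(_ _ qB)/allP/(_ m) := closed_terms_checkT.
  rewrite mem_iota m8 (negbTE mB) => /(_ isT) /andP[_ /orP[] pl].
    rewrite -eval_upper_terms // /eval_terms (perm_big _ pl) /= big_flatten big_map.
    by [].
  rewrite -eval_upper_terms // {1}/eval_terms (perm_big _ pl) => /eqP E; apply/eqP.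
  rewrite -oppr_eq0; move: E; rewrite -/(eval_terms W _) eval_opp_terms.
  by rewrite {1}/eval_terms big_flatten big_map.
have T0 m k : (m < 8)%N -> (k < 8)%N -> k != m -> T k m = 0.
  move=> m8 k8 km; have E B (qB : B \in spin7_quads) (mB : m \notin B) := H B m qB m8 mB.
  case: m m8 km E => [|[|[|[|[|[|[|[|m]]]]]]]] // _ km E.
  - have := E [:: 1; 2; 4; 6]%N isT isT; have := E [:: 1; 2; 5; 7]%N isT isT; have := E [:: 1; 3; 4; 7]%N isT isT; have := E [:: 1; 3; 5; 6]%N isT isT; have := E [:: 2; 3; 4; 5]%N isT isT; have := E [:: 2; 3; 6; 7]%N isT isT; have := E [:: 4; 5; 6; 7]%N isT isT; rewrite !big_cons !big_nil => h1 h2 h3 h4 h5 h6 h7.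
    by case: k k8 km => [|[|[|[|[|[|[|[|k]]]]]]]] // _ _; lra.
  - have := E [:: 0; 2; 4; 7]%N isT isT; have := E [:: 0; 2; 5; 6]%N isT isT; have := E [:: 0; 3; 4; 6]%N isT isT; have := E [:: 0; 3; 5; 7]%N isT isT; have := E [:: 2; 3; 4; 5]%N isT isT; have := E [:: 2; 3; 6; 7]%N isT isT; have := E [:: 4; 5; 6; 7]%N isT isT; rewrite !big_cons !big_nil => h1 h2 h3 h4 h5 h6 h7.
    by case: k k8 km => [|[|[|[|[|[|[|[|k]]]]]]]] // _ _; lra.
  - have := E [:: 0; 1; 4; 5]%N isT isT; have := E [:: 0; 1; 6; 7]%N isT isT; have := E [:: 0; 3; 4; 6]%N isT isT; have := E [:: 0; 3; 5; 7]%N isT isT; have := E [:: 1; 3; 4; 7]%N isT isT; have := E [:: 1; 3; 5; 6]%N isT isT; have := E [:: 4; 5; 6; 7]%N isT isT; rewrite !big_cons !big_nil => h1 h2 h3 h4 h5 h6 h7.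
    by case: k k8 km => [|[|[|[|[|[|[|[|k]]]]]]]] // _ _; lra.
  - have := E [:: 0; 1; 4; 5]%N isT isT; have := E [:: 0; 1; 6; 7]%N isT isT; have := E [:: 0; 2; 4; 7]%N isT isT; have := E [:: 0; 2; 5; 6]%N isT isT; have := E [:: 1; 2; 4; 6]%N isT isT; have := E [:: 1; 2; 5; 7]%N isT isT; have := E [:: 4; 5; 6; 7]%N isT isT; rewrite !big_cons !big_nil => h1 h2 h3 h4 h5 h6 h7.
    by case: k k8 km => [|[|[|[|[|[|[|[|k]]]]]]]] // _ _; lra.
  - have := E [:: 0; 1; 2; 3]%N isT isT; have := E [:: 0; 1; 6; 7]%N isT isT; have := E [:: 0; 2; 5; 6]%N isT isT; have := E [:: 0; 3; 5; 7]%N isT isT; have := E [:: 1; 2; 5; 7]%N isT isT; have := E [:: 1; 3; 5; 6]%N isT isT; have := E [:: 2; 3; 6; 7]%N isT isT; rewrite !big_cons !big_nil => h1 h2 h3 h4 h5 h6 h7.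
    by case: k k8 km => [|[|[|[|[|[|[|[|k]]]]]]]] // _ _; lra.
  - have := E [:: 0; 1; 2; 3]%N isT isT; have := E [:: 0; 1; 6; 7]%N isT isT; have := E [:: 0; 2; 4; 7]%N isT isT; have := E [:: 0; 3; 4; 6]%N isT isT; have := E [:: 1; 2; 4; 6]%N isT isT; have := E [:: 1; 3; 4; 7]%N isT isT; have := E [:: 2; 3; 6; 7]%N isT isT; rewrite !big_cons !big_nil => h1 h2 h3 h4 h5 h6 h7.
    by case: k k8 km => [|[|[|[|[|[|[|[|k]]]]]]]] // _ _; lra.
  - have := E [:: 0; 1; 2; 3]%N isT isT; have := E [:: 0; 1; 4; 5]%N isT isT; have := E [:: 0; 2; 4; 7]%N isT isT; have := E [:: 0; 3; 5; 7]%N isT isT; have := E [:: 1; 2; 5; 7]%N isT isT; have := E [:: 1; 3; 4; 7]%N isT isT; have := E [:: 2; 3; 4; 5]%N isT isT; rewrite !big_cons !big_nil => h1 h2 h3 h4 h5 h6 h7.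
    by case: k k8 km => [|[|[|[|[|[|[|[|k]]]]]]]] // _ _; lra.
  - have := E [:: 0; 1; 2; 3]%N isT isT; have := E [:: 0; 1; 4; 5]%N isT isT; have := E [:: 0; 2; 5; 6]%N isT isT; have := E [:: 0; 3; 4; 6]%N isT isT; have := E [:: 1; 2; 4; 6]%N isT isT; have := E [:: 1; 3; 5; 6]%N isT isT; have := E [:: 2; 3; 4; 5]%N isT isT; rewrite !big_cons !big_nil => h1 h2 h3 h4 h5 h6 h7.
    by case: k k8 km => [|[|[|[|[|[|[|[|k]]]]]]]] // _ _; lra.
have S k m : (m < 8)%N -> (k < 8)%N -> k != m -> sign_terms W (rel_terms k m) = 0.
  move=> m8 k8 km; rewrite -sign_termsE -?TE; first exact: T0.
  have /allP/(_ k) := rel_terms_checkT; rewrite mem_iota k8 => /(_ isT)/allP/(_ m).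
  by rewrite mem_iota m8 (negbTE km) => /(_ isT).
(** For fixed [k], the seven [m] different from [k] give the seven equations of spin(7): each goal
    is matched with the [m] whose pair with [k] occurs in it. *)
Ltac rel_eq S k m :=
  let l := eval vm_compute in (rel_terms k m) in
  have := S k m isT isT isT; rewrite [rel_terms k m](_ : _ = l) //;
  cbn [sign_terms]; lra.
case=> [|[|[|[|[|[|[|[|k]]]]]]]] // _.
- do ?split; [rel_eq S 0%N 1%N|rel_eq S 0%N 2%N|rel_eq S 0%N 3%N|rel_eq S 0%N 4%N|rel_eq S 0%N 5%N|rel_eq S 0%N 6%N|rel_eq S 0%N 7%N].
- do ?split; [rel_eq S 1%N 0%N|rel_eq S 1%N 3%N|rel_eq S 1%N 2%N|rel_eq S 1%N 5%N|rel_eq S 1%N 4%N|rel_eq S 1%N 7%N|rel_eq S 1%N 6%N].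
- do ?split; [rel_eq S 2%N 3%N|rel_eq S 2%N 0%N|rel_eq S 2%N 1%N|rel_eq S 2%N 7%N|rel_eq S 2%N 6%N|rel_eq S 2%N 5%N|rel_eq S 2%N 4%N].
- do ?split; [rel_eq S 3%N 2%N|rel_eq S 3%N 1%N|rel_eq S 3%N 0%N|rel_eq S 3%N 6%N|rel_eq S 3%N 7%N|rel_eq S 3%N 4%N|rel_eq S 3%N 5%N].
- do ?split; [rel_eq S 4%N 5%N|rel_eq S 4%N 7%N|rel_eq S 4%N 6%N|rel_eq S 4%N 0%N|rel_eq S 4%N 1%N|rel_eq S 4%N 3%N|rel_eq S 4%N 2%N].
- do ?split; [rel_eq S 5%N 4%N|rel_eq S 5%N 6%N|rel_eq S 5%N 7%N|rel_eq S 5%N 1%N|rel_eq S 5%N 0%N|rel_eq S 5%N 2%N|rel_eq S 5%N 3%N].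
- do ?split; [rel_eq S 6%N 7%N|rel_eq S 6%N 5%N|rel_eq S 6%N 4%N|rel_eq S 6%N 3%N|rel_eq S 6%N 2%N|rel_eq S 6%N 0%N|rel_eq S 6%N 1%N].
- do ?split; [rel_eq S 7%N 6%N|rel_eq S 7%N 4%N|rel_eq S 7%N 5%N|rel_eq S 7%N 2%N|rel_eq S 7%N 3%N|rel_eq S 7%N 1%N|rel_eq S 7%N 0%N].
Qed.
End Spin7Algebra.

(** * Curvature tensors with values in spin(7) *)

Section Spin7Curvature.
Variable R : realFieldType.
Implicit Types (A B : nat -> nat -> R).

Definition bracket A B i j : R := \sum_(k < 8) (A i k * B k j - B i k * A k j).

Lemma spin7_rel_add A B : spin7_rel A -> spin7_rel B ->
  spin7_rel (fun i j => A i j + B i j).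
Proof.
case=> a1 [a2 [a3 [a4 [a5 [a6 a7]]]]] [b1 [b2 [b3 [b4 [b5 [b6 b7]]]]]].
do ?split.
- by have := congr2 +%R a1 b1; rewrite addr0 => <-; ring.
- by have := congr2 +%R a2 b2; rewrite addr0 => <-; ring.
- by have := congr2 +%R a3 b3; rewrite addr0 => <-; ring.
- by have := congr2 +%R a4 b4; rewrite addr0 => <-; ring.
- by have := congr2 +%R a5 b5; rewrite addr0 => <-; ring.
- by have := congr2 +%R a6 b6; rewrite addr0 => <-; ring.
- by have := congr2 +%R a7 b7; rewrite addr0 => <-; ring.
Qed.

Lemma eq_spin7_rel A B : A =2 B -> spin7_rel A -> spin7_rel B.
Proof. by move=> AB; rewrite /spin7_rel !AB. Qed.

Lemma spin7_rel_scale c A : spin7_rel A -> spin7_rel (fun i j => c * A i j).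
Proof.
case=> a1 [a2 [a3 [a4 [a5 [a6 a7]]]]]; rewrite /spin7_rel -(mulr0 c).
do ?split.
- by rewrite -[in RHS]a1; ring.
- by rewrite -[in RHS]a2; ring.
- by rewrite -[in RHS]a3; ring.
- by rewrite -[in RHS]a4; ring.
- by rewrite -[in RHS]a5; ring.
- by rewrite -[in RHS]a6; ring.
- by rewrite -[in RHS]a7; ring.
Qed.

Lemma spin7_rel_sum (I : Type) (s : seq I) (c : I -> R) (A : I -> nat -> nat -> R) :
  (forall k, spin7_rel (A k)) -> spin7_rel (fun i j => \sum_(k <- s) c k * A k i j).
Proof.
move=> rA; elim: s => [|k s IH].
  apply: (@eq_spin7_rel (fun i j => 0)) => [i j|]; first by rewrite big_nil.
  by do ?split; ring.
apply: (@eq_spin7_rel (fun i j => c k * A k i j + \sum_(k <- s) c k * A k i j)).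
  by move=> i j; rewrite big_cons.
by apply: spin7_rel_add => //; exact: spin7_rel_scale.
Qed.

(** Closure under the bracket: the seven equations eliminate row 0 of each matrix, after which every
    equation for the bracket is a polynomial identity in the 21 remaining entries. *)
Lemma spin7_rel_bracket A B : skew_entries A -> skew_entries B -> spin7_rel A -> spin7_rel B ->
  spin7_rel (bracket A B).
Proof.
move=> sA sB [a1 [a2 [a3 [a4 [a5 [a6 a7]]]]]] [b1 [b2 [b3 [b4 [b5 [b6 b7]]]]]].
have nA := skew_normal sA; have nB := skew_normal sB.
have a1' : A 0%N 1%N = - A 2%N 3%N - A 4%N 5%N - A 6%N 7%N by apply: subr0_eq; rewrite -[RHS]a1; ring.
have a2' : A 0%N 2%N = A 1%N 3%N - A 4%N 7%N - A 5%N 6%N by apply: subr0_eq; rewrite -[RHS]a2; ring.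
have a3' : A 0%N 3%N = - A 1%N 2%N - A 4%N 6%N + A 5%N 7%N by apply: subr0_eq; rewrite -[RHS]a3; ring.
have a4' : A 0%N 4%N = A 1%N 5%N + A 2%N 7%N + A 3%N 6%N by apply: subr0_eq; rewrite -[RHS]a4; ring.
have a5' : A 0%N 5%N = - A 1%N 4%N + A 2%N 6%N - A 3%N 7%N by apply: subr0_eq; rewrite -[RHS]a5; ring.
have a6' : A 0%N 6%N = A 1%N 7%N - A 2%N 5%N - A 3%N 4%N by apply: subr0_eq; rewrite -[RHS]a6; ring.
have a7' : A 0%N 7%N = - A 1%N 6%N - A 2%N 4%N + A 3%N 5%N by apply: subr0_eq; rewrite -[RHS]a7; ring.
have b1' : B 0%N 1%N = - B 2%N 3%N - B 4%N 5%N - B 6%N 7%N by apply: subr0_eq; rewrite -[RHS]b1; ring.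
have b2' : B 0%N 2%N = B 1%N 3%N - B 4%N 7%N - B 5%N 6%N by apply: subr0_eq; rewrite -[RHS]b2; ring.
have b3' : B 0%N 3%N = - B 1%N 2%N - B 4%N 6%N + B 5%N 7%N by apply: subr0_eq; rewrite -[RHS]b3; ring.
have b4' : B 0%N 4%N = B 1%N 5%N + B 2%N 7%N + B 3%N 6%N by apply: subr0_eq; rewrite -[RHS]b4; ring.
have b5' : B 0%N 5%N = - B 1%N 4%N + B 2%N 6%N - B 3%N 7%N by apply: subr0_eq; rewrite -[RHS]b5; ring.
have b6' : B 0%N 6%N = B 1%N 7%N - B 2%N 5%N - B 3%N 4%N by apply: subr0_eq; rewrite -[RHS]b6; ring.
have b7' : B 0%N 7%N = - B 1%N 6%N - B 2%N 4%N + B 3%N 5%N by apply: subr0_eq; rewrite -[RHS]b7; ring.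
clear a1 a2 a3 a4 a5 a6 a7 b1 b2 b3 b4 b5 b6 b7.
do ?split; rewrite /bracket !big_ord_recr !big_ord0 /= !nA !nB
  ?(a1', a2', a3', a4', a5', a6', a7') ?(b1', b2', b3', b4', b5', b6', b7');
  ring.
Qed.

(* [r i j k l] stands for [Omega_ij (E_k, E_l)]. *)
Variable r : nat -> nat -> nat -> nat -> R.
Hypothesis r_skew1 : forall i j k l, r i j k l = - r j i k l.
Hypothesis r_skew2 : forall i j k l, r i j k l = - r i j l k.
Hypothesis r_bianchi : forall i j k l, r i j k l + r i k l j + r i l j k = 0.

(** The classical combination of the four Bianchi identities obtained by rotating the indices. *)
Lemma riemann_pair_symmetry i j k l : r i j k l = r k l i j.
Proof.
have := r_bianchi i j k l; have := r_bianchi j k l i; have := r_bianchi k l i j.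
have := r_bianchi l i j k.
have := r_skew2 j k l i; have := r_skew1 j l i k; have := r_skew1 j i k l.
have := r_skew1 k i j l; have := r_skew2 i k j l; have := r_skew1 k j l i.
have := r_skew1 l i j k; have := r_skew2 l j k i; have := r_skew1 l k i j.
lra.
Qed.

Hypothesis r_spin7 : forall k l, spin7_rel (fun i j => r i j k l).

(* With the last index fixed, the equations of spin(7) express [r i j i l] by
   entries whose sum over [i] splits into cyclic sums. *)
Lemma ricci_spin7 j l : (j < 8)%N -> \sum_(i < 8) r i j i l = 0.
Proof.
(* Pair symmetry moves the Bianchi identity to the first three indices, leaving [l] fixed. *)
have cyc p q i : r p q i l + r q i p l + r i p q l = 0.
  have := r_bianchi l p q i; rewrite 3!(riemann_pair_symmetry l).
  have := r_skew1 p q i l; have := r_skew2 p q i l; have := r_skew2 q i p l.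
  have := r_skew2 i p q l; lra.
have n k m := skew_normal (fun i j => r_skew1 i j k m).
have s i := r_spin7 i l.
case: j => [|[|[|[|[|[|[|[|j]]]]]]]] // _; rewrite !big_ord_recr big_ord0 /=.
- have [h1 [_ [_ [_ [_ [_ _]]]]]] := s 1%N; have [_ [h2 [_ [_ [_ [_ _]]]]]] := s 2%N; have [_ [_ [h3 [_ [_ [_ _]]]]]] := s 3%N; have [_ [_ [_ [h4 [_ [_ _]]]]]] := s 4%N; have [_ [_ [_ [_ [h5 [_ _]]]]]] := s 5%N; have [_ [_ [_ [_ [_ [h6 _]]]]]] := s 6%N; have [_ [_ [_ [_ [_ [_ h7]]]]]] := s 7%N;
  have := cyc 1%N 2%N 3%N; have := cyc 1%N 4%N 5%N; have := cyc 1%N 6%N 7%N; have := cyc 2%N 4%N 7%N; have := cyc 2%N 5%N 6%N; have := cyc 3%N 4%N 6%N; have := cyc 3%N 5%N 7%N;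
  rewrite !n in h1 h2 h3 h4 h5 h6 h7 *; lra.
- have [h0 [_ [_ [_ [_ [_ _]]]]]] := s 0%N; have [_ [_ [h2 [_ [_ [_ _]]]]]] := s 2%N; have [_ [h3 [_ [_ [_ [_ _]]]]]] := s 3%N; have [_ [_ [_ [_ [h4 [_ _]]]]]] := s 4%N; have [_ [_ [_ [h5 [_ [_ _]]]]]] := s 5%N; have [_ [_ [_ [_ [_ [_ h6]]]]]] := s 6%N; have [_ [_ [_ [_ [_ [h7 _]]]]]] := s 7%N;
  have := cyc 0%N 2%N 3%N; have := cyc 0%N 4%N 5%N; have := cyc 0%N 6%N 7%N; have := cyc 2%N 4%N 6%N; have := cyc 2%N 5%N 7%N; have := cyc 3%N 4%N 7%N; have := cyc 3%N 5%N 6%N;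
  rewrite !n in h0 h2 h3 h4 h5 h6 h7 *; lra.
- have [_ [h0 [_ [_ [_ [_ _]]]]]] := s 0%N; have [_ [_ [h1 [_ [_ [_ _]]]]]] := s 1%N; have [h3 [_ [_ [_ [_ [_ _]]]]]] := s 3%N; have [_ [_ [_ [_ [_ [_ h4]]]]]] := s 4%N; have [_ [_ [_ [_ [_ [h5 _]]]]]] := s 5%N; have [_ [_ [_ [_ [h6 [_ _]]]]]] := s 6%N; have [_ [_ [_ [h7 [_ [_ _]]]]]] := s 7%N;
  have := cyc 0%N 1%N 3%N; have := cyc 0%N 4%N 7%N; have := cyc 0%N 5%N 6%N; have := cyc 1%N 4%N 6%N; have := cyc 1%N 5%N 7%N; have := cyc 3%N 4%N 5%N; have := cyc 3%N 6%N 7%N;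
  rewrite !n in h0 h1 h3 h4 h5 h6 h7 *; lra.
- have [_ [_ [h0 [_ [_ [_ _]]]]]] := s 0%N; have [_ [h1 [_ [_ [_ [_ _]]]]]] := s 1%N; have [h2 [_ [_ [_ [_ [_ _]]]]]] := s 2%N; have [_ [_ [_ [_ [_ [h4 _]]]]]] := s 4%N; have [_ [_ [_ [_ [_ [_ h5]]]]]] := s 5%N; have [_ [_ [_ [h6 [_ [_ _]]]]]] := s 6%N; have [_ [_ [_ [_ [h7 [_ _]]]]]] := s 7%N;
  have := cyc 0%N 1%N 2%N; have := cyc 0%N 4%N 6%N; have := cyc 0%N 5%N 7%N; have := cyc 1%N 4%N 7%N; have := cyc 1%N 5%N 6%N; have := cyc 2%N 4%N 5%N; have := cyc 2%N 6%N 7%N;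
  rewrite !n in h0 h1 h2 h4 h5 h6 h7 *; lra.
- have [_ [_ [_ [h0 [_ [_ _]]]]]] := s 0%N; have [_ [_ [_ [_ [h1 [_ _]]]]]] := s 1%N; have [_ [_ [_ [_ [_ [_ h2]]]]]] := s 2%N; have [_ [_ [_ [_ [_ [h3 _]]]]]] := s 3%N; have [h5 [_ [_ [_ [_ [_ _]]]]]] := s 5%N; have [_ [_ [h6 [_ [_ [_ _]]]]]] := s 6%N; have [_ [h7 [_ [_ [_ [_ _]]]]]] := s 7%N;
  have := cyc 0%N 1%N 5%N; have := cyc 0%N 2%N 7%N; have := cyc 0%N 3%N 6%N; have := cyc 1%N 2%N 6%N; have := cyc 1%N 3%N 7%N; have := cyc 2%N 3%N 5%N; have := cyc 5%N 6%N 7%N;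
  rewrite !n in h0 h1 h2 h3 h5 h6 h7 *; lra.
- have [_ [_ [_ [_ [h0 [_ _]]]]]] := s 0%N; have [_ [_ [_ [h1 [_ [_ _]]]]]] := s 1%N; have [_ [_ [_ [_ [_ [h2 _]]]]]] := s 2%N; have [_ [_ [_ [_ [_ [_ h3]]]]]] := s 3%N; have [h4 [_ [_ [_ [_ [_ _]]]]]] := s 4%N; have [_ [h6 [_ [_ [_ [_ _]]]]]] := s 6%N; have [_ [_ [h7 [_ [_ [_ _]]]]]] := s 7%N;
  have := cyc 0%N 1%N 4%N; have := cyc 0%N 2%N 6%N; have := cyc 0%N 3%N 7%N; have := cyc 1%N 2%N 7%N; have := cyc 1%N 3%N 6%N; have := cyc 2%N 3%N 4%N; have := cyc 4%N 6%N 7%N;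
  rewrite !n in h0 h1 h2 h3 h4 h6 h7 *; lra.
- have [_ [_ [_ [_ [_ [h0 _]]]]]] := s 0%N; have [_ [_ [_ [_ [_ [_ h1]]]]]] := s 1%N; have [_ [_ [_ [_ [h2 [_ _]]]]]] := s 2%N; have [_ [_ [_ [h3 [_ [_ _]]]]]] := s 3%N; have [_ [_ [h4 [_ [_ [_ _]]]]]] := s 4%N; have [_ [h5 [_ [_ [_ [_ _]]]]]] := s 5%N; have [h7 [_ [_ [_ [_ [_ _]]]]]] := s 7%N;
  have := cyc 0%N 1%N 7%N; have := cyc 0%N 2%N 5%N; have := cyc 0%N 3%N 4%N; have := cyc 1%N 2%N 4%N; have := cyc 1%N 3%N 5%N; have := cyc 2%N 3%N 7%N; have := cyc 4%N 5%N 7%N;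
  rewrite !n in h0 h1 h2 h3 h4 h5 h7 *; lra.
- have [_ [_ [_ [_ [_ [_ h0]]]]]] := s 0%N; have [_ [_ [_ [_ [_ [h1 _]]]]]] := s 1%N; have [_ [_ [_ [h2 [_ [_ _]]]]]] := s 2%N; have [_ [_ [_ [_ [h3 [_ _]]]]]] := s 3%N; have [_ [h4 [_ [_ [_ [_ _]]]]]] := s 4%N; have [_ [_ [h5 [_ [_ [_ _]]]]]] := s 5%N; have [h6 [_ [_ [_ [_ [_ _]]]]]] := s 6%N;
  have := cyc 0%N 1%N 6%N; have := cyc 0%N 2%N 4%N; have := cyc 0%N 3%N 5%N; have := cyc 1%N 2%N 5%N; have := cyc 1%N 3%N 4%N; have := cyc 2%N 3%N 6%N; have := cyc 4%N 5%N 6%N;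
  rewrite !n in h0 h1 h2 h3 h4 h5 h6 *; lra.
Qed.
End Spin7Curvature.

(** * Connections of closed Spin(7)-structures *)

Section DeriveForms.
Variables (R : realType) (V : normedModType R).

Lemma derive_postlinear (W W' : normedModType R) (L : {linear W -> W'}) (f : V -> W) x u :
  continuous L -> differentiable f x ->
  'D_u (fun y => L (f y)) x = L ('D_u f x).
Proof.
move=> cL df; have dL y : differentiable L y by exact: linear_differentiable.
rewrite !deriveE //; last exact: (@differentiable_comp _ _ _ _ f L).
by rewrite (diff_comp df (dL _)) /= diff_lin.
Qed.

Lemma continuous_mulmx m n p (v : 'M[R]_(m, n)) :
  continuous (mulmx v : 'M[R]_(n, p) -> 'M[R]_(m, p)).
Proof.
move=> y; apply: differentiable_continuous; apply: differentiable_mx => i j.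
have -> : (fun N : 'M[R]_(n, p) => (v *m N) i j : R^o) =
    \sum_k (fun N : 'M[R]_(n, p) => v i k *: (N k j : R^o)).
  by apply/funext => N; rewrite fct_sumE mxE.
apply: differentiable_sum => k.
exact: (differentiableZ (v i k) (differentiable_coord y k j)).
Qed.

Lemma derive_mulmx m n p (v : 'M[R]_(m, n)) (e : V -> 'M[R]_(n, p)) x u :
  differentiable e x -> 'D_u (fun y => v *m e y) x = v *m 'D_u e x.
Proof. by move=> de; apply: derive_postlinear => //; exact: continuous_mulmx. Qed.

Lemma differentiable_mulmx m n p (v : 'M[R]_(m, n)) (e : V -> 'M[R]_(n, p)) x :
  differentiable e x -> differentiable (fun y => v *m e y) x.
Proof.
move=> de; apply: (@differentiable_comp _ _ _ _ e (mulmx v)) => //.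
by apply: linear_differentiable; exact: continuous_mulmx.
Qed.

Lemma smooth_mulmx m n p (v : 'M[R]_(m, n)) (e : V -> 'M[R]_(n, p)) (U : set V) :
  open U -> smooth_on U e -> smooth_on U (fun y => v *m e y).
Proof.
move=> oU se; apply: smooth_mx => // i j; under eq_fun do rewrite mxE.
apply: smooth_sum => // k; apply: smooth_mul => //; first exact: smooth_cst.
exact: smooth_entry.
Qed.

Lemma is_derive_prod (I : eqType) (r : seq I) (g : I -> V -> R^o) x u :
  uniq r -> (forall i, derivable (g i) x u) ->
  is_derive x u (fun y => \prod_(i <- r) g i y : R^o)
    (\sum_(p <- r) 'D_u (g p) x * \prod_(q <- r | q != p) g q x).
Proof.
move=> ur dg; elim: r ur => [_|a r IH /andP[ar /IH{}IH]].
  rewrite big_nil; under eq_fun do rewrite big_nil; exact: is_derive_cst.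
under eq_fun do rewrite big_cons.
have da : is_derive x u (g a) ('D_u (g a) x) by exact: DeriveDef.
apply: is_derive_eq (is_deriveM da IH) _.
rewrite big_cons big_cons eqxx addrC; congr (_ + _).
  rewrite -[LHS]/(_ * _) mulrC; congr (_ * _); rewrite [RHS]big_seq_cond [LHS]big_seq.
  apply: eq_bigl => i; case ir: (i \in r) => //=.
  by apply/esym; apply: contraNneq ar => <-.
rewrite -[LHS]/(_ * _) mulr_sumr [LHS]big_seq [RHS]big_seq; apply: eq_bigr => p pr.
rewrite mulrCA big_cons; have -> // : a != p by apply: contraNneq ar => ->.
Qed.

Lemma is_derive_mull (k : R) (g : V -> R^o) (dg : R) x u :
  is_derive x u g dg -> is_derive x u (fun y => k * g y : R^o) (k * dg).
Proof.
move=> h; apply: is_derive_eq (is_deriveM (is_derive_cst (k : R^o) x u) h) _.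
by rewrite scaler0 addr0.
Qed.

Lemma is_derive_mulf (g h : V -> R^o) (dg dh : R) x u :
  is_derive x u g dg -> is_derive x u h dh ->
  is_derive x u (fun y => g y * h y : R^o) (dg * h x + g x * dh).
Proof.
move=> Dg Dh; apply: is_derive_eq (is_deriveM Dg Dh) _.
by rewrite addrC -[_ *: dg]/(_ * dg) mulrC.
Qed.

Lemma is_derive_pow n (g : V -> R^o) (dg : R) x u :
  is_derive x u g dg ->
  is_derive x u (fun y => g y ^+ n.+1 : R^o) (n.+1%:R * g x ^+ n * dg).
Proof.
move=> h; elim: n => [|n IH].
  by under eq_fun do rewrite expr1; rewrite mul1r mul1r.
under eq_fun do rewrite exprS; apply: is_derive_eq (is_derive_mulf h IH) _.
rewrite [n.+2%:R]mulrS [g x ^+ n.+1]exprS; ring.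
Qed.

Lemma is_derive_bigsum (I : Type) (r : seq I) (g : I -> V -> R^o) (dg : I -> R) x u :
  (forall i, is_derive x u (g i) (dg i)) ->
  is_derive x u (fun y => \sum_(i <- r) g i y : R^o) (\sum_(i <- r) dg i).
Proof.
move=> Dg; elim: r => [|a r IH].
  rewrite big_nil; under eq_fun do rewrite big_nil; exact: is_derive_cst.
rewrite big_cons; under eq_fun do rewrite big_cons.
exact: is_deriveD (Dg a) IH.
Qed.

Lemma derive_bigsum (I : Type) (r : seq I) (g : I -> V -> R^o) x u :
  (forall i, derivable (g i) x u) ->
  'D_u (fun y => \sum_(i <- r) g i y : R^o) x = \sum_(i <- r) 'D_u (g i) x.
Proof.
move=> dg.
have Dg i : is_derive x u (g i) ('D_u (g i) x) by exact: DeriveDef.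
by have [_ ->] := is_derive_bigsum r Dg.
Qed.

Lemma derive_tform n k (c : seq nat -> R) (w : V -> 'M[R]_(k, n)) x u :
  differentiable w x ->
  'D_u (fun y => tform c (w y) : R^o) x =
  \sum_(f : {ffun 'I_k -> 'I_n}) c (idx f) *
    \sum_p ('D_u w x) p (f p) * \prod_(q | q != p) w x q (f q).
Proof.
move=> dw.
have de i j : derivable (fun y => w y i j : R^o) x u.
  by apply: diff_derivable; exact: differentiable_entry.
have dp (f : {ffun 'I_k -> 'I_n}) := @is_derive_prod _ (index_enum 'I_k)
  (fun i y => w y i (f i)) x u (index_enum_uniq _) (fun i => de i (f i)).
have dc (f : {ffun 'I_k -> 'I_n}) : is_derive x u
    (fun y => c (idx f) * \prod_i w y i (f i) : R^o)
    (c (idx f) * \sum_p 'D_u (fun y => w y p (f p) : R^o) x *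
                 \prod_(q | q != p) w x q (f q)).
  apply: is_derive_eq (is_deriveM (is_derive_cst (c (idx f) : R^o) x u) (dp f)) _.
  by rewrite scaler0 addr0.
rewrite /tform derive_bigsum => [|f]; last by have [] := dc f.
apply: eq_bigr => f _; have [_ ->] := dc f; congr (_ * _); apply: eq_bigr => p _.
by rewrite derive_entry //; exact: diff_derivable.
Qed.

End DeriveForms.

Section Frames.
Variables (R : realType) (n k : nat).

Definition upd (b : {ffun 'I_k -> 'I_n}) (p : 'I_k) (i : 'I_n) : {ffun 'I_k -> 'I_n} :=
  [ffun q => if q == p then i else b q].

Lemma idx_upd b p i : idx (upd b p i) = set_nth 0%N (idx b) p i.
Proof.
have sz : size (set_nth 0%N (idx b) p i) = k.
  by rewrite size_set_nth size_idx; apply/maxn_idPr.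
apply: (@eq_from_nth _ 0%N); first by rewrite sz size_idx.
rewrite size_idx => q qk; rewrite -[q]/(nat_of_ord (Ordinal qk)) nth_idx ffunE.
by rewrite nth_set_nth /= -val_eqE /=; case: eqP => // _; rewrite -nth_idx.
Qed.

(** On frame vectors the undifferentiated factors are Kronecker deltas, so only the functions
    agreeing with [b] away from [p] survive. *)
Lemma sum_upd (F : {ffun 'I_k -> 'I_n} -> R) (b : {ffun 'I_k -> 'I_n}) p :
  \sum_f F f * \prod_(q | q != p) (b q == f q)%:R = \sum_i F (upd b p i).
Proof.
rewrite (partition_big (fun f : {ffun 'I_k -> 'I_n} => f p) predT) //=.
apply: eq_bigr => i _; rewrite (bigD1 (upd b p i)) /=; last by rewrite ffunE eqxx.
rewrite [X in _ * X]big1 ?mulr1 => [|q qp]; last by rewrite ffunE (negbTE qp) eqxx.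
rewrite big1 ?addr0 // => f /andP[/eqP fp fu].
have [q qf] : exists q, f q != upd b p i q.
  by apply/existsP; rewrite -negb_forall; apply: contraNN fu => /forallP E;
     apply/eqP/ffunP => q; rewrite (eqP (E q)).
have qp : q != p by apply: contraNneq qf => ->; rewrite ffunE eqxx fp.
rewrite (bigD1 q) //=; move: qf; rewrite ffunE (negbTE qp) eq_sym => /negbTE ->.
by rewrite mul0r mulr0.
Qed.

Lemma idx_surj (w : seq nat) : size w = k -> all (fun i => i < n)%N w ->
  exists f : {ffun 'I_k -> 'I_n}, idx f = w.
Proof.
move=> sw /allP wn.
have lt (i : 'I_k) : (nth 0%N w i < n)%N by apply: wn; rewrite mem_nth ?sw.
exists [ffun i => Ordinal (lt i)]; apply: (@eq_from_nth _ 0%N); first by rewrite size_idx.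
by rewrite size_idx => i ik; rewrite -[i]/(nat_of_ord (Ordinal ik)) nth_idx ffunE.
Qed.
End Frames.

Section TwoRows.
Variables (R : realType) (n : nat).
Implicit Types (v : 'M[R]_(2, n)).

Lemma row'0_2 v : row' ord0 v = row 1 v.
Proof.
by apply/matrixP => i j; rewrite !mxE; congr (v _ _); apply/val_inj; rewrite /= (ord1 i).
Qed.

Lemma row'1_2 v : row' 1 v = row 0 v.
Proof.
by apply/matrixP => i j; rewrite !mxE; congr (v _ _); apply/val_inj; rewrite /= (ord1 i).
Qed.

Lemma extd_1form (w : 'rV[R]_n -> covec R 1 n) x v :
  extd w x v = 'D_(row 0 v) (w^~ (row 1 v)) x - 'D_(row 1 v) (w^~ (row 0 v)) x.
Proof.
rewrite /extd big_ord_recl big_ord1 expr0 mul1r /= expr1 mulN1r.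
have -> : lift ord0 ord0 = 1 :> 'I_2 by apply/val_inj.
by rewrite row'0_2 row'1_2.
Qed.

Lemma row0_col_mx (u w : 'rV[R]_n) : row 0 (col_mx u w : 'M[R]_(1 + 1, n)) = u.
Proof.
apply/rowP => j; rewrite mxE; have -> : 0 = lshift 1 (0 : 'I_1) by apply/val_inj.
exact: (@col_mxEu R 1 1 n u w).
Qed.

Lemma row1_col_mx (u w : 'rV[R]_n) : row 1 (col_mx u w : 'M[R]_(1 + 1, n)) = w.
Proof.
apply/rowP => j; rewrite mxE; have -> : 1 = rshift 1 (0 : 'I_1) by apply/val_inj.
exact: (@col_mxEd R 1 1 n u w).
Qed.

Lemma alternating1_linear (a : covec R 1 n) : is_alternating a ->
  forall s (u v : 'rV[R]_n), a (s *: u + v) = s * a u + a v.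
Proof.
move=> [la _] s u v; apply: (la _ u v ord0).
- by rewrite !row_id.
- by apply/matrixP => -[].
- by apply/matrixP => -[].
Qed.

Lemma alternating1_sum (a : covec R 1 n) (m : nat) (s : 'I_m -> R) (u : 'I_m -> 'rV[R]_n) :
  is_alternating a -> a (\sum_k s k *: u k) = \sum_k s k * a (u k).
Proof.
move=> aa; have L := alternating1_linear aa.
have a0 : a 0 = 0 by have := L 1 0 0; rewrite scaler0 addr0 mul1r; lra.
by elim/big_rec2: _ => [//|k y z _ <-]; rewrite L.
Qed.
End TwoRows.

Section CoframeDifferential.
Variables (R : realType) (n : nat) (U : set 'rV[R]_n) (e : 'rV[R]_n -> 'M[R]_n).
Variable omega : 'I_n -> 'I_n -> 'rV[R]_n -> covec R 1 n.
Hypotheses (se : smooth_on U e) (lc : levi_civita U e omega).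

(** Cartan's first structure equation evaluated on two constant vectors. *)
Lemma dcoframe i x (u v : 'rV[R]_n) : U x ->
  (v *m 'D_u e x) 0 i - (u *m 'D_v e x) 0 i =
  - \sum_j (omega i j x u * (v *m e x) 0 j - omega i j x v * (u *m e x) 0 j).
Proof.
move=> Ux; have := connection_torsion_free lc i (col_mx u v : 'M[R]_(1 + 1, n)) Ux.
rewrite extd_1form row0_col_mx row1_col_mx => E.
have De (w z : 'rV[R]_n) :
    'D_w (coframe_form e i ^~ z : 'rV[R]_n -> R^o) x = (z *m 'D_w e x) 0 i.
  have de := smooth_differentiable se Ux.
  rewrite -(derive_mulmx z w de) -derive_entry //.
  by apply: diff_derivable; exact: differentiable_mulmx.
move: E; rewrite !De => ->; congr (- _); apply: eq_bigr => j _.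
by rewrite wedge_1_1 row0_col_mx row1_col_mx.
Qed.

End CoframeDifferential.

Section ClosedSpin7.
Variables (R : realType) (U : set 'rV[R]_8) (e : 'rV[R]_8 -> 'M[R]_8).
Variable omega : 'I_8 -> 'I_8 -> 'rV[R]_8 -> covec R 1 8.
Hypotheses (oU : open U) (se : smooth_on U e) (ue : forall x, U x -> e x \in unitmx).
Hypothesis lc : levi_civita U e omega.

(** Natural numbers are sent through [inord] so that frame, derivatives and connection carry the
    same indices as the computed tables. *)
Let frame x (k : nat) : 'rV[R]_8 := row (inord k) (invmx (e x)).
Let fD x k i b : R := (frame x b *m 'D_(frame x k) e x) 0 (inord i).
Let fW x k i j : R := omega (inord i) (inord j) x (frame x k).

Lemma frame_coframe x k i : U x -> (frame x k *m e x) 0 i = (inord k == i)%:R.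
Proof. by move=> Ux; rewrite -row_mul mulVmx ?ue // !mxE. Qed.

Lemma frame_torsion x k i b : U x -> fD x k i b - fD x b i k = - (fW x k i b - fW x b i k).
Proof.
move=> Ux; rewrite /fD (dcoframe se lc) // sumrB; congr (- (_ - _)).
  rewrite (bigD1 (inord b)) //= frame_coframe // eqxx mulr1 big1 ?addr0 // => j jb.
  by rewrite frame_coframe // eq_sym (negbTE jb) mulr0.
rewrite (bigD1 (inord k)) //= frame_coframe // eqxx mulr1 big1 ?addr0 // => j jb.
by rewrite frame_coframe // eq_sym (negbTE jb) mulr0.
Qed.

Lemma fW_skew x k : U x -> skew_entries (fW x k).
Proof. by move=> Ux i j; exact: (connection_skew lc). Qed.

Lemma omega_frame x v i j : U x ->
  omega i j x v = \sum_(k < 8) (v *m e x) 0 k * omega i j x (frame x k).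
Proof.
move=> Ux; rewrite -(alternating1_sum _ (frame x)); last exact: (connection_linear lc).
congr (omega i j x _); rewrite -[LHS]mulmx1 -(mulmxV (ue Ux)) mulmxA mulmx_sum_row.
by apply: eq_bigr => k _; rewrite /frame inord_val.
Qed.

Variable Phi : 'rV[R]_8 -> covec R 4 8.
Hypothesis PhiE : forall x v, U x -> Phi x v = spin7_model (e x) v.
Hypothesis Phi_closed : forall x v, U x -> extd Phi x v = 0.

(** The arguments are frozen at their values at [x], so the derivative falls on the coframe alone,
    one slot [q] at a time; the other slots become Kronecker deltas. *)
Lemma derive_Phi_frame x (b : {ffun 'I_4 -> 'I_8}) (u : 'rV[R]_8) : U x ->
  'D_u (Phi^~ (rowsub b (invmx (e x))) : 'rV[R]_8 -> R^o) x =
  \sum_(q < 4) \sum_(i < 8) (spin7_coef (set_nth 0%N (idx b) q i))%:~R *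
     (row (b q) (invmx (e x)) *m 'D_u e x) 0 i.
Proof.
move=> Ux; have de := smooth_differentiable se Ux.
rewrite (@eq_derive_on R _ _ U _ (fun y => tform (fun l => (spin7_coef l)%:~R)
   (rowsub b (invmx (e x)) *m e y) : R^o)) //; last first.
  by move=> y Uy; rewrite PhiE // spin7_modelE.
rewrite derive_tform ?derive_mulmx //; last exact: differentiable_mulmx.
under eq_bigr do rewrite mulr_sumr.
rewrite exchange_big /=; apply: eq_bigr => q _.
have := sum_upd (fun f => (spin7_coef (idx f))%:~R *
  (row (b q) (invmx (e x)) *m 'D_u e x) 0 (f q)) b q.
have -> : \sum_i (spin7_coef (idx (upd b q i)))%:~R *
    (row (b q) (invmx (e x)) *m 'D_u e x) 0 (upd b q i q) =
    \sum_(i < 8) (spin7_coef (set_nth 0%N (idx b) q i))%:~R *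
    (row (b q) (invmx (e x)) *m 'D_u e x) 0 i.
  by apply: eq_bigr => i _; rewrite idx_upd ffunE eqxx.
move=> <-; apply: eq_bigr => f _; rewrite -mulrA; congr (_ * (_ * _)).
  by rewrite !mxE; apply: eq_bigr => j _; rewrite !mxE.
by apply: eq_bigr => p _; rewrite mul_rowsub_mx mulVmx ?ue // !mxE.
Qed.

Lemma idx_lift (a : {ffun 'I_5 -> 'I_8}) (p : 'I_5) :
  idx ([ffun q => a (lift p q)] : {ffun 'I_4 -> 'I_8}) = del_nth (idx a) p.
Proof.
have sz : size (del_nth (idx a) p) = 4%N.
  by rewrite size_cat size_take size_drop size_idx ltn_ord; case: p => -[|[|[|[|[|]]]]].
apply: (@eq_from_nth _ 0%N); first by rewrite size_idx sz.
rewrite size_idx => q q4; rewrite -[q]/(nat_of_ord (Ordinal q4)) nth_idx ffunE -nth_idx.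
rewrite /del_nth nth_cat size_take size_idx ltn_ord /= /bump.
case: ltnP => qp; first by rewrite nth_take.
by rewrite nth_drop add1n addSn subnKC.
Qed.

Lemma closed_terms_frame x (a : {ffun 'I_5 -> 'I_8}) : U x ->
  eval_terms (fD x) (closed_terms (idx a)) = 0.
Proof.
move=> Ux; rewrite -(Phi_closed (rowsub a (invmx (e x))) Ux) /extd.
rewrite /eval_terms /closed_terms big_filter big_mkcond big_flatten big_map.
rewrite -[iota 0 5]/(index_iota 0 5) big_mkord; apply: eq_bigr => p _.
pose b : {ffun 'I_4 -> 'I_8} := [ffun q => a (lift p q)].
have -> : row' p (rowsub a (invmx (e x))) = rowsub b (invmx (e x)).
  by apply/matrixP => q j; rewrite !mxE ffunE.
rewrite derive_Phi_frame // mulr_sumr big_flatten big_map.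
rewrite -[iota 0 4]/(index_iota 0 4) big_mkord; apply: eq_bigr => q _.
rewrite big_map -[iota 0 8]/(index_iota 0 8) big_mkord mulr_sumr.
apply: eq_bigr => i _ /=; rewrite -idx_lift -/b.
set c := spin7_coef _.
have -> : fD x (nth 0%N (idx a) p) i (nth 0%N (idx b) q) =
    (row (b q) (invmx (e x)) *m 'D_(row p (rowsub a (invmx (e x)))) e x) 0 i.
  by rewrite /fD /frame !nth_idx !inord_val row_rowsub.
rewrite mulrA; set D := _ 0 i.
have -> : (if odd p then - c else c)%:~R = (-1) ^+ p * c%:~R :> R.
  by rewrite -signr_odd; case: odd; rewrite ?mul1r ?mulN1r ?rmorphN.
case: eqP => //= c0; suff -> : c = 0 by rewrite mulr0 mul0r.
by move: c0; case: odd => // /eqP; rewrite oppr_eq0 => /eqP.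
Qed.

(** The torsion-free condition turns the components of [d Phi = 0] into equations on the connection
    in each frame direction; the linear equations of spin(7) then pass to any [v] by expansion in
    the frame. *)
Lemma connection_spin7 x v : U x ->
  spin7_rel (fun i j => omega (inord i) (inord j) x v).
Proof.
move=> Ux.
have relW k : (k < 8)%N -> spin7_rel (fW x k).
  apply: spin7_rel_closed => [k'|B m qB m8 mB]; first exact: fW_skew.
  set a := sort leq (m :: B).
  have [f fa] : exists f : {ffun 'I_5 -> 'I_8}, idx f = a.
    move: qB; rewrite mem_filter => /andP[_ wB]; apply: idx_surj.
    - by rewrite size_sort /= (size_words wB).
    - by rewrite all_sort /= m8 (all_words wB).
  have := closed_terms_frame f Ux; rewrite fa (eval_terms_torsion (W := fW x)).
  - by move/eqP; rewrite oppr_eq0 => /eqP.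
  - by move=> k' i b; exact: frame_torsion.
  have /allP/(_ _ qB)/allP/(_ m) := closed_terms_checkT.
  by rewrite mem_iota m8 (negbTE mB) => /(_ isT) /andP[].
apply: (eq_spin7_rel _ (spin7_rel_sum (index_enum 'I_8) (fun k => (v *m e x) 0 k)
  (fun k => relW k (ltn_ord k)))) => i j.
by rewrite [RHS]omega_frame.
Qed.

End ClosedSpin7.

(** * Ricci flatness *)

Section SpinCurvature.
Variables (R : realType) (U : set 'rV[R]_8) (e : 'rV[R]_8 -> 'M[R]_8).
Variable omega : 'I_8 -> 'I_8 -> 'rV[R]_8 -> covec R 1 8.
Hypotheses (oU : open U) (se : smooth_on U e) (ue : forall x, U x -> e x \in unitmx).
Hypothesis lc : levi_civita U e omega.

Lemma derivable_omega i j x (u v : 'rV[R]_8) : U x ->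
  derivable (omega i j ^~ v : 'rV[R]_8 -> R^o) x u.
Proof. by move=> Ux; exact: smooth_derivable (connection_smooth lc i j v) Ux. Qed.

Lemma derive_relation4 (f g h k : 'rV[R]_8 -> R^o) (a b c : R) x u : U x ->
  derivable f x u -> derivable g x u -> derivable h x u -> derivable k x u ->
  (forall y, U y -> f y + a * g y + b * h y + c * k y = 0) ->
  'D_u f x + a * 'D_u g x + b * 'D_u h x + c * 'D_u k x = 0.
Proof.
move=> Ux df dg dh dk E.
have D : is_derive x u (f + a \*: g + b \*: h + c \*: k : 'rV[R]_8 -> R^o)
    ('D_u f x + a *: 'D_u g x + b *: 'D_u h x + c *: 'D_u k x).
  have D0 (F : 'rV[R]_8 -> R^o) : derivable F x u -> is_derive x u F ('D_u F x).
    by move=> dF; exact: DeriveDef.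
  exact: is_deriveD (is_deriveD (is_deriveD (D0 _ df) (is_deriveZ a (D0 _ dg)))
    (is_deriveZ b (D0 _ dh))) (is_deriveZ c (D0 _ dk)).
have [_ <-] := D; rewrite (@eq_derive_on R _ _ U _ (cst 0)) ?derive_cst //.
Qed.

(** The equations of spin(7) have constant coefficients and hold on the open set [U], so they can be
    differentiated term by term. *)
Lemma derive_connection_spin7 x (u v : 'rV[R]_8) : U x ->
  (forall y, U y -> spin7_rel (fun i j => omega (inord i) (inord j) y v)) ->
  spin7_rel (fun i j => 'D_u (omega (inord i) (inord j) ^~ v : 'rV[R]_8 -> R^o) x).
Proof.
move=> Ux rel.
pose h i j : 'rV[R]_8 -> R^o := omega (inord i) (inord j) ^~ v.
have dh i j : derivable (h i j) x u by exact: derivable_omega.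
have D i1 j1 i2 j2 i3 j3 i4 j4 a b c := @derive_relation4 _ _ _ _ a b c _ _ Ux
  (dh i1 j1) (dh i2 j2) (dh i3 j3) (dh i4 j4).
do ?split.
- have := D 0%N 1%N 2%N 3%N 4%N 5%N 6%N 7%N 1 1 1; rewrite ?mul1r ?mulN1r; apply=> y /rel[r _].
  by rewrite ?mul1r ?mulN1r.
- have := D 0%N 2%N 1%N 3%N 4%N 7%N 5%N 6%N (-1) 1 1; rewrite ?mul1r ?mulN1r; apply=> y /rel[_ [r _]].
  by rewrite ?mul1r ?mulN1r.
- have := D 0%N 3%N 1%N 2%N 4%N 6%N 5%N 7%N 1 1 (-1); rewrite ?mul1r ?mulN1r; apply=> y /rel[_ [_ [r _]]].
  by rewrite ?mul1r ?mulN1r.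
- have := D 0%N 4%N 1%N 5%N 2%N 7%N 3%N 6%N (-1) (-1) (-1); rewrite ?mul1r ?mulN1r; apply=> y /rel[_ [_ [_ [r _]]]].
  by rewrite ?mul1r ?mulN1r.
- have := D 0%N 5%N 1%N 4%N 2%N 6%N 3%N 7%N 1 (-1) 1; rewrite ?mul1r ?mulN1r; apply=> y /rel[_ [_ [_ [_ [r _]]]]].
  by rewrite ?mul1r ?mulN1r.
- have := D 0%N 6%N 1%N 7%N 2%N 5%N 3%N 4%N (-1) 1 1; rewrite ?mul1r ?mulN1r; apply=> y /rel[_ [_ [_ [_ [_ [r _]]]]]].
  by rewrite ?mul1r ?mulN1r.
- have := D 0%N 7%N 1%N 6%N 2%N 4%N 3%N 5%N 1 1 (-1); rewrite ?mul1r ?mulN1r; apply=> y /rel[_ [_ [_ [_ [_ [_ r]]]]]].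
  by rewrite ?mul1r ?mulN1r.
Qed.

(** The first Bianchi identity, from [d (d e^i) = 0]. The structure equation is differentiated once
    more, in the third of three constant vectors, and summed cyclically; the first derivatives of
    the coframe that remain are eliminated by the structure equation again. *)
Lemma coframe_bianchi i x (u v w : 'rV[R]_8) : U x ->
  let Om j a b := curvature omega i j x (col_mx a b : 'M[R]_(1 + 1, 8)) in
  \sum_j (Om j w u * (v *m e x) 0 j + Om j u v * (w *m e x) 0 j +
          Om j v w * (u *m e x) 0 j) = 0.
Proof.
move=> Ux Om.
pose eta j (z : 'rV[R]_8) : 'rV[R]_8 -> R^o := fun y => (z *m e y) 0 j.
pose o p q z : 'rV[R]_8 -> R^o := omega p q ^~ z.
have seta j z : smooth_on U (eta j z).
  by apply: smooth_entry => //; exact: smooth_mulmx.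
have so p q z : smooth_on U (o p q z) by exact: connection_smooth lc p q z.
have Deta j z a y : U y -> 'D_a (eta j z) y = (z *m 'D_a e y) 0 j.
  move=> Uy; have de := smooth_differentiable se Uy.
  rewrite -(derive_mulmx z a de) -derive_entry //.
  by apply: diff_derivable; exact: differentiable_mulmx.
have T p a b y : U y -> 'D_a (eta p b) y - 'D_b (eta p a) y =
    - \sum_j (o p j a y * eta j b y - o p j b y * eta j a y).
  by move=> Uy; rewrite !Deta //; exact: (dcoframe se lc).
have dT c a b : 'D_c ('D_a (eta i b)) x - 'D_c ('D_b (eta i a)) x =
    - \sum_j ((o i j a x * 'D_c (eta j b) x + eta j b x * 'D_c (o i j a) x) -
              (o i j b x * 'D_c (eta j a) x + eta j a x * 'D_c (o i j b) x)).
  have dDeta p q : derivable ('D_p (eta i q)) x c.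
    exact: smooth_derivable (smooth_derive p (seta i q)) Ux.
  have deta j z : derivable (eta j z) x c by exact: smooth_derivable (seta j z) Ux.
  have do_ j z : derivable (o i j z) x c by exact: smooth_derivable (so i j z) Ux.
  rewrite -deriveB //.
  rewrite (@eq_derive_on R _ _ U _
    (- (fun y => \sum_j (o i j a y * eta j b y - o i j b y * eta j a y) : R^o))) //;
    last by move=> y Uy; exact: T.
  have dj j : is_derive x c (o i j a * eta j b - o i j b * eta j a : 'rV[R]_8 -> R^o)
     ((o i j a x * 'D_c (eta j b) x + eta j b x * 'D_c (o i j a) x) -
      (o i j b x * 'D_c (eta j a) x + eta j a x * 'D_c (o i j b) x)).
    by apply: is_deriveB; apply: is_deriveM; exact: DeriveDef.
  have dj' j := @ex_derive _ _ _ _ _ _ _ (dj j).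
  rewrite deriveN; last first.
    rewrite (_ : (fun y => _) = \sum_j (o i j a * eta j b - o i j b * eta j a)).
      exact: derivable_sum.
    by apply/funext => y; rewrite fct_sumE.
  by rewrite derive_bigsum //; congr (- _); apply: eq_bigr => j _; have [_ ->] := dj j.
have E := dT w u v; have E1 := dT u v w; have E2 := dT v w u.
(* By symmetry the six second derivatives of the coframe cancel in pairs in the cyclic sum. *)
have sc p a b : 'D_a ('D_b (eta i p)) x = 'D_b ('D_a (eta i p)) x.
  exact: smooth_derive_comm (seta i p) Ux.
rewrite (sc v w u) in E; rewrite (sc w u v) in E1; rewrite (sc u v w) in E2.
have Z : \sum_j (eta j v x * ('D_w (o i j u) x - 'D_u (o i j w) x) +
                 eta j w x * ('D_u (o i j v) x - 'D_v (o i j u) x) +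
                 eta j u x * ('D_v (o i j w) x - 'D_w (o i j v) x) +
      (o i j u x * ('D_w (eta j v) x - 'D_v (eta j w) x) +
       o i j v x * ('D_u (eta j w) x - 'D_w (eta j u) x) +
       o i j w x * ('D_v (eta j u) x - 'D_u (eta j v) x))) = 0.
  move: E E1 E2.
  set a1 := 'D_u _ x; set a2 := 'D_w _ x; set a3 := 'D_v _ x.
  set s1 := \sum_j _; set s2 := \sum_j _; set s3 := \sum_j _ => E E1 E2.
  transitivity (s1 + s2 + s3); last by move: E E1 E2; lra.
  rewrite -!big_split; apply: eq_bigr => j _ /=.
  move: (o i j u x) (o i j v x) (o i j w x) (eta j u x) (eta j v x) (eta j w x).
  move: ('D_w (o i j u) x) ('D_u (o i j w) x) ('D_u (o i j v) x) ('D_v (o i j u) x).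
  move: ('D_v (o i j w) x) ('D_w (o i j v) x) ('D_w (eta j v) x) ('D_v (eta j w) x).
  move: ('D_u (eta j w) x) ('D_w (eta j u) x) ('D_v (eta j u) x) ('D_u (eta j v) x).
  move=> *; ring.
pose P p b z := \sum_k o p k b x * eta k z x.
have TP p a b : 'D_a (eta p b) x - 'D_b (eta p a) x = - (P p a b - P p b a).
  by rewrite T // sumrB.
have OmE j a b : Om j a b = 'D_a (o i j b) x - 'D_b (o i j a) x +
    \sum_k (o i k a x * o k j b x - o i k b x * o k j a x).
  rewrite /Om /curvature extd_1form row0_col_mx row1_col_mx; congr (_ + _).
  by apply: eq_bigr => k _; rewrite wedge_1_1 row0_col_mx row1_col_mx.
(* The part [omega_ik /\ omega_kj /\ e^j] is regrouped around [P], the expression that the structure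
   equation substitutes for [d e^k]. *)
have Q a b z : \sum_j (\sum_k (o i k a x * o k j b x - o i k b x * o k j a x)) * eta j z x =
    \sum_k (o i k a x * P k b z - o i k b x * P k a z).
  under eq_bigr do rewrite mulr_suml.
  rewrite exchange_big; apply: eq_bigr => k _ /=.
  rewrite /P !mulr_sumr -sumrB; apply: eq_bigr => j _; ring.
rewrite -[RHS]Z.
transitivity (\sum_j (eta j v x * ('D_w (o i j u) x - 'D_u (o i j w) x) +
                 eta j w x * ('D_u (o i j v) x - 'D_v (o i j u) x) +
                 eta j u x * ('D_v (o i j w) x - 'D_w (o i j v) x)) +
  (\sum_k (o i k w x * P k u v - o i k u x * P k w v) +
   \sum_k (o i k u x * P k v w - o i k v x * P k u w) +
   \sum_k (o i k v x * P k w u - o i k w x * P k v u))).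
  rewrite -!Q -!big_split; apply: eq_bigr => j _ /=.
  rewrite !OmE -![(_ *m e x) 0 j]/(eta j _ x).
  move: (eta j u x) (eta j v x) (eta j w x) ('D_w (o i j u) x) ('D_u (o i j w) x).
  move: ('D_u (o i j v) x) ('D_v (o i j u) x) ('D_v (o i j w) x) ('D_w (o i j v) x).
  move=> *; ring.
rewrite -!big_split; apply: eq_bigr => j _ /=.
rewrite (TP j w v) (TP j u w) (TP j v u).
move: (eta j u x) (eta j v x) (eta j w x) ('D_w (o i j u) x) ('D_u (o i j w) x).
move: ('D_u (o i j v) x) ('D_v (o i j u) x) ('D_v (o i j w) x) ('D_w (o i j v) x).
move=> *; ring.
Qed.

Hypothesis omega_spin7 : forall x v, U x ->
  spin7_rel (fun i j => omega (inord i) (inord j) x v).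

(** [d omega] stays in spin(7) by differentiating linear equations, and [omega /\ omega] on two
    vectors is the bracket of two elements of spin(7). *)
Lemma curvature_spin7 x (u v : 'rV[R]_8) : U x ->
  spin7_rel (fun i j =>
    curvature omega (inord i) (inord j) x (col_mx u v : 'M[R]_(1 + 1, 8))).
Proof.
move=> Ux.
have D a b := derive_connection_spin7 a Ux (fun y Uy => omega_spin7 b Uy).
have sk a : skew_entries (fun i j => omega (inord i) (inord j) x a).
  by move=> i j; exact: (connection_skew lc).
have B := spin7_rel_bracket (sk u) (sk v) (omega_spin7 u Ux) (omega_spin7 v Ux).
apply: (eq_spin7_rel _ (spin7_rel_add (spin7_rel_add (D u v)
  (spin7_rel_scale (-1) (D v u))) B)) => i j.
rewrite /curvature extd_1form row0_col_mx row1_col_mx mulN1r; congr (_ + _).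
apply: eq_bigr => k _; rewrite wedge_1_1 row0_col_mx row1_col_mx.
by rewrite /bracket !inord_val.
Qed.

Lemma curvature_swap i j x (u v : 'rV[R]_8) : U x ->
  curvature omega i j x (col_mx u v : 'M[R]_(1 + 1, 8)) =
  - curvature omega i j x (col_mx v u : 'M[R]_(1 + 1, 8)).
Proof.
move=> Ux; rewrite /curvature !extd_1form !row0_col_mx !row1_col_mx opprD opprB.
congr (_ + _); rewrite -sumrN; apply: eq_bigr => k _.
rewrite !wedge_1_1 !row0_col_mx !row1_col_mx; ring.
Qed.

Lemma curvature_skew i j x (u v : 'rV[R]_8) : U x ->
  curvature omega i j x (col_mx u v : 'M[R]_(1 + 1, 8)) =
  - curvature omega j i x (col_mx u v : 'M[R]_(1 + 1, 8)).
Proof.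
move=> Ux; rewrite /curvature !extd_1form !row0_col_mx !row1_col_mx.
have D (a b : 'rV[R]_8) : 'D_a (omega i j ^~ b : 'rV[R]_8 -> R^o) x =
    - 'D_a (omega j i ^~ b : 'rV[R]_8 -> R^o) x.
  rewrite -deriveN; last exact: derivable_omega.
  by apply: (@eq_derive_on R _ _ U) => // y Uy; exact: (connection_skew lc).
rewrite [X in X - _ + _]D [X in _ - X + _]D opprD !opprB opprK.
congr (_ + _); first by rewrite addrC.
rewrite -sumrN; apply: eq_bigr => k _.
rewrite !wedge_1_1 !row0_col_mx !row1_col_mx.
rewrite !(connection_skew lc i k _ Ux) !(connection_skew lc k j _ Ux); ring.
Qed.

Lemma ricci_flat x j l : U x -> ricci e omega x j l = 0.
Proof.
move=> Ux; rewrite /ricci.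
pose E (k : nat) : 'rV[R]_8 := row (inord k) (invmx (e x)).
pose r i j k l := curvature omega (inord i) (inord j) x (col_mx (E k) (E l) : 'M[R]_(1 + 1, 8)).
have Ee k i : (E k *m e x) 0 i = (inord k == i)%:R.
  by rewrite -row_mul mulVmx ?ue // !mxE.
have rb p a b c : r p a b c + r p b c a + r p c a b = 0.
  have := coframe_bianchi (inord p) (E a) (E b) (E c) Ux.
  rewrite /= !big_split /=.
  have S (F : 'I_8 -> R) q : \sum_j F j * (E q *m e x) 0 j = F (inord q).
    rewrite (bigD1 (inord q)) //= Ee eqxx mulr1 big1 ?addr0 // => k kq.
    by rewrite Ee eq_sym (negbTE kq) mulr0.
  by rewrite !S -!/(r _ _ _ _) => <-; rewrite addrC addrA.
have R0 : \sum_(i < 8) r i j i l = 0.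
  apply: (ricci_spin7 _ _ rb) => // *; first exact: curvature_skew.
    exact: curvature_swap.
  exact: curvature_spin7.
by rewrite -[RHS]R0; apply: eq_bigr => i _; rewrite /r /E !inord_val.
Qed.
End SpinCurvature.

(** * Warped forms on the cylinder *)

Section DoubleDeletion.
Variables (R : realType) (n k : nat).
Implicit Types (u : 'M[R]_(n.+2, k)).

Lemma sum_lift (F : 'I_n.+2 -> R) (i : 'I_n.+2) : \sum_(j < n.+1) F (lift i j) = \sum_(m | m != i) F m.
Proof.
rewrite (reindex_onto (lift i) (fun m => odflt ord0 (unlift i m))) /=; last first.
  by move=> m mi; case: unliftP => [j ->//|E]; rewrite E eqxx in mi.
by apply: eq_bigl => j; rewrite liftK eqxx andbT eq_sym neq_lift.
Qed.

(** Deleting the indices [i] and [m] in the order [i], [m] carries the sign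
    [(-1) ^+ (i + m + (i < m))], and exchanging the order flips it: the mechanism behind the
    vanishing of double alternating sums. *)
Lemma sum_lift_swap (H : 'I_n.+2 -> 'I_n.+2 -> R) :
  \sum_(i < n.+2) \sum_(j < n.+1) (-1) ^+ (i + j) * H i (lift i j) =
  - \sum_(m < n.+2) \sum_(l < n.+1) (-1) ^+ (m + l) * H (lift m l) m.
Proof.
pose s (i m : 'I_n.+2) : R := (-1) ^+ (i + m + (i < m)%N).
have s1 (i : 'I_n.+2) (j : 'I_n.+1) : (-1) ^+ (i + j) = s i (lift i j) :> R.
  rewrite /s /= /bump; case: (leqP i j) => h.
    by rewrite add1n ltnS h addn1 addnS !exprS !mulN1r opprK.
  by rewrite add0n ltnNge (ltnW h) addn0.
have s2 (m : 'I_n.+2) (l : 'I_n.+1) : (-1) ^+ (m + l) = - s (lift m l) m :> R.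
  rewrite /s /= /bump; case: (leqP m l) => h.
    by rewrite add1n ltnNge (leqW h) addn0 addSn exprS mulN1r opprK addnC.
  by rewrite add0n h addn1 exprS mulN1r opprK addnC.
under eq_bigr => i _ do [under eq_bigr do rewrite s1; rewrite (sum_lift (fun m => s i m * H i m))].
under [in RHS]eq_bigr => m _ do [under eq_bigr do rewrite s2 mulNr;
  rewrite sumrN (sum_lift (fun i => s i m * H i m))].
rewrite sumrN opprK (exchange_big_dep predT) //=.
by apply: eq_bigr => m _; apply: eq_bigl => i; rewrite eq_sym.
Qed.

(** Names the doubly reduced matrix by the original row indices, so that the two orders of deletion
    can be compared; 0 is a default at [i = m]. *)
Definition del2 u (i m : 'I_n.+2) : 'M[R]_(n, k) :=
  if unlift i m is Some j then row' j (row' i u) else 0.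

Lemma del2_lift u (i : 'I_n.+2) (j : 'I_n.+1) : del2 u i (lift i j) = row' j (row' i u).
Proof. by rewrite /del2 liftK. Qed.

Lemma del2_swap u (m : 'I_n.+2) (l : 'I_n.+1) : del2 u (lift m l) m = row' l (row' m u).
Proof.
rewrite /del2; case: unliftP => [j mE|E]; last by have /eqP := neq_lift m l; rewrite -E.
apply/matrixP => p q; rewrite !mxE; congr (u _ _); apply/val_inj => /=.
have : (m : nat) = bump (bump m l) j := congr1 val mE.
rewrite /bump; case: (leqP m l) => h1; case: (leqP l p) => h2; rewrite ?(add1n, add0n);
  case: (leqP j p) => h3; rewrite ?(add1n, add0n);
  do 3!(case: leqP => ?; rewrite ?(add1n, add0n)); lia.
Qed.
End DoubleDeletion.

Section Cylinder.
Variable R : realType.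

Definition tcoord (n : nat) (y : 'rV[R]_(n + 1)) : R^o := rsubmx y 0 0.

Fact tcoord_linear n : linear (@tcoord n).
Proof. by move=> a u v; rewrite /tcoord linearP !mxE. Qed.

HB.instance Definition _ n :=
  GRing.isLinear.Build R 'rV[R]_(n + 1) R^o _ (@tcoord n) (@tcoord_linear n).

Lemma tcoord_continuous n : continuous (@tcoord n).
Proof.
move=> y; apply: differentiable_continuous.
by apply: differentiable_entry; exact: differentiable_rsubmx.
Qed.

Lemma lsubmx_continuous n : continuous (lsubmx : 'rV[R]_(n + 1) -> 'rV[R]_n).
Proof. by move=> y; apply: differentiable_continuous; exact: differentiable_lsubmx. Qed.

Lemma derive_tcoord n (f : R^o -> R^o) (y z : 'rV[R]_(n + 1)) :
  differentiable f (tcoord y) ->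
  'D_z (fun y => f (tcoord y)) y = tcoord z * 'D_1 f (tcoord y).
Proof.
move=> df; rewrite (derive_comp_linear (L := @tcoord n) _ (@tcoord_continuous n)) //.
rewrite !deriveE // -[X in 'd f _ X = _](mulr1 (tcoord z)).
by rewrite -[tcoord z * 1]/(tcoord z *: (1 : R^o)) linearZ.
Qed.

Lemma derive_lsubmx n (g : 'rV[R]_n -> R^o) (y z : 'rV[R]_(n + 1)) :
  differentiable g (lsubmx y) ->
  'D_z (fun y => g (lsubmx y)) y = 'D_(lsubmx z) g (lsubmx y).
Proof.
move=> dg.
exact: (derive_comp_linear (L := lsubmx) _ (@lsubmx_continuous n) dg).
Qed.

Lemma is_derive_lsubmx n (g : 'rV[R]_n -> R^o) (y z : 'rV[R]_(n + 1)) :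
  differentiable g (lsubmx y) ->
  is_derive y z (fun y => g (lsubmx y)) ('D_(lsubmx z) g (lsubmx y)).
Proof.
move=> dg; apply: DeriveDef; last exact: derive_lsubmx.
apply: diff_derivable; apply: (@differentiable_comp _ _ _ _ lsubmx g) => //.
exact: differentiable_lsubmx.
Qed.

Lemma is_derive_tcoord n (f : R^o -> R^o) (y z : 'rV[R]_(n + 1)) :
  differentiable f (tcoord y) ->
  is_derive y z (fun y => f (tcoord y)) (tcoord z * 'D_1 f (tcoord y)).
Proof.
move=> df; apply: DeriveDef; last exact: derive_tcoord.
apply: diff_derivable; apply: (@differentiable_comp _ _ _ _ (@tcoord n) f) => //.
by apply: linear_differentiable; exact: tcoord_continuous.
Qed.

Variables (O : set 'rV[R]_7) (f : R^o -> R^o).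
Variables (a : 'rV[R]_7 -> covec R 3 7) (b : 'rV[R]_7 -> covec R 4 7).
Hypothesis oO : open O.
Hypothesis da : forall x w, O x -> differentiable (a^~ w : 'rV[R]_7 -> R^o) x.
Hypothesis db : forall x w, O x -> differentiable (b^~ w : 'rV[R]_7 -> R^o) x.
Hypothesis alt_a : forall x, O x -> perm_alternating (a x).

Definition cyl_form (y : 'rV[R]_(7 + 1)) (v : 'M[R]_(4, 7 + 1)) : R :=
  f (tcoord y) ^+ 3 * wedge (fun u : 'M[R]_(3, 7 + 1) => a (lsubmx y) (lsubmx u))
    (fun u : 'M[R]_(1, 7 + 1) => rsubmx u 0 0) (v : 'M[R]_(3 + 1, 7 + 1)) +
  f (tcoord y) ^+ 4 * b (lsubmx y) (lsubmx v).

Lemma cyl_formE y v : O (lsubmx y) -> cyl_form y v =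
  f (tcoord y) ^+ 3 * (\sum_(j < 4) (-1) ^+ (3 + j) *
    rsubmx v j 0 * a (lsubmx y) (row' j (lsubmx v))) +
  f (tcoord y) ^+ 4 * b (lsubmx y) (lsubmx v).
Proof.
move=> Oy; rewrite /cyl_form wedge_3_1; last first.
  move=> s u; rewrite -alt_a //; congr (a _ _).
  by apply/matrixP => i j; rewrite !mxE.
congr (_ * _ + _); apply: eq_bigr => j _; rewrite mulrAC; congr (_ * _ * a _ _).
  by rewrite !mxE.
by apply/matrixP => p q; rewrite !mxE.
Qed.

Lemma derive_cyl_form y (z : 'rV[R]_(7 + 1)) v : O (lsubmx y) ->
  differentiable f (tcoord y) ->
  let t := tcoord y in let x := lsubmx y in
  'D_z (cyl_form^~ v : 'rV[R]_(7 + 1) -> R^o) y =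
  3 * f t ^+ 2 * (tcoord z * 'D_1 f t) * (\sum_(j < 4) (-1) ^+ (3 + j) *
    rsubmx v j 0 * a x (row' j (lsubmx v))) +
  f t ^+ 3 * (\sum_(j < 4) (-1) ^+ (3 + j) *
    rsubmx v j 0 * 'D_(lsubmx z) (a^~ (row' j (lsubmx v)) : 'rV[R]_7 -> R^o) x) +
  4 * f t ^+ 3 * (tcoord z * 'D_1 f t) * b x (lsubmx v) +
  f t ^+ 4 * 'D_(lsubmx z) (b^~ (lsubmx v) : 'rV[R]_7 -> R^o) x.
Proof.
move=> Oy df t x.
have oO' : open (lsubmx @^-1` O : set 'rV[R]_(7 + 1)).
  by apply: open_comp => // u _; exact: lsubmx_continuous.
rewrite (eq_derive_on z oO' (fun y => @cyl_formE y v) Oy).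
have F := is_derive_tcoord z df.
have A j := is_derive_lsubmx z (@da _ (row' j (lsubmx v)) Oy).
have B := is_derive_lsubmx z (@db _ (lsubmx v) Oy).
have S : is_derive y z (fun y : 'rV[R]_(7 + 1) => \sum_(j < 4) (-1) ^+ (3 + j) *
    rsubmx v j 0 * a (lsubmx y) (row' j (lsubmx v)) : R^o)
    (\sum_(j < 4) (-1) ^+ (3 + j) *
    rsubmx v j 0 * 'D_(lsubmx z) (a^~ (row' j (lsubmx v)) : 'rV[R]_7 -> R^o) x).
  by apply: is_derive_bigsum => j; apply: is_derive_mull; exact: A.
have D := is_deriveD (is_derive_mulf (is_derive_pow 2 F) S)
  (is_derive_mulf (is_derive_pow 3 F) B).
have [_ ->] := D; rewrite -/t -/x.
by rewrite -[LHS]/(_ + _); ring.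
Qed.

(** This is [dt /\ (f^3 da + 4 f^3 f' b) + f^4 db], with index [m] marking the vector fed to [dt].
    The derivative of [f^3] disappears since [dt /\ dt = 0]. *)
Lemma extd_cyl_form y (v : 'M[R]_(5, 7 + 1)) : O (lsubmx y) ->
  differentiable f (tcoord y) ->
  let t := tcoord y in let x := lsubmx y in
  extd cyl_form y v =
  \sum_(m < 5) (-1) ^+ m * rsubmx v m 0 *
    (f t ^+ 3 * extd a x (row' m (lsubmx v)) +
     4 * f t ^+ 3 * 'D_1 f t * b x (row' m (lsubmx v))) +
  f t ^+ 4 * extd b x (lsubmx v).
Proof.
move=> Oy df t x; rewrite /extd.
under eq_bigr => i _ do rewrite derive_cyl_form //.
pose u := lsubmx v; pose s i := rsubmx v i 0.
have uE (i : 'I_5) : lsubmx (row' i v) = row' i u by apply/matrixP => p q; rewrite !mxE.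
have ruE (i : 'I_5) : lsubmx (row i v) = row i u by apply/rowP => q; rewrite !mxE.
have sE (i : 'I_5) (j : 'I_4) : rsubmx (row' i v) j 0 = s (lift i j) by rewrite /s !mxE.
have tE (i : 'I_5) : tcoord (row i v) = s i by rewrite /tcoord /s !mxE.
pose G i m : R := s m * 'D_(row i u) (a^~ (del2 u i m) : 'rV[R]_7 -> R^o) x.
pose K i m : R := s i * s m * a x (del2 u i m).
(* [dt /\ dt = 0]: the summand [K] is symmetric in its two indices, so the signed sum equals its own
   negative. *)
have S1 : \sum_(i < 5) \sum_(j < 4) (-1) ^+ (i + j) * K i (lift i j) = 0.
  have := sum_lift_swap K.
  under [in X in _ = - X]eq_bigr => m _ do under eq_bigr => l _ do
    rewrite /K del2_swap -(del2_lift u) [s _ * s m]mulrC.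
  by rewrite -/K; set X := \sum_i _ => E; lra.
(* The order is exchanged so that the vector fed to [dt] is deleted first; the inner sum is then the
   exterior derivative of [a]. *)
have S2 := sum_lift_swap G.
transitivity (3 * f t ^+ 2 * 'D_1 f t * - (\sum_(i < 5) \sum_(j < 4) (-1) ^+ (i + j) * K i (lift i j)) +
  f t ^+ 3 * - (\sum_(i < 5) \sum_(j < 4) (-1) ^+ (i + j) * G i (lift i j)) +
  \sum_(i < 5) ((-1) ^+ i * s i * (4 * f t ^+ 3 * 'D_1 f t * b x (row' i u)) +
    f t ^+ 4 * ((-1) ^+ i * 'D_(row i u) (b^~ (row' i u) : 'rV[R]_7 -> R^o) x))).
  rewrite -!sumrN !mulr_sumr -!big_split /=; apply: eq_bigr => i _.
  rewrite -!sumrN !mulr_sumr -/t -/x uE ruE tE.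
  rewrite mulrDr mulrDr mulrDr -!addrA; congr (_ + (_ + _)).
  - rewrite !mulr_sumr; apply: eq_bigr => j _; rewrite sE /K del2_lift exprD [(-1) ^+ (i + j)]exprD; ring.
  - rewrite !mulr_sumr; apply: eq_bigr => j _; rewrite sE /G del2_lift exprD [(-1) ^+ (i + j)]exprD; ring.
  - ring.
rewrite S1 S2 oppr0 mulr0 add0r opprK big_split /= addrA; congr (_ + _); last by rewrite mulr_sumr.
rewrite mulr_sumr -big_split; apply: eq_bigr => m _ /=.
rewrite -/u -/(s m) [RHS]mulrDr; congr (_ + _).
rewrite !mulr_sumr; apply: eq_bigr => l _; rewrite /G del2_swap exprD.
have -> : row l (row' m u) = row (lift m l) u by apply/rowP => q; rewrite !mxE.
ring.
Qed.
End Cylinder.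

(** * The dual 4-form and its warped coframes *)

Section G2Star.
Variables (R : realType) (M : topologicalType) (A : atlas R 7 M) (phi : dform A 3).
Hypothesis hM : smooth_manifold A.
Hypothesis hphi : g2_structure phi.

Lemma g2_adapted c x : cimg c x -> exists e, adapted g2_model (phi c x) e.
Proof.
move=> cx; have [U [e [Ux [_ _ _ ad]]]] := hphi.2 c x cx.
by exists (e x); exact: ad.
Qed.

(** The coframe chosen by [xget] is adapted as soon as some adapted coframe exists, and all adapted
    coframes give the same dual form. *)
Lemma g2_starE c x e : adapted g2_model (phi c x) e ->
  g2_star phi c x = g2_dual e.
Proof.
move=> ad; have ad0 : [set e | adapted g2_model (phi c x) e]
    (xget 1%:M [set e | adapted g2_model (phi c x) e]) by apply: xgetI ad.
apply/funext => w; rewrite /g2_star /form_star (g2_dual_star _ ad0).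
by have [_ ->] := g2_coframe_change ad0 ad.2.
Qed.

Lemma smooth_tform n k (V : normedModType R) (U : set V) (c : seq nat -> R)
    (w : V -> 'M[R]_(k, n)) :
  open U -> smooth_on U w -> smooth_on U (fun y => tform c (w y) : R^o).
Proof.
move=> oU sw; apply: smooth_sum => // f; apply: smooth_mul => //; first exact: smooth_cst.
by apply: smooth_prod => // i; exact: smooth_entry.
Qed.

Lemma transition_cimg (c c' : chart A) x : overlap c c' x ->
  [/\ cimg c x, cimg c' (transition c c' x) & differentiable (transition c c') x].
Proof.
move=> ov; have [p [cp c'p] px] := ov; split.
- by exists p.
- by exists p => //; rewrite /transition /= -px cmapK.
- exact: smooth_differentiable (transition_smooth hM (c':=c')) ov.
Qed.

Lemma derive_rows n m k (g : 'rV[R]_n -> 'rV[R]_m) x (v : 'M[R]_(k, n)) :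
  differentiable g x -> \matrix_(i < k) 'D_(row i v) g x = v *m jacobian g x.
Proof. by move=> dg; apply/row_matrixP => i; rewrite rowK row_mul deriveEjacobian. Qed.

(** Compatibility only shows that the pulled-back matrix represents [phi]; comparison with an
    adapted coframe at [x] makes it invertible. *)
Lemma g2_transition (c c' : chart A) x e' : overlap c c' x ->
  adapted g2_model (phi c' (transition c c' x)) e' ->
  adapted g2_model (phi c x) (jacobian (transition c c') x *m e').
Proof.
move=> ov ad'; have [cx c'x dt] := transition_cimg ov.
have [e ad] := g2_adapted cx.
have E v : phi c x v = g2_model (jacobian (transition c c') x *m e') v.
  rewrite (form_compatible hphi.1 v ov) derive_rows // ad'.2 !g2_modelE.
  by rewrite mulmxA.
by have [] := g2_coframe_change ad E.
Qed.

Lemma g2_star_form : is_form (g2_star phi).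
Proof.
split=> [c x cx|c v vs x cx|c c' x v ov].
- by have [e ad] := g2_adapted cx; rewrite (g2_starE ad); exact: alternating_g2_dual.
- have [U [e [Ux [oU Uc se ad]]]] := hphi.2 c x cx.
  have : smooth_on U (fun x => g2_star phi c x v : R^o); last by move=> s; exact: s.
  apply: (@eq_smooth_on _ _ _ U (fun x => tform (fun l => (g2_dual_coef l)%:~R) (v *m e x) : R^o)) => //.
    by move=> y Uy; rewrite (g2_starE (ad y Uy)) g2_dual_tform.
  by apply: smooth_tform => //; exact: smooth_mulmx.
- have [cx c'x dt] := transition_cimg ov.
  have [e' ad'] := g2_adapted c'x.
  rewrite (g2_starE ad') (g2_starE (g2_transition ov ad')) derive_rows // !g2_dual_tform.
  by rewrite mulmxA.
Qed.

Lemma cimg_cylinder (I : set R) (c : chart (cylinder A I)) (y : 'rV[R]_(7 + 1)) :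
  cimg c y <-> cimg (c : chart A) (lsubmx y) /\ I (tcoord y).
Proof.
split=> [[[t p] /= [It cp] <-]|[[p cp px] It]].
  by rewrite row_mxKl /tcoord row_mxKr mxE eqxx mulr1n; split=> //; exists p.
exists (tcoord y, p) => //=; rewrite px -[RHS]hsubmxK; congr row_mx.
by rewrite [RHS]mx11_scalar.
Qed.

Lemma warped_formE I f c (y : 'rV[R]_(7 + 1)) e v :
  adapted g2_model (phi c (lsubmx y)) e ->
  warped_form phi I f c y v =
  spin7_model (warp_coframe (f (tcoord y)) e : 'M[R]_8) v.
Proof.
move=> ad; rewrite spin7_model_warp /warped_form /form_wedge /pull_form (g2_starE ad).
have -> // : (fun v : 'M[R]_(3, 7 + 1) => phi c (lsubmx y) (lsubmx v)) =
  (fun u => g2_model e (lsubmx u)) by apply/funext => u; exact: ad.2.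
Qed.

Lemma open_cylinder (O : set 'rV[R]_7) (I : set R) : open O -> open I ->
  open [set y : 'rV[R]_(7 + 1) | O (lsubmx y) /\ I (tcoord y)].
Proof.
move=> oO oI; apply: openI.
  by apply: open_comp => // u _; exact: lsubmx_continuous.
by apply: open_comp => // u _; exact: (@tcoord_continuous R 7).
Qed.

Lemma smooth_warp_coframe (O : set 'rV[R]_7) (I : set R) (e : 'rV[R]_7 -> 'M[R]_7) :
  open O -> open I -> smooth_on O e ->
  smooth_on [set y : 'rV[R]_(7 + 1) | O (lsubmx y) /\ I (tcoord y)]
    (fun y => warp_coframe (tcoord y) (e (lsubmx y)) : 'M[R]_8).
Proof.
move=> oO oI se; set U := [set _ | _]; have oU : open U by exact: open_cylinder.
have st : smooth_on U (@tcoord R 7) by apply: smooth_linear; exact: tcoord_continuous.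
have sE : smooth_on U (fun y : 'rV[R]_(7 + 1) => e (lsubmx y)).
  have := smooth_comp_linear (L := lsubmx) (@lsubmx_continuous R 7) oO se.
  by apply: smooth_onW => y [].
apply: smooth_mx => // i j.
pose i' : 'I_(7 + 1) := i; pose j' : 'I_(7 + 1) := j.
case: (split_ordP i') => p ip; case: (split_ordP j') => q jq.
- apply: (@eq_smooth_on _ _ _ U (fun y => tcoord y * (e (lsubmx y)) p q : R^o)) => //.
    move=> y _; rewrite -[i]/i' -[j]/j' ip jq /warp_coframe.
    by rewrite (@block_mxEul R 7 1 7 1) mxE.
  by apply: smooth_mul => //; exact: smooth_entry.
- apply: (@eq_smooth_on _ _ _ U (fun y => 0 : R^o)) => //; last exact: smooth_cst.
  by move=> y _; rewrite -[i]/i' -[j]/j' ip jq (@block_mxEur R 7 1 7 1) mxE.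
- apply: (@eq_smooth_on _ _ _ U (fun y => 0 : R^o)) => //; last exact: smooth_cst.
  by move=> y _; rewrite -[i]/i' -[j]/j' ip jq (@block_mxEdl R 7 1 7 1) mxE.
apply: (@eq_smooth_on _ _ _ U (fun y => (1%:M : 'M[R]_1) p q : R^o)) => //;
  last exact: smooth_cst.
by move=> y _; rewrite -[i]/i' -[j]/j' ip jq (@block_mxEdr R 7 1 7 1).
Qed.

End G2Star.

(** * The Spin(7)-structure of the cone *)

Section Cone.
Variables (R : realType) (M : topologicalType) (A : atlas R 7 M) (phi : dform A 3).
Hypothesis hM : smooth_manifold A.
Hypothesis hphi : g2_structure phi.

Local Notation ray := (`]0, +oo[%classic : set R).

Lemma rayE t : ray t = (0 < t).
Proof. by rewrite /= in_itv /= andbT. Qed.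

Lemma open_ray : open ray.
Proof. exact: interval_open. Qed.

Lemma cone_adapted_on c (U : set 'rV[R]_7) e : adapted_on g2_model phi c U e ->
  adapted_on (A := cylinder A ray) spin7_model (warped_form phi ray id) c
    [set y : 'rV[R]_(7 + 1) | U (lsubmx y) /\ ray (tcoord y)]
    (fun y => warp_coframe (tcoord y) (e (lsubmx y)) : 'M[R]_8).
Proof.
move=> [oU Uc se ad]; split.
- by apply: open_cylinder => //; exact: open_ray.
- by move=> y [Uy ty]; apply/cimg_cylinder; split => //; exact: Uc.
- by apply: smooth_warp_coframe => //; exact: open_ray.
move=> y [Uy ty]; have ady := ad _ Uy; split.
  apply: warp_coframe_unit ady.1; by move: ty; rewrite rayE => /gt_eqF ->.
by move=> v; rewrite (warped_formE _ _ _ ady).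
Qed.

Lemma cylinder_overlap (I : set R) (c c' : chart (cylinder A I)) (y : 'rV[R]_(7 + 1)) :
  overlap c c' y -> overlap (c : chart A) (c' : chart A) (lsubmx y) /\ I (tcoord y).
Proof.
move=> [[t p] /= [[It cp] [_ c'p]] <-].
by rewrite row_mxKl /tcoord row_mxKr mxE eqxx mulr1n; split => //; exists p.
Qed.

Lemma transition_cylinder (I : set R) (c c' : chart (cylinder A I)) :
  transition c c' = (fun y : 'rV[R]_(7 + 1) =>
    row_mx (transition (c : chart A) (c' : chart A) (lsubmx y)) (rsubmx y) : 'rV[R]_(7 + 1)).
Proof.
apply/funext => y; rewrite /transition /=; congr row_mx.
by rewrite [RHS]mx11_scalar.
Qed.

Lemma derive_transition_cylinder (I : set R) (c c' : chart (cylinder A I))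
    (y z : 'rV[R]_(7 + 1)) :
  differentiable (transition (c : chart A) (c' : chart A)) (lsubmx y) ->
  'D_z (transition c c') y =
  row_mx ('D_(lsubmx z) (transition (c : chart A) (c' : chart A)) (lsubmx y)) (rsubmx z)
  :> 'rV[R]_(7 + 1).
Proof.
move=> dt; rewrite transition_cylinder.
set g := transition _ _ in dt *.
have Dl i : is_derive y z (fun y : 'rV[R]_(7 + 1) => g (lsubmx y) 0 i : R^o)
    (('D_(lsubmx z) g (lsubmx y)) 0 i).
  rewrite -derive_entry; last exact: diff_derivable.
  exact: (is_derive_lsubmx z (differentiable_entry 0 i dt)).
have Dr (i : 'I_1) : is_derive y z (fun y : 'rV[R]_(7 + 1) => rsubmx y 0 i : R^o) (rsubmx z 0 i).
  rewrite (ord1 i); apply: is_derive_eq (is_derive_tcoord z (f := id) _) _ => //.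
  by rewrite derive_id mulr1.
have E i : is_derive y z
   (fun y : 'rV[R]_(7 + 1) => (row_mx (g (lsubmx y)) (rsubmx y) : 'rV[R]_(7 + 1)) 0 i : R^o)
   ((row_mx ('D_(lsubmx z) g (lsubmx y)) (rsubmx z) : 'rV[R]_(7 + 1)) 0 i).
  case: (split_ordP i) => j ->.
    by rewrite row_mxEl; under eq_fun do rewrite row_mxEl; exact: Dl.
  by rewrite row_mxEr; under eq_fun do rewrite row_mxEr; exact: Dr.
have dm : derivable (fun y : 'rV[R]_(7 + 1) =>
    row_mx (g (lsubmx y)) (rsubmx y) : 'rV[R]_(7 + 1)) y z.
  by apply/derivable_mxP => i j; rewrite (ord1 i); have [] := E j.
apply/rowP => j; rewrite -derive_entry //; by have [_ ->] := E j.
Qed.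

(** Each property is read off the local expression as the Spin(7) model in a warped coframe. For
    compatibility, the transition moves only the fiber coordinates, and the coframe of [c'] is
    pulled back by the fiber Jacobian. *)
Lemma cone_form : is_form (A := cylinder A ray) (warped_form phi ray id).
Proof.
split=> [c y /cimg_cylinder[cy ty]|c v vs y cy|c c' y v ov].
- have [e ad] := g2_adapted hphi cy.
  rewrite (_ : warped_form _ _ _ _ _ = spin7_model (warp_coframe (tcoord y) e : 'M[R]_8));
    first exact: alternating_spin7_model.
  by apply/funext => v; exact: warped_formE.
- have /cimg_cylinder[cx ty] := cy.
  have [U [e [Ux ado]]] := hphi.2 c _ cx.
  have [oV _ sV adV] := cone_adapted_on ado.
  set W := [set _ | _] in oV sV adV.
  have : smooth_on W (fun y => warped_form phi ray id c y v : R^o); last first.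
    by move=> s; apply: s; split.
  apply: (@eq_smooth_on _ _ _ W (fun y => tform (fun l => (spin7_coef l)%:~R)
    (v *m (warp_coframe (tcoord y) (e (lsubmx y)) : 'M[R]_8)) : R^o)) => //.
    by move=> z Wz; rewrite (adV z Wz).2 spin7_modelE.
  by apply: smooth_tform => //; exact: smooth_mulmx.
have [ov' ty] := cylinder_overlap ov.
have [cx c'x dt] := transition_cimg hM ov'.
have [e' ad'] := g2_adapted hphi c'x.
have ad := g2_transition hM hphi ov' ad'.
have Tl : lsubmx (transition c c' y : 'rV[R]_(7 + 1)) =
    transition (c : chart A) (c' : chart A) (lsubmx y).
  by rewrite transition_cylinder row_mxKl.
have Tr : tcoord (transition c c' y : 'rV[R]_(7 + 1)) = tcoord y.
  by rewrite transition_cylinder /tcoord row_mxKr.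
rewrite (warped_formE _ _ _ ad) (@warped_formE _ _ _ _ _ _ _ _ e') ?Tl // Tr !spin7_modelE.
congr (tform _ _); rewrite !(@mul_warp_coframe R 7).
set w := \matrix_(i < 4) _.
have wE i : row i w = row_mx (row i (@lsubmx R 4 7 1 v) *m jacobian (transition (c : chart A) (c' : chart A)) (lsubmx y))
   (rsubmx (row i (v : 'M[R]_(4, 7 + 1)))) :> 'rV[R]_(7 + 1).
  rewrite rowK derive_transition_cylinder // deriveEjacobian //.
  by congr (row_mx (_ *m _) _); apply/rowP => j; rewrite !mxE.
have -> : @lsubmx R 4 7 1 w = @lsubmx R 4 7 1 v *m
    jacobian (transition (c : chart A) (c' : chart A)) (lsubmx y).
  apply/row_matrixP => i; rewrite row_mul -[RHS](@row_mxKl R 1 7 1 _ (rsubmx (row i (v : 'M[R]_(4, 7 + 1))))) -wE.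
  by apply/rowP => j; rewrite !mxE.
have -> : @rsubmx R 4 7 1 w = @rsubmx R 4 7 1 v.
  apply/row_matrixP => i; have := congr1 (@rsubmx R 1 7 1) (wE i); rewrite row_mxKr => E.
  by apply/rowP => j; move/rowP/(_ j): E; rewrite !mxE.
by rewrite mulmxA.
Qed.

Lemma cone_structure : @spin7_structure R _ (cylinder A ray) (warped_form phi ray id).
Proof.
split; first exact: cone_form.
move=> c y /cimg_cylinder[cx ty].
have [U [e [Ux ado]]] := hphi.2 c _ cx.
exists [set y : 'rV[R]_(7 + 1) | U (lsubmx y) /\ ray (tcoord y)].
exists (fun y => warp_coframe (tcoord y) (e (lsubmx y)) : 'M[R]_8).
by split; [split|exact: cone_adapted_on].
Qed.
End Cone.

(** * The Levi-Civita connection of the cone *)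

Section ConeConnection.
Variables (R : realType) (U : set 'rV[R]_7) (e : 'rV[R]_7 -> 'M[R]_7).
Variable omega : 'I_7 -> 'I_7 -> 'rV[R]_7 -> covec R 1 7.
Hypotheses (oU : open U) (se : smooth_on U e) (ue : forall x, U x -> e x \in unitmx).
Hypothesis lc : levi_civita U e omega.

Lemma linear_alternating1 n (a : covec R 1 n) :
  (forall s (u v : 'rV[R]_n), a (s *: u + v) = s * a u + a v) -> is_alternating a.
Proof.
move=> La; split=> [v v1 v2 i s|v i j]; last by rewrite (ord1 i) (ord1 j) eqxx.
by rewrite (ord1 i) !row_id => -> _ _.
Qed.

(** Dictated by [d (t e^i) = - omega_ij /\ (t e^j) - e^i /\ dt]: tangent entries are those of the
    fiber, and the mixed entry is [e^i] itself, independent of [t]. *)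
Definition cone_connection (i j : 'I_8) (y : 'rV[R]_8) : covec R 1 8 := fun v =>
  let x := @lsubmx R 1 7 1 y in let u := @lsubmx R 1 7 1 v in
  match fintype.split (i : 'I_(7 + 1)), fintype.split (j : 'I_(7 + 1)) with
  | inl i, inl j => omega i j x u
  | inl i, inr _ => (u *m e x) 0 i
  | inr _, inl j => - (u *m e x) 0 j
  | inr _, inr _ => 0
  end.

Local Notation l_ i := (lshift 1 (i : 'I_7) : 'I_8).
Local Notation r_ := (rshift 7 (0 : 'I_1) : 'I_8).
Local Notation cc := cone_connection.

Lemma cone_ll i j y v : cc (l_ i) (l_ j) y v = omega i j (@lsubmx R 1 7 1 y) (@lsubmx R 1 7 1 v).
Proof. by rewrite /cc !(unsplitK (inl _)). Qed.

Lemma cone_lr i y v : cc (l_ i) r_ y v = (@lsubmx R 1 7 1 v *m e (@lsubmx R 1 7 1 y)) 0 i.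
Proof. by rewrite /cc !(unsplitK (inl _)) (unsplitK (inr _)). Qed.

Lemma cone_rl j y v : cc r_ (l_ j) y v = - (@lsubmx R 1 7 1 v *m e (@lsubmx R 1 7 1 y)) 0 j.
Proof. by rewrite /cc !(unsplitK (inl _)) (unsplitK (inr _)). Qed.

Lemma cone_rr y v : cc r_ r_ y v = 0.
Proof. by rewrite /cc !(unsplitK (inr _)). Qed.

Variant cone_index_spec : 'I_8 -> Type :=
  | ConeTangent i : cone_index_spec (l_ i)
  | ConeRadial : cone_index_spec r_.

Lemma cone_indexP i : cone_index_spec i.
Proof.
pose i' : 'I_(7 + 1) := i; rewrite -[i]/i'; case: (split_ordP i') => j ->.
  exact: ConeTangent.
by rewrite (ord1 j); exact: ConeRadial.
Qed.

Lemma sum_cone (F : 'I_8 -> R) : \sum_i F i = \sum_(i < 7) F (l_ i) + F r_.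
Proof. by rewrite (@big_split_ord _ _ _ 7 1) /= big_ord1. Qed.

Local Notation V := [set y : 'rV[R]_(7 + 1) | U (lsubmx y) /\ (`]0, +oo[%classic : set R) (tcoord y)].

Let smooth_lsub (g : 'rV[R]_7 -> R^o) : smooth_on U g ->
  smooth_on V (fun y : 'rV[R]_(7 + 1) => g (lsubmx y)).
Proof.
move=> sg; have := smooth_comp_linear (L := lsubmx) (@lsubmx_continuous R 7) oU sg.
by apply: smooth_onW => y [].
Qed.

Lemma omega_add i j x s (u v : 'rV[R]_7) : U x ->
  omega i j x (s *: u + v) = s * omega i j x u + omega i j x v.
Proof. by move=> Ux; apply: alternating1_linear; exact: (connection_linear lc). Qed.

Lemma cone_levi_civita :
  levi_civita (V : set 'rV[R]_8)
    (fun y : 'rV[R]_(7 + 1) => warp_coframe (tcoord y) (e (lsubmx y)) : 'M[R]_8) cc.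
Proof.
have oV : open V by apply: open_cylinder => //; exact: open_ray.
have ce (u : 'rV[R]_7) k : smooth_on U (fun x => (u *m e x) 0 k : R^o).
  by apply: smooth_entry => //; exact: smooth_mulmx.
split.
- move=> i j y [Uy ty]; apply: linear_alternating1 => s u v.
  have L : @lsubmx R 1 7 1 (s *: u + v) = s *: @lsubmx R 1 7 1 u + @lsubmx R 1 7 1 v.
    by rewrite linearP.
  case: (cone_indexP i) => [p|]; case: (cone_indexP j) => [q|];
    rewrite ?cone_ll ?cone_lr ?cone_rl ?cone_rr ?L ?omega_add //.
  + by rewrite mulmxDl -scalemxAl !mxE.
  + by rewrite mulmxDl -scalemxAl !mxE opprD mulrN.
  + by rewrite mulr0 addr0.
- move=> i j v; case: (cone_indexP i) => [p|]; case: (cone_indexP j) => [q|].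
  + apply: (eq_smooth_on oV (fun y _ => esym (cone_ll p q y v))).
    exact: (smooth_lsub (connection_smooth lc p q _)).
  + apply: (eq_smooth_on oV (fun y _ => esym (cone_lr p y v))).
    exact: (smooth_lsub (ce _ p)).
  + apply: (eq_smooth_on oV (fun y _ => esym (cone_rl q y v))).
    by apply: smooth_opp => //; exact: (smooth_lsub (ce _ q)).
  + apply: (eq_smooth_on oV (fun y _ => esym (cone_rr y v))); exact: smooth_cst.
- move=> i j y v [Uy ty]; case: (cone_indexP i) => [p|]; case: (cone_indexP j) => [q|];
    rewrite ?cone_ll ?cone_lr ?cone_rl ?cone_rr ?opprK ?oppr0 //.
  exact: (connection_skew lc).
move=> i y v [Uy ty].
set et := (fun y : 'rV[R]_8 => _).
have etE y' (u : 'rV[R]_8) : u *m et y' =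
   row_mx (tcoord (y' : 'rV[R]_(7 + 1)) *: (@lsubmx R 1 7 1 u *m e (@lsubmx R 1 7 1 y')))
     (@rsubmx R 1 7 1 u) :> 'rV[R]_(7 + 1).
  exact: (@mul_warp_coframe R 7).
rewrite extd_1form; under eq_bigr do rewrite wedge_1_1.
rewrite sum_cone /coframe_form !etE (@row_mxEr R 1 7 1).
set u0 := row 0 v; set u1 := row 1 v.
have et_r z (u : 'rV[R]_8) : 'D_z (fun y' => (u *m et y') 0 r_ : R^o) y = 0.
  rewrite (_ : (fun y' => _) = cst (@rsubmx R 1 7 1 u 0 0)) ?derive_cst //.
  by apply/funext => y'; rewrite etE (@row_mxEr R 1 7 1).
case: (cone_indexP i) => [p|]; last first.
  rewrite !et_r !cone_rr !mul0r !subr0 addr0 -sumrN big1 // => j _.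
  rewrite !cone_rl (@row_mxEl R 1 7 1) [in X in _ * X]mxE (@row_mxEl R 1 7 1) [in X in _ - _ * X]mxE; ring.
have et_l z (u : 'rV[R]_8) : 'D_z (fun y' => (u *m et y') 0 (l_ p) : R^o) y =
    tcoord (z : 'rV[R]_(7 + 1)) * (@lsubmx R 1 7 1 u *m e (@lsubmx R 1 7 1 y)) 0 p +
    tcoord (y : 'rV[R]_(7 + 1)) *
      (@lsubmx R 1 7 1 u *m 'D_(@lsubmx R 1 7 1 z) e (@lsubmx R 1 7 1 y)) 0 p.
  have de := smooth_differentiable se Uy.
  pose g x := (@lsubmx R 1 7 1 u *m e x) 0 p : R^o.
  have dg : differentiable g (@lsubmx R 1 7 1 y).
    by apply: differentiable_entry; exact: differentiable_mulmx.
  rewrite (_ : (fun y' => _) = (fun y' : 'rV[R]_(7 + 1) => tcoord y' * g (lsubmx y'))); last first.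
    by apply/funext => y'; rewrite etE (@row_mxEl R 1 7 1) mxE.
  have did : differentiable (id : R^o -> R^o) (@tcoord R 7 y) by [].
  have Dt := @is_derive_tcoord R 7 id y z did.
  have [_ ->] := is_derive_mulf Dt (@is_derive_lsubmx R 7 g y z dg).
  rewrite derive_id mulr1 /g; congr (_ + _ * _).
  rewrite derive_entry; last by apply: diff_derivable; exact: differentiable_mulmx.
  by rewrite derive_mulmx.
rewrite !et_l !cone_lr.
have := dcoframe se lc p (@lsubmx R 1 7 1 u0) (@lsubmx R 1 7 1 u1) Uy.
set x := @lsubmx R 1 7 1 y; set a0 := @lsubmx R 1 7 1 u0; set a1 := @lsubmx R 1 7 1 u1 => E.
have -> : \sum_j (cc (l_ p) (l_ j) y u0 * (row_mx (tcoord (y : 'rV[R]_(7 + 1)) *: (a1 *m e x))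
      (@rsubmx R 1 7 1 u1) : 'rV[R]_(7 + 1)) 0 (l_ j) -
    cc (l_ p) (l_ j) y u1 * (row_mx (tcoord (y : 'rV[R]_(7 + 1)) *: (a0 *m e x))
      (@rsubmx R 1 7 1 u0) : 'rV[R]_(7 + 1)) 0 (l_ j)) =
    - (tcoord (y : 'rV[R]_(7 + 1)) * ((a1 *m 'D_a0 e x) 0 p - (a0 *m 'D_a1 e x) 0 p)).
  rewrite E mulrN opprK mulr_sumr; apply: eq_bigr => j _.
  have sE s (w : 'rV[R]_7) : (s *: w) 0 j = s * w 0 j by rewrite mxE.
  by rewrite !cone_ll !(@row_mxEl R 1 7 1) !sE; ring.
rewrite !(@row_mxEr R 1 7 1) /tcoord.
have K (s0 s1 t A B C D : R) : s0 * A + t * C - (s1 * B + t * D) =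
    - (- (t * (C - D)) + (B * s1 - A * s0)) by ring.
exact: K.
Qed.

End ConeConnection.

(** * Curvature of the cone *)

Section ConeCurvature.
Variables (R : realType) (U : set 'rV[R]_7) (e : 'rV[R]_7 -> 'M[R]_7).
Variable omega : 'I_7 -> 'I_7 -> 'rV[R]_7 -> covec R 1 7.
Hypotheses (oU : open U) (se : smooth_on U e) (ue : forall x, U x -> e x \in unitmx).
Hypothesis lc : levi_civita U e omega.

Local Notation l_ i := (lshift 1 (i : 'I_7) : 'I_8).
Local Notation r_ := (rshift 7 (0 : 'I_1) : 'I_8).
Local Notation cc := (cone_connection e omega).
Local Notation lsub := (@lsubmx R 1 7 1).

(** The Gauss equation: the intermediate radial index adds [omega_i8 /\ omega_8j = - e^i /\ e^j]. *)
Lemma curvature_cone i j (y a b : 'rV[R]_8) : U (lsub y) ->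
  curvature cc (l_ i) (l_ j) y (col_mx a b : 'M[R]_(1 + 1, 8)) =
  curvature omega i j (lsub y) (col_mx (lsub a) (lsub b) : 'M[R]_(1 + 1, 7)) -
  ((lsub a *m e (lsub y)) 0 i * (lsub b *m e (lsub y)) 0 j -
   (lsub b *m e (lsub y)) 0 i * (lsub a *m e (lsub y)) 0 j).
Proof.
move=> Uy; rewrite /curvature !extd_1form !row0_col_mx !row1_col_mx.
have D (z w : 'rV[R]_8) : 'D_z (cc (l_ i) (l_ j) ^~ w : 'rV[R]_8 -> R^o) y =
    'D_(lsub z) (omega i j ^~ (lsub w) : 'rV[R]_7 -> R^o) (lsub y).
  rewrite (_ : (fun _ => _) = (fun y : 'rV[R]_(7 + 1) => omega i j (lsubmx y) (lsub w) : R^o));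
    last by apply/funext => y'; exact: cone_ll.
  have := @is_derive_lsubmx R 7 (omega i j ^~ (lsub w)) y z.
  case=> //; exact: smooth_differentiable (connection_smooth lc i j _) Uy.
rewrite !D -[RHS]addrA; congr (_ + _).
rewrite sum_cone; congr (_ + _).
  by apply: eq_bigr => k _; rewrite !wedge_1_1 !row0_col_mx !row1_col_mx !cone_ll.
by rewrite !wedge_1_1 !row0_col_mx !row1_col_mx !cone_lr !cone_rl !mulrN opprB opprK addrC.
Qed.

(** All connection forms vanish on a radial [a] and their coefficients do not depend on [t]. In the
    Ricci sum this disposes of the radial index, whose first argument is the radial frame vector. *)
Lemma curvature_cone_radial j (y a b : 'rV[R]_8) : U (lsub y) -> lsub a = 0 ->
  curvature cc r_ (l_ j) y (col_mx a b : 'M[R]_(1 + 1, 8)) = 0.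
Proof.
move=> Uy a0; rewrite /curvature extd_1form row0_col_mx row1_col_mx.
have D (z w : 'rV[R]_8) : 'D_z (cc r_ (l_ j) ^~ w : 'rV[R]_8 -> R^o) y =
    - (lsub w *m 'D_(lsub z) e (lsub y)) 0 j.
  have de := smooth_differentiable se Uy.
  pose g x := (lsub w *m e x) 0 j : R^o.
  have dg : differentiable g (lsub y).
    by apply: differentiable_entry; exact: differentiable_mulmx.
  rewrite (_ : (fun _ => _) = - (fun y : 'rV[R]_(7 + 1) => g (lsubmx y)));
    last by apply/funext => y'; exact: cone_rl.
  have [dgl Dgl] := @is_derive_lsubmx R 7 g y z dg.
  rewrite deriveN // Dgl /g derive_entry; last first.
    by apply: diff_derivable; exact: differentiable_mulmx.
  by rewrite derive_mulmx.
have o0 k l : omega k l (lsub y) 0 = 0.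
  have := alternating1_linear (connection_linear lc k l Uy) 1 0 0.
  by rewrite scaler0 addr0 mul1r; lra.
rewrite !D a0 derive0 mulmx0 mul0mx mxE oppr0 subr0 add0r.
rewrite sum_cone wedge_1_1 !row0_col_mx !row1_col_mx !cone_rr !mul0r subr0 addr0.
rewrite big1 // => k _.
rewrite wedge_1_1 !row0_col_mx !row1_col_mx !cone_rl !cone_ll a0 o0 mul0mx mxE.
by rewrite oppr0 mul0r mulr0 subr0.
Qed.

(** At [t = 1] the tangent part of the cone frame is the frame of the fiber. The trace of
    [e^i /\ e^j] over seven directions gives 7 - 1 = 6. *)
Lemma ricci_cone x j l : U x ->
  let y : 'rV[R]_(7 + 1) := row_mx x 1%:M in
  ricci (fun y : 'rV[R]_(7 + 1) => warp_coframe (tcoord y) (e (lsubmx y)) : 'M[R]_8) cc y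
    (l_ j) (l_ l) = ricci e omega x j l - 6 * (j == l)%:R.
Proof.
move=> Ux y; have ly : lsub y = x by rewrite /y row_mxKl.
have ty : tcoord y = 1 by rewrite /tcoord /y row_mxKr mxE.
have ux := ue Ux.
pose B : 'M[R]_(7 + 1) := block_mx (invmx (e x)) 0 0 1%:M.
have invE : invmx (warp_coframe (tcoord y) (e (lsubmx y)) : 'M[R]_8) = B.
  have BE : B *m warp_coframe (tcoord y) (e (lsubmx y)) = 1%:M.
    rewrite -/(lsub y) ly ty /B /warp_coframe scale1r mulmx_block.
    by rewrite !mulmx0 !mul0mx !addr0 !add0r mulVmx // mulmx1 -scalar_mx_block.
  have u := warp_coframe_unit (oner_neq0 R) ux.
  rewrite -/(lsub y) ly ty in BE *.
  by rewrite -[LHS]mul1mx -BE -mulmxA mulmxV // mulmx1.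
have rowl i : lsub (row (l_ i) B) = row i (invmx (e x)).
  by apply/rowP => k; rewrite [LHS]mxE [LHS]mxE (@block_mxEul R 7 1 7 1) [RHS]mxE.
have rowr : lsub (row r_ B) = 0.
  by apply/rowP => k; rewrite [LHS]mxE [LHS]mxE (@block_mxEdl R 7 1 7 1).
have Uy : U (lsub y) by rewrite ly.
have E i k : (row i (invmx (e x)) *m e x) 0 k = (i == k)%:R.
  by rewrite -row_mul mulVmx // !mxE.
rewrite /ricci invE sum_cone curvature_cone_radial // addr0.
under eq_bigr => i _ do rewrite curvature_cone // !rowl ly !E eqxx mul1r.
rewrite !sumrB; congr (_ - _); rewrite sumr_const card_ord.
rewrite (bigD1 l) //= eqxx mul1r big1 ?addr0 => [|i il]; last first.
  by rewrite eq_sym (negbTE il) mul0r.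
rewrite (eq_sym l) -mulr_natl; ring.
Qed.
End ConeCurvature.

(** Every Levi-Civita connection of the fiber extends to the cone, so Ricci flatness of the cone can
    be read on the slice [t = 1]. *)
Lemma einstein_fiber (R : realType) (M : topologicalType) (A : atlas R 7 M)
    (phi : dform A 3) :
  warped_einstein phi `]0, +oo[%classic id 0 -> einstein g2_model phi 6.
Proof.
move=> flat c U e omega ado lc x j l Ux.
have [oU Uc se ad] := ado.
have ue z : U z -> e z \in unitmx by move=> /ad[].
have Vy : [set y : 'rV[R]_(7 + 1) | U (lsubmx y) /\
    (`]0, +oo[%classic : set R) (tcoord y)] (row_mx x 1%:M).
  by split=> /=; rewrite ?row_mxKl // /tcoord row_mxKr mxE in_itv /= ltr01.
have := flat c _ _ _ (cone_adapted_on ado) (cone_levi_civita oU se lc) _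
  (lshift 1 (j : 'I_7) : 'I_8) (lshift 1 (l : 'I_7) : 'I_8) Vy.
by rewrite (ricci_cone se ue lc) // mul0r => /eqP; rewrite subr_eq0 => /eqP.
Qed.

(** * Warping functions *)

Section AffineWarping.
Variables (R : realType) (I : set R) (f : R -> R) (k : R).
Hypotheses (iI : is_interval I) (df : forall t, I t -> differentiable (f : R^o -> R^o) t).
Hypothesis fk : forall t, I t -> 'D_1 (f : R^o -> R^o) t = k.

Lemma affine_on_interval s t : I s -> I t -> f t - f s = k * (t - s).
Proof.
wlog st : s t / s <= t => [W Is It|Is It].
  have [/W|/ltW/W/(_ It Is) E] := leP s t; first exact.
  by rewrite -opprB E -mulrN opprB.
have sI x : x \in `[s, t]%R -> I x.
  by rewrite in_itv /=; exact: (iI Is It).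
have [||_ _ E] := @MVT_segment R f (fun=> k) s t st; last exact: E.
- move=> x /subset_itv_oo_cc/sI Ix; apply: DeriveDef (fk Ix).
  exact: diff_derivable (df Ix).
- apply: continuous_in_subspaceT => x; rewrite inE => /sI Ix.
  exact: differentiable_continuous (df Ix).
Qed.

(** A nonconstant affine function is injective and has equal increments over equal steps. Evenness
    of cosh and the symmetry of sin about [pi / 2] contradict the former; exp on 0, 1, 2 and sinh on
    1, 2, 3 contradict the latter. *)
Lemma affine_normal_warping mu lambda : (exists s t, [/\ I s, I t & f s != f t]) ->
  normal_warping mu lambda I f ->
  I = `]0, +oo[%classic /\ forall t, I t -> f t = t.
Proof.
move=> [s0 [t0 [Is0 It0 fst]]].
have k0 : k <> 0.
  move=> k0; have := affine_on_interval Is0 It0; rewrite k0 mul0r => /subr0_eq E.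
  by rewrite E eqxx in fst.
have aff s t : I s -> I t -> f s = f t -> s = t.
  move=> Is It E; have := affine_on_interval Is It; rewrite E subrr => /esym/eqP.
  by rewrite mulf_eq0 => /orP[/eqP//|/eqP/subr0_eq].
have e1 : 1 < expR 1 :> R by rewrite expR_gt1.
have E2 : expR 2 = expR 1 ^+ 2 :> R by rewrite -expRM_natl mulr1.
have E3 : expR 3 = expR 1 ^+ 3 :> R by rewrite -expRM_natl mulr1.
case=> [[_ _ II fE]|[[_ _ II fE]|[[_ _ II fE]|[[_ _ II fE]|[_ _ II fE]]]]].
- have I1 : I 1 by rewrite II.
  have IN1 : I (-1) by rewrite II.
  have := aff _ _ I1 IN1; rewrite !fE // opprK addrC => /(_ erefl) ?; exfalso; lra.
- have I0 : I 0 by rewrite II.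
  have I1 : I 1 by rewrite II.
  have I2 : I 2 by rewrite II.
  have A := affine_on_interval I0 I1; have B := affine_on_interval I1 I2.
  rewrite !fE // expR0 E2 in A B; exfalso; nra.
- have I1 : I 1 by rewrite II /= in_itv /= andbT.
  have I2 : I 2 by rewrite II /= in_itv /= andbT.
  have I3 : I 3 by rewrite II /= in_itv /= andbT.
  have A := affine_on_interval I1 I2; have B := affine_on_interval I2 I3.
  rewrite !fE // !expRN E2 E3 in A B.
  move: e1 A B; set e := expR 1 => e1 A B.
  have e0 : e != 0 by rewrite gt_eqF // (lt_trans ltr01).
  (* Equality of the two increments of sinh, cleared of denominators by [e ^+ 3]; both factors are
     nonzero since [e > 1]. *)
  have : (e - 1) ^+ 2 * (e ^+ 4 - 1) = 0.
    have C : e ^+ 2 - (e ^+ 2)^-1 - (e - e^-1) = e ^+ 3 - (e ^+ 3)^-1 - (e ^+ 2 - (e ^+ 2)^-1) by lra.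
    have : e ^+ 3 * (e ^+ 2 - (e ^+ 2)^-1 - (e - e^-1)) = e ^+ 3 * (e ^+ 3 - (e ^+ 3)^-1 - (e ^+ 2 - (e ^+ 2)^-1)) by rewrite C.
    have -> : e ^+ 3 * (e ^+ 2 - (e ^+ 2)^-1 - (e - e^-1)) = e ^+ 5 - e - (e ^+ 4 - e ^+ 2) by field.
    have -> : e ^+ 3 * (e ^+ 3 - (e ^+ 3)^-1 - (e ^+ 2 - (e ^+ 2)^-1)) = e ^+ 6 - 1 - (e ^+ 5 - e) by field.
    move=> D; have -> : (e - 1) ^+ 2 * (e ^+ 4 - 1) = e ^+ 6 - 1 - (e ^+ 5 - e) - (e ^+ 5 - e - (e ^+ 4 - e ^+ 2)) by ring.
    by rewrite D subrr.
  move=> /eqP; rewrite mulf_eq0 expf_eq0 /= subr_eq0 gt_eqF //= subr_eq0.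
  by rewrite gt_eqF // exprn_egt1.
- by split.
have p0 := pi_gt0 R.
have I1 : I (pi / 4) by rewrite II /= in_itv /=; apply/andP; split; lra.
have I2 : I (pi - pi / 4) by rewrite II /= in_itv /=; apply/andP; split; lra.
have := aff _ _ I1 I2; rewrite !fE // sinB sinpi cospi mul0r sub0r mulN1r opprK => /(_ erefl) ?; exfalso; lra.
Qed.

End AffineWarping.

(** * Parallel warped structures *)

Section ClosedForms.
Variables (R : realType) (N : topologicalType) (B : atlas R 8 N) (Phi : dform B 4).

Lemma spin7_parallel_closed : spin7_parallel Phi -> form_eq (form_d Phi) (zero_form B 5).
Proof.
move=> [_ [l1 [l5 [[_ _ _ dE] l10 l50]]]] c x cx v.
rewrite dE // l50 // addr0 /form_wedge /wedge big1 ?mulr0 // => s _.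
by rewrite l10 // mulr0 mul0r.
Qed.

Lemma is_form_zero n (M : topologicalType) (A : atlas R n M) k : is_form (zero_form A k).
Proof.
split=> // [c x cx|c v]; last exact: smooth_cst.
by split=> // *; rewrite /zero_form mulr0 addr0.
Qed.

Lemma closed_spin7_parallel : spin7_structure Phi ->
  form_eq (form_d Phi) (zero_form B 5) -> spin7_parallel Phi.
Proof.
move=> sP dP; split=> //; exists (zero_form B 1), (zero_form B 5); split => //.
split; [exact: is_form_zero|exact: is_form_zero| |] => c x cx v.
  (* The star of the zero form vanishes whichever coframe is chosen. *)
  rewrite /form_wedge /wedge big1 ?mulr0 // => s _.
  rewrite [X in _ * X](_ : _ = 0) ?mulr0 // /spin7_star5 /form_star /coframe_star.
  by rewrite big1 ?mulr0 // => f _; rewrite mul0r.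
rewrite dP // addr0 /form_wedge /wedge big1 ?mulr0 // => s _.
by rewrite mulr0 mul0r.
Qed.

Lemma closed_spin7_ricci_flat :
  form_eq (form_d Phi) (zero_form B 5) -> einstein spin7_model Phi 0.
Proof.
move=> dP c U e omega [oU Uc se ad] lc x j l Ux; rewrite mul0r.
have ue z : U z -> e z \in unitmx by move=> /ad[].
apply: (ricci_flat oU se ue lc _ j l Ux) => z v Uz.
apply: (connection_spin7 oU se ue lc (Phi := Phi c)) => // [w u Uw|w u Uw].
  exact: (ad w Uw).2.
by apply: dP; exact: Uc.
Qed.

End ClosedForms.

Section WarpedDifferential.
Variables (R : realType) (M : topologicalType) (A : atlas R 7 M) (phi : dform A 3).
Hypotheses (hM : smooth_manifold A) (hphi : g2_structure phi).

Lemma extd_warped_form (I : set R) (f : R -> R) (c : chart A)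
    (y : 'rV[R]_(7 + 1)) (v : 'M[R]_(5, 7 + 1)) :
  cimg c (lsubmx y) -> differentiable (f : R^o -> R^o) (tcoord y) ->
  let t := tcoord y in let x := lsubmx y in
  extd (warped_form phi I f c) y v =
  \sum_(m < 5) (-1) ^+ m * rsubmx v m 0 *
    (f t ^+ 3 * extd (phi c) x (row' m (lsubmx v)) +
     4 * f t ^+ 3 * 'D_1 (f : R^o -> R^o) t * g2_star phi c x (row' m (lsubmx v))) +
  f t ^+ 4 * extd (g2_star phi c) x (lsubmx v).
Proof.
move=> cx df t x.
apply: (extd_cyl_form (O := cimg c) (a := phi c) (b := g2_star phi c)) => //.
- exact: (cimg_open hM).
- by move=> z w cz; exact: smooth_differentiable (form_smooth hphi.1 w) cz.
- by move=> z w cz; exact: smooth_differentiable (form_smooth (g2_star_form hM hphi) w) cz.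
move=> z cz; have [e [ue ad]] := g2_adapted hphi cz.
have -> : phi c z = g2_model e by apply/funext.
exact: perm_alternating_g2_model.
Qed.

Lemma cone_closed : nearly_parallel phi (-4) ->
  form_eq (form_d (warped_form phi `]0, +oo[%classic id)) (zero_form _ 5).
Proof.
move=> [dphi dpsi] c y /cimg_cylinder[cx ty] v.
have dphiE z w : cimg (c : chart A) z -> extd (phi c) z w = -4 * g2_star phi c z w by move=> cz; exact: dphi.
have dpsiE z w : cimg (c : chart A) z -> extd (g2_star phi c) z w = 0 by move=> cz; exact: dpsi.
rewrite /form_d extd_warped_form // dpsiE // mulr0 addr0 /zero_form big1 // => m _.
(* With [f' = 1], the torsion -4 cancels the factor 4 from the derivative of [t ^+ 4]. *)
by rewrite dphiE // derive_id; ring.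
Qed.

Section Converse.
Variables (I : set R) (f : R -> R).
Hypothesis wf : warping_function I f.
Hypothesis closed : form_eq (form_d (warped_form phi I f)) (zero_form (cylinder A I) 5).

Let df t : I t -> differentiable (f : R^o -> R^o) t.
Proof. by have [_ _ sf _ _] := wf => It; exact: smooth_differentiable sf It. Qed.

Let extd_warped_form0 c x t (v : 'M[R]_(5, 7 + 1)) : cimg c x -> I t ->
  \sum_(m < 5) (-1) ^+ m * rsubmx v m 0 *
    (f t ^+ 3 * extd (phi c) x (row' m (lsubmx v)) +
     4 * f t ^+ 3 * 'D_1 (f : R^o -> R^o) t * g2_star phi c x (row' m (lsubmx v))) +
  f t ^+ 4 * extd (g2_star phi c) x (lsubmx v) = 0.
Proof.
move=> cx It; pose y : 'rV[R]_(7 + 1) := row_mx x t%:M.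
have ly : lsubmx y = x by rewrite row_mxKl.
have ty : tcoord y = t by rewrite /tcoord row_mxKr mxE.
have := extd_warped_form I (f := f) (c := c) (y := y) v.
rewrite ly ty => /(_ cx (df It)) <-.
by apply: closed; apply/cimg_cylinder; rewrite ly ty.
Qed.

(** Closedness is tested on vectors tangent to the fiber ([row_mx w 0]): every [dt] factor vanishes,
    and [f t ^+ 4] can be cancelled. *)
Lemma closed_warped_star c x (w : 'M[R]_(5, 7)) : cimg c x ->
  extd (g2_star phi c) x w = 0.
Proof.
move=> cx; have [_ _ _ f0 [t [_ [It _ _]]]] := wf.
have := extd_warped_form0 (row_mx w 0) cx It.
rewrite row_mxKl row_mxKr big1 ?add0r => [/eqP|m _]; last by rewrite mxE mulr0 mul0r.
by rewrite mulf_eq0 expf_eq0 (negbTE (f0 t It)) => /eqP.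
Qed.

(** Closedness is tested on the unit vector of the coordinate [t] followed by four vectors tangent
    to the fiber: only the term [m = 0] survives, and [f t ^+ 3] can be cancelled. *)
Lemma closed_warped_d c x t (w : 'M[R]_(4, 7)) : cimg c x -> I t ->
  extd (phi c) x w = - 4 * 'D_1 (f : R^o -> R^o) t * g2_star phi c x w.
Proof.
move=> cx It; have [_ _ _ f0 _] := wf.
have := extd_warped_form0 (block_mx 0 1%:M w 0 : 'M[R]_(1 + 4, 7 + 1)) cx It.
rewrite closed_warped_star // mulr0 addr0 block_mxEh row_mxKl row_mxKr.
rewrite big_ord_recl big1 ?addr0 => [|m _].
  have -> : row' ord0 (col_mx 0 w : 'M[R]_(1 + 4, 7)) = w.
    apply/matrixP => i j; rewrite mxE.
    have -> : lift ord0 i = rshift 1 i by apply/val_inj.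
    exact: (@col_mxEd R 1 4 7).
  have -> : (col_mx 1%:M 0 : 'M[R]_(1 + 4, 1)) ord0 0 = 1.
    have -> : ord0 = lshift 4 (0 : 'I_1) by apply/val_inj.
    by rewrite (@col_mxEu R 1 4 1) mxE.
  rewrite expr0 !mul1r => /eqP E; apply/eqP; move: E.
  rewrite -subr_eq0 (_ : _ + _ - 0 = f t ^+ 3 * (extd (phi c) x w - - 4 * 'D_1 (f : R^o -> R^o) t * g2_star phi c x w));
    last by ring.
  by rewrite mulf_eq0 expf_eq0 (negbTE (f0 t It)) subr_eq0.
have -> : (col_mx 1%:M 0 : 'M[R]_(1 + 4, 1)) (lift ord0 m) 0 = 0.
  have -> : lift ord0 m = rshift 1 m by apply/val_inj.
  by rewrite (@col_mxEd R 1 4 1) mxE.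
by rewrite mulr0 mul0r.
Qed.

End Converse.

Lemma g2_dual_neq0 (e : 'M[R]_7) : e \in unitmx -> exists w, g2_dual e w != 0.
Proof.
(* The first four frame vectors pick out the coefficient 1 of [e^{1234}]. *)
move=> ue; pose h : {ffun 'I_4 -> 'I_7} := [ffun i : 'I_4 => inord i].
exists (rowsub h (invmx e)); rewrite g2_dual_tform mul_rowsub_mx mulVmx // tform_basis.
have -> : idx h = [:: 0; 1; 2; 3]%N; last by rewrite intr_eq0.
rewrite /idx; apply: (@eq_from_nth _ 0%N); first by rewrite size_map size_enum_ord.
rewrite size_map size_enum_ord => i i4.
rewrite -[i]/(nat_of_ord (Ordinal i4)) (nth_map (Ordinal i4)) ?size_enum_ord // nth_ord_enum.
by rewrite ffunE; move: i4; case: i => [|[|[|[|i]]]] //= _; rewrite inordK.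
Qed.

End WarpedDifferential.

Section Proposition.
Variables (R : realType) (M : topologicalType) (A : atlas R 7 M) (phi : dform A 3).
Hypotheses (hM : smooth_manifold A) (hM0 : [set: M] !=set0) (hphi : g2_structure phi).

Lemma cone_parallel : nearly_parallel phi (-4) ->
  parallel_warped phi `]0, +oo[%classic id.
Proof.
move=> np; have dP := cone_closed hM hphi np.
have flat := closed_spin7_ricci_flat dP.
split; last exact: closed_spin7_parallel (cone_structure hM hphi) dP.
- split.
  + exact: open_ray.
  + by move=> x y; rewrite !rayE => x0 _ z /andP[xz _]; rewrite rayE (lt_le_trans x0).
  + apply: (@smooth_linear R R^o `]0, +oo[%classic R^o idfun) => z; exact: cvg_id.
  + by move=> t; rewrite rayE => /gt_eqF ->.
  + exists 1, 2; rewrite !rayE; split; rewrite ?ltr01 ?ltr0n // lt_eqF //.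
    by rewrite ltr1n.
move=> _; exists 6, 0; split => //; first exact: einstein_fiber.
by do 3 right; left.
Qed.

Lemma parallel_warped_cone I f : parallel_warped phi I f ->
  [/\ I = `]0, +oo[%classic, forall t, I t -> f t = t & nearly_parallel phi (-4)].
Proof.
move=> [wf norm par]; have dP := spin7_parallel_closed par.
have [oI iI sf _ nc] := wf.
have df t : I t -> differentiable (f : R^o -> R^o) t.
  by move=> It; exact: smooth_differentiable sf It.
(* A point of [M] provides arguments [w] on which the dual form is nonzero; comparing the formula
   for [d phi] on them at two parameters shows that [f'] is constant. *)
have [p _] := hM0; have [c cp] := cdom_cover hM p.
have cx : cimg c (cmap c p) by exists p.
have [e ad] := g2_adapted hphi cx.
have [w w0] := g2_dual_neq0 ad.1; rewrite -(g2_starE ad) in w0.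
have [s [_ [Is _ _]]] := nc.
have fk t : I t -> 'D_1 (f : R^o -> R^o) t = 'D_1 (f : R^o -> R^o) s.
  move=> It; have := closed_warped_d hM hphi wf dP w cx It.
  rewrite (closed_warped_d hM hphi wf dP w cx Is) => /(mulIf w0)/eqP.
  by rewrite !mulNr eqr_opp => /eqP/mulfI ->.
(* Ricci flatness triggers the normalization. The [lambda] it returns is not identified with 0: the
   normal form is selected by the shape of [f] alone. *)
have [|mu [lambda [_ _ nw]]] := norm; first by exists 0; exact: closed_spin7_ricci_flat dP.
have [II fE] := affine_normal_warping iI df fk nc nw.
split=> //; split=> [c' x cx' v|c' x cx' v]; last exact: (closed_warped_star hM hphi wf dP v cx').
rewrite /form_d (closed_warped_d hM hphi wf dP v cx' Is).
(* On the open set [I], [f] coincides with the identity, so [f' = 1] and the torsion constant is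
   -4. *)
rewrite (@eq_derive_on _ _ _ (I : set R^o) _ id _ _ oI fE Is).
by rewrite derive_id mulr1.
Qed.

End Proposition.

Theorem proposition7p1 (R : realType) (M : topologicalType) (A : atlas R 7 M)
    (phi : dform A 3) (hM : smooth_manifold A) (hM0 : [set: M] !=set0)
    (hphi : g2_structure phi) :
  ((exists (I : set R) (f : R -> R), parallel_warped phi I f) <->
     nearly_parallel phi (-4)) /\
  (nearly_parallel phi (-4) ->
     parallel_warped phi `]0, +oo[%classic id /\
     forall (I : set R) (f : R -> R), parallel_warped phi I f ->
       [/\ I = `]0, +oo[%classic,
           forall t, I t -> f t = t &
           form_eq (warped_form phi I f)
             (fun c y v =>
                let t := rsubmx (y : 'rV_(7 + 1)) 0 0 in
                t ^+ 3 * form_wedge (pull_form I phi) (dt_form A I) c y v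
                + t ^+ 4 * pull_form I (g2_star phi) c y v)]).
Proof.
split; first split.
- by move=> [I [f /(parallel_warped_cone hM hM0 hphi)[]]].
- by move=> np; exists `]0, +oo[%classic, id; exact: cone_parallel.
move=> np; split; first exact: cone_parallel.
move=> I f /(parallel_warped_cone hM hM0 hphi)[II fE _]; split => //.
by move=> c y /cimg_cylinder[_ It] v; rewrite /warped_form fE.
Qed.
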